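(* Let $\mathcal{A},\mathcal{B}>0$ and let $f^{(L)},g^{(L)},f^{(R)},g^{(R)}$ be smooth real-valued functions on a neighbourhood of the origin in $\mathbb{R}^2$ with $$f^{(L)}(0,0)=f^{(R)}(0,0)=0,\quad \frac{\partial f^{(L)}}{\partial y}(0,0)=-\mathcal{A},\quad \frac{\partial f^{(R)}}{\partial y}(0,0)=1,\quad g^{(L)}(0,0)=\mathcal{B},\quad g^{(R)}(0,0)=1.$$ For $\varepsilon>0$ consider the hysteretic system with these left and right half-systems and hysteretic band $-\varepsilon\le x\le\varepsilon$, and let $q_I$ (which depends on $\varepsilon$ and on the fixed exit threshold $x^*$) denote the fraction of initial points $(0,y)$, $y\in I$, whose forward orbits head right, as defined in the context. Then, for every sufficiently small $\varepsilon$-independent $x^*>0$, there exists $\eta>0$ such that for all $y_{\min},y_{\max}$ (independent of $\varepsilon$) with $-\eta<y_{\min}<y_{\max}<0$, $$q_{[y_{\min},y_{\max}]}\to\frac{\mathcal{A}}{\mathcal{A}+\mathcal{B}}\quad\text{as }\varepsilon\to0^+.$$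
   Context: Hysteretic system: for $\varepsilon>0$, a state consists of a point $(x,y)$ near the origin together with a mode, left or right. In the left mode the point evolves by $(\dot x,\dot y)=(f^{(L)}(x,y),g^{(L)}(x,y))$ until $x=\varepsilon$ is reached, at which moment the mode switches to right. In the right mode the point evolves by $(\dot x,\dot y)=(f^{(R)}(x,y),g^{(R)}(x,y))$ until $x=-\varepsilon$ is reached, at which moment the mode switches to left. Thus the left field has the form $(-\mathcal{A}y+O(|x|)+O(2),\ \mathcal{B}+O(1))$ and the right field has the form $(y+O(|x|)+O(2),\ 1+O(1))$, where $O(k)$ denotes terms of order $k$ or larger in $(x,y)$. Heading right: fix an $\varepsilon$-independent $x^*>0$ (with $\varepsilon<x^*$), small enough that only dynamics local to the origin plays a role. An orbit ''heads right'' if it first exits the region $|x|<x^*$ at $x=x^*$. For $y<0$ let $\sigma_\varepsilon(y)=1$ if the forward orbit of $(0,y)$, started in the right mode, heads right, and $\sigma_\varepsilon(y)=0$ otherwise. For an interval $I$ of $y$-values, $$q_I=\frac{\int_I\sigma_\varepsilon(y)\,dy}{\int_I dy}.$$ *)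

(* Defs.v *)
From HB Require Import structures.
From mathcomp Require Import all_boot all_order all_algebra.
From mathcomp Require Import all_classical all_reals all_analysis.

Set Implicit Arguments.
Unset Strict Implicit.
Unset Printing Implicit Defensive.

Import Order.TTheory GRing.Theory Num.Theory.
Import numFieldNormedType.Exports.

Local Open Scope classical_set_scope.
Local Open Scope ring_scope.

Definition dx {R : realType} (h : R * R -> R) : R * R -> R :=
  fun p => 'D_((1, 0) : R * R) h p.

Definition dy {R : realType} (h : R * R -> R) : R * R -> R :=
  fun p => 'D_((0, 1) : R * R) h p.

(* For [U] open: all partial derivatives of [h] of order at most [k] exist and
   are continuous on [U]. The values of [h] outside [U] play no role. *)
Fixpoint Ck_on {R : realType} (k : nat) (U : set (R * R)) (h : R * R -> R)
    : Prop :=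
  (forall p, U p -> {for p, continuous h}) /\
  match k with
  | 0 => True
  | k'.+1 =>
      [/\ forall p, U p ->
            derivable h p ((1, 0) : R * R) /\ derivable h p ((0, 1) : R * R),
          Ck_on k' U (dx h) & Ck_on k' U (dy h)]
  end.

Definition smooth_on {R : realType} (U : set (R * R)) (h : R * R -> R) : Prop :=
  forall k, Ck_on k U h.

Inductive mode : Type := LeftMode | RightMode.

Definition other (m : mode) : mode :=
  match m with LeftMode => RightMode | RightMode => LeftMode end.

Definition mode_field {T : Type} (FL FR : T) (m : mode) : T :=
  match m with LeftMode => FL | RightMode => FR end.

(* The value of x at which the system switches from mode [m] to the other. *)
Definition threshold {R : realType} (eps : R) (m : mode) : R :=
  match m with LeftMode => eps | RightMode => - eps end.

(* The ODE is imposed on the open interval; continuity on the closed interval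
   then gives the one-sided equations at the endpoints. *)
Definition solves_on {R : realType} (U : set (R * R)) (F : R * R -> R * R)
    (a b : R) (x y : R -> R) : Prop :=
  [/\ {within `[a, b], continuous x},
      {within `[a, b], continuous y},
      forall t, t \in `[a, b] -> U (x t, y t) &
      forall t, t \in `]a, b[ ->
        is_derive t 1 x (F (x t, y t)).1 /\ is_derive t 1 y (F (x t, y t)).2].

(* [(x, y)], restricted to [0, T], is the forward orbit of [p] started in mode
   [m], in the phase space [U]. It undergoes [n] switches, at the times
   [s 1 <= ... <= s n]; between [s k] and [s k.+1] the mode is
   [iter k other m]. The last clause covers k = n as well: no switch is missed
   before the final time [T]. *)
Definition hysteretic_orbit {R : realType} (U : set (R * R))
    (FL FR : R * R -> R * R) (eps : R) (m : mode) (p : R * R) (T : R)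
    (x y : R -> R) : Prop :=
  exists (n : nat) (s : nat -> R),
    [/\ s 0%N = 0 /\ s n.+1 = T,
        (x 0, y 0) = p,
        forall k, (k <= n)%N -> s k <= s k.+1 /\
          solves_on U (mode_field FL FR (iter k other m)) (s k) (s k.+1) x y,
        forall k, (k < n)%N -> x (s k.+1) = threshold eps (iter k other m) &
        forall k, (k <= n)%N -> forall t, s k <= t < s k.+1 ->
          x t <> threshold eps (iter k other m)].

Definition heads_right {R : realType} (U : set (R * R))
    (FL FR : R * R -> R * R) (eps xs : R) (y0 : R) : Prop :=
  exists (T : R) (x y : R -> R),
    [/\ 0 <= T,
        hysteretic_orbit U FL FR eps RightMode (0, y0) T x y,
        forall t, 0 <= t < T -> `|x t| < xs &
        x T = xs].

Definition sigma {R : realType} (U : set (R * R)) (FL FR : R * R -> R * R)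
    (eps xs : R) : R -> R :=
  \1_[set y0 | heads_right U FL FR eps xs y0].

(* Since [sigma] is nonnegative, its integral is the supremum of the integrals
   of the simple functions below it, and makes sense without knowing in advance
   that [sigma] is measurable. *)
Definition q_right {R : realType} (U : set (R * R)) (FL FR : R * R -> R * R)
    (eps xs : R) (I : set R) : R :=
  (\int[lebesgue_measure]_(y in I) sigma U FL FR eps xs y) /
  (\int[lebesgue_measure]_(y in I) 1).

(* Main.v *)
(* Since [g > 0], the coordinate [y] increases along orbits and can be used as time. After the
   reflection [x -> -x] in the left mode, both modes become equations [dx/dt = phi t x] with
   [phi t x = k t + O(|x| + t^2)], where [k = 1] on the right and [k = A / B] on the left, and each
   phase runs from [x = e] to [x = -e]. A phase can only fail near the tangency [phi t (-e) = 0]: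
   the solution ending there tangentially separates the phases that reach [x = -e] from those
   that turn back and leave through the side of their own mode. Following the two separating
   orbits backwards through the cycles gives interleaved points [u (n+1) < v n < u n]; orbits
   between [v n] and [u n] leave on the left, orbits between [u (n+1)] and [v n] on the right.

   Let [rho n] be the logarithm of the quotient of the lengths of these adjacent intervals. A
   phase changes [t^2] by about [4 e / k], so for fixed [n], as [e -> 0], [rho n] tends to a value
   within [O(1/n)] of [ln (A / B)]. Comparing three orbits as functions of [x], the first order
   terms of the derivative of this logarithm cancel, so a cycle changes it only by [O(1/n^2)],
   uniformly in [e]. Hence all but the first few quotients, which concern an interval of length
   [O(sqrt e)], are close to [A / B], and the right-going points have density
   [(A / B) / (1 + A / B) = A / (A + B)]. *)

Require Import Defs.
From HB Require Import structures.
From mathcomp Require Import all_boot all_order all_algebra.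
From mathcomp Require Import all_classical all_reals all_analysis.
From mathcomp Require Import ring lra.
Import Order.TTheory GRing.Theory Num.Theory.
Import numFieldNormedType.Exports.
Local Open Scope classical_set_scope.
Local Open Scope ring_scope.
Set Implicit Arguments.
Unset Strict Implicit.

(** * Calculus *)

(** An orbit from a fixed [y] makes of order [1/e] cycles, whereas the approximation of squared
    arrival times accumulates an error in every cycle and serves only boundedly many of them. The
    other cycles need increments of [rho] that are summable uniformly in [e]. Their size has three
    sources: a phase at distance [m] before the fold distorts the quotient by [O(e d / m^3)], where
    [d] is the time span of the three orbits; squared times change by [O(e)] per cycle, so
    [d = O(e / m)]; and after [n] cycles [m^2 >= n e / L]. Together this is [O(1/n^2)], free of [e].
    Only second differences in [t] enter, which is why a fold carries [fold_dd]. Solutions [x(y)]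
    are easy to compare; hysteretic orbits come with physical time and a list of switches. Outcomes
    are therefore transported through one phase at a time, as equivalences, and that an orbit does
    not exit on the right follows from uniqueness. Measurability of the right-going set is obtained
    along the way, since membership is decided except at finitely many points of the interval. *)

Lemma is_derive1_continuous (R : realType) (f : R -> R) (t d : R) :
  is_derive t 1 f d -> {for t, continuous f}.
Proof.
move=> h; have : derivable f t 1 by [].
by move/derivable1_diffP/differentiable_continuous.
Qed.

Lemma derive_within_continuous (R : realType) (f df : R -> R) (a b : R) :
  (forall t, a <= t <= b -> is_derive t 1 f (df t)) ->
  {within `[a, b], continuous f}.
Proof.
move=> h; apply: continuous_in_subspaceT => t.
rewrite inE /= in_itv /= => /h; exact: is_derive1_continuous.
Qed.

Lemma MVT_ler (R : realType) (f df : R -> R) (a b c : R) : a <= b ->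
  {within `[a, b], continuous f} ->
  (forall t, a < t < b -> is_derive t 1 f (df t)) ->
  (forall t, a < t < b -> df t <= c) -> f b - f a <= c * (b - a).
Proof.
rewrite le_eqVlt => /orP[/eqP->|ab] cf hf hc; first by rewrite !subrr mulr0.
have hf' t : t \in `]a, b[ -> is_derive t 1 f (df t).
  by rewrite in_itv; exact: hf.
have [z zab ->] := MVT ab hf' cf.
rewrite ler_wpM2r ?subr_ge0 ?(ltW ab)//; apply: hc.
by move: zab; rewrite in_itv.
Qed.

Lemma MVT_ger (R : realType) (f df : R -> R) (a b c : R) : a <= b ->
  {within `[a, b], continuous f} ->
  (forall t, a < t < b -> is_derive t 1 f (df t)) ->
  (forall t, a < t < b -> c <= df t) -> c * (b - a) <= f b - f a.
Proof.
rewrite le_eqVlt => /orP[/eqP->|ab] cf hf hc; first by rewrite !subrr mulr0.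
have hf' t : t \in `]a, b[ -> is_derive t 1 f (df t).
  by rewrite in_itv; exact: hf.
have [z zab ->] := MVT ab hf' cf.
rewrite ler_wpM2r ?subr_ge0 ?(ltW ab)//; apply: hc.
by move: zab; rewrite in_itv.
Qed.

Lemma derive_ler (R : realType) (f g df dg : R -> R) (a b : R) : a <= b ->
  (forall t, a <= t <= b -> is_derive t 1 f (df t)) ->
  (forall t, a <= t <= b -> is_derive t 1 g (dg t)) ->
  (forall t, a <= t <= b -> df t <= dg t) -> f b - f a <= g b - g a.
Proof.
move=> ab hf hg hfg.
have hfg' t : a <= t <= b -> is_derive t 1 (f - g) (df t - dg t).
  by move=> tab; apply: is_deriveB; [exact: hf|exact: hg].
have := @MVT_ler R (f - g) (fun t => df t - dg t) a b 0 ab.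
rewrite mul0r => /(_ (derive_within_continuous hfg')).
have -> : (f - g) b - (f - g) a = (f b - f a) - (g b - g a).
  by rewrite !fctE; ring.
rewrite subr_le0; apply.
  by move=> t /andP[at_ tb]; apply: hfg'; rewrite !ltW.
by move=> t /andP[at_ tb]; rewrite subr_le0; apply: hfg; rewrite !ltW.
Qed.

Lemma ivt_between (R : realType) (f : R -> R) (a b v : R) : a <= b ->
  {within `[a, b], continuous f} -> (f a - v) * (f b - v) <= 0 ->
  exists2 c, a <= c <= b & f c = v.
Proof.
move=> ab cf hv.
have [|c] := @IVT R f a b v ab cf.
  have [fab|fab] := lerP (f a) (f b); nra.
by rewrite in_itv /= => cab <-; exists c.
Qed.

Lemma within_continuous_itvP (R : realType) (f : R -> R) (a b : R) :
  {within `[a, b], continuous f} -> forall c e, a <= c <= b -> 0 < e ->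
  exists2 d, 0 < d & forall t, a <= t <= b -> `|t - c| < d -> `|f t - f c| < e.
Proof.
move=> /subspace_continuousP cf c e cab e0.
have /cvgrPdist_lt/(_ _ e0) := cf c ltac:(by rewrite /= in_itv).
rewrite near_withinE near_simpl => /nbhs_ballP[d /= d0 h]; exists d => // t tab tc.
rewrite distrC; apply: h; last by rewrite /= in_itv.
by rewrite /ball /= distrC.
Qed.

Lemma first_hit (R : realType) (f : R -> R) (a b v : R) : a <= b ->
  {within `[a, b], continuous f} -> f a <= v -> v <= f b ->
  exists c, [/\ a <= c <= b, f c = v & forall t, a <= t < c -> f t < v].
Proof.
move=> ab cf fav vfb.
pose S := [set t | a <= t <= b /\ v <= f t].
have Sb : S b by split; rewrite ?ab ?lexx.
have lbS : lbound S a by move=> t [/andP[]].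
have hS : has_inf S by split; [exists b | exists a].
pose c := inf S.
have ac : a <= c by apply: lb_le_inf => //; exists b.
have cb : c <= b by apply: ge_inf => //; exists a.
have ltv t : a <= t < c -> f t < v.
  move=> /andP[at_ tc]; rewrite ltNge; apply/negP => vt.
  have : c <= t.
    by apply: ge_inf; [exists a|split => //; rewrite at_ (le_trans (ltW tc))].
  by rewrite leNgt tc.
exists c; split => //; first by rewrite ac.
apply/eqP; rewrite eq_le; apply/andP; split; rewrite leNgt; apply/negP => h.
  have cf1 : {within `[a, c], continuous f}.
    apply: continuous_subspaceW cf => t /=.
    by rewrite !in_itv /= => /andP[-> /le_trans->].
  have [z /andP[az zc] fz] := @ivt_between _ f a c v ac cf1 ltac:(nra).
  have zltc : z < c.
    by rewrite lt_neqAle zc andbT; apply/eqP => E; move: h; rewrite -E fz ltxx.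
  by have := ltv z; rewrite az zltc fz ltxx => /(_ isT).
have cab : a <= c <= b by rewrite ac cb.
have [d d0 hd] := within_continuous_itvP cf cab (ltac:(lra) : 0 < v - f c).
have [w [/andP[aw wb] vw]] := inf_adherent d0 hS.
rewrite -/c => wz; have cw : c <= w by apply: ge_inf; [exists a|split; rewrite ?aw].
have := hd w; rewrite aw wb => /(_ isT).
by rewrite ger0_norm ?subr_ge0// => /(_ ltac:(lra)); rewrite ltr_norml; lra.
Qed.

Lemma derive_sqr_expR (R : realType) (z : R -> R) (d c t : R) :
  is_derive t 1 z d ->
  is_derive t 1 (fun u => z u ^+ 2 * expR (c * u))
    ((2 * z t * d + c * z t ^+ 2) * expR (c * t)).
Proof.
move=> hz.
have h1 : is_derive t 1 (fun u : R => c * u) c.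
  by apply: is_derive_eq; rewrite /GRing.scale /= mulr1.
have h2 : is_derive t 1 (fun u : R => expR (c * u)) (c * expR (c * t)).
  have h3 := is_derive_expR (c * t).
  by have := @is_derive1_comp _ expR (fun u : R => c * u) t _ _ h3 h1; rewrite mulrC.
apply: is_derive_eq; rewrite /GRing.scale /=; ring.
Qed.

(** [z^2 * expR (- 2 L t)] decreases and [z^2 * expR (2 L t)] increases, so a zero propagates
    forwards and backwards. Both directions are needed, since solutions are also compared at earlier
    times. *)
Lemma gronwall0 (R : realType) (z dz : R -> R) (a b L : R) : a <= b ->
  {within `[a, b], continuous z} ->
  (forall t, a < t < b -> is_derive t 1 z (dz t)) ->
  (forall t, a < t < b -> `|dz t| <= L * `|z t|) ->
  (z a = 0 <-> z b = 0).
Proof.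
move=> ab cz hz hL.
have hw c t : a < t < b -> is_derive t 1 (fun u => z u ^+ 2 * expR (c * u))
    ((2 * z t * dz t + c * z t ^+ 2) * expR (c * t)).
  by move=> tab; apply: derive_sqr_expR; exact: hz.
have cw c : {within `[a, b], continuous (fun u => z u ^+ 2 * expR (c * u))}.
  have ce : continuous (fun u : R => expR (c * u)).
    move=> t; apply: (is_derive1_continuous (d := c * expR (c * t))).
    have h1 : is_derive t 1 (fun u : R => c * u) c.
      by apply: is_derive_eq; rewrite /GRing.scale /= mulr1.
    have := @is_derive1_comp _ expR (fun u : R => c * u) t _ _ (is_derive_expR (c * t)) h1.
    by rewrite mulrC.
  apply/subspace_continuousP => t tab.
  have /subspace_continuousP/(_ t tab) czt := cz.
  by apply: cvgM; [apply: cvgM|apply: cvg_within_filter; exact: ce].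
have key t : a < t < b -> `|z t * dz t| <= L * z t ^+ 2.
  move=> tab; rewrite normrM -real_normK ?num_real// expr2 mulrCA.
  by rewrite ler_wpM2l// hL.
split=> z0.
- have := MVT_ler ab (cw (- (2 * L))) (hw (- (2 * L))) (c := 0).
  rewrite mul0r z0 expr0n /= mul0r subr0 => H.
  have {}H : z b ^+ 2 * expR (- (2 * L) * b) <= 0.
    apply: H => t tab; rewrite pmulr_lle0 ?expR_gt0//.
    by have := key t tab; rewrite ler_norml; lra.
  move: H; rewrite pmulr_lle0 ?expR_gt0// => H; apply/eqP; rewrite -sqrf_eq0.
  by rewrite eq_le H sqr_ge0.
- have := MVT_ger ab (cw (2 * L)) (hw (2 * L)) (c := 0).
  rewrite mul0r z0 expr0n /= mul0r sub0r oppr_ge0 => H.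
  have {}H : z a ^+ 2 * expR (2 * L * a) <= 0.
    apply: H => t tab; rewrite pmulr_lge0 ?expR_gt0//.
    by have := key t tab; rewrite ler_norml; lra.
  move: H; rewrite pmulr_lle0 ?expR_gt0// => H; apply/eqP; rewrite -sqrf_eq0.
  by rewrite eq_le H sqr_ge0.
Qed.

Definition lipschitz2 (R : realType) (L : R) (F : R -> R -> R) :=
  forall t t' x x', `|F t x - F t' x'| <= L * (`|t - t'| + `|x - x'|).

Lemma primitive (R : realType) (h : R -> R) (a b t0 x0 : R) : continuous h ->
  exists2 H : R -> R, H t0 = x0 & forall t, a < t < b -> is_derive t 1 H (h t).
Proof.
move=> ch.
pose H0 t := (\int[lebesgue_measure]_(s in `[a, t]) h s)%R.
have hi u : lebesgue_measure.-integrable `[a, u] (EFin \o h).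
  apply: continuous_compact_integrable; first exact: segment_compact.
  exact: continuous_subspaceT.
have hH t : a < t < b -> is_derive t 1 H0 (h t).
  move=> /andP[at_ tb]; have [hd he] := continuous_FTC1_closed tb (hi b) at_ (ch t).
  apply: (DeriveDef hd); rewrite -derive1E; exact: he.
exists (fun t => H0 t + (x0 - H0 t0)); first by ring.
move=> t tab; have hh := hH t tab.
by apply: is_derive_eq; rewrite addr0.
Qed.

(** * Picard iteration *)

Definition clamp (R : realType) (a b t : R) : R := Num.max a (Num.min b t).

Lemma clamp_id (R : realType) (a b t : R) : a <= t <= b -> clamp a b t = t.
Proof. by move=> /andP[at_ tb]; rewrite /clamp (min_idPr tb) (max_idPr at_). Qed.

Lemma clamp_itv (R : realType) (a b t : R) : a <= b -> a <= clamp a b t <= b.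
Proof. by move=> ab; rewrite /clamp le_max lexx ge_max ab ge_min lexx. Qed.

Lemma clamp_lip (R : realType) (a b t s : R) : a <= b ->
  `|clamp a b t - clamp a b s| <= `|t - s|.
Proof.
move=> ab; rewrite /clamp.
have h1 := ler_norm (t - s); have h2 := ler_norm (s - t); rewrite distrC in h2.
rewrite ler_norml; case: (leP b t) => bt; case: (leP b s) => bs; rewrite ?(max_idPr ab).
- by rewrite subrr; apply/andP; split; lra.
- by case: (leP a s) => ?; apply/andP; split; lra.
- by case: (leP a t) => ?; apply/andP; split; lra.
- by case: (leP a t) => ?; case: (leP a s) => ?; apply/andP; split; lra.
Qed.

Lemma lipschitz_continuous (R : realType) (f : R -> R) (K : R) :
  (forall t s, `|f t - f s| <= K * `|t - s|) -> continuous f.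
Proof.
move=> h t; apply/cvgrPdist_lt => e e0.
have K0 : 0 <= K by have := h 0 1; rewrite sub0r normrN normr1 mulr1; apply: le_trans.
have K1 : 0 < K + 1 by rewrite ltr_wpDl.
near=> s; rewrite (le_lt_trans (h t s))//.
have hs : `|t - s| < e / (K + 1).
  by near: s; apply: cvgr_dist_lt; [exact: cvg_id|exact: divr_gt0].
rewrite ltr_pdivlMr// in hs.
by apply: le_lt_trans hs; rewrite mulrC ler_wpM2l//; lra.
Unshelve. all: by end_near. Qed.

(** Passage to the limit in an estimate with a geometric error; it replaces convergence statements
    in the Picard iteration. *)
Lemma ler_add_half (R : realType) (x y c : R) :
  (forall n : nat, x <= y + c * 2^-1 ^+ n) -> x <= y.
Proof.
move=> h; apply/ler_addgt0Pr => e e0.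
pose n := Num.bound (`|c| / e).
apply: (le_trans (h n)); rewrite lerD2l.
have nb : `|c| / e < n%:R by apply: archi_boundP; rewrite divr_ge0// ltW.
have : n%:R <= 2 ^+ n :> R by rewrite -natrX ler_nat ltnW// ltn_expl.
rewrite exprVn ler_pdivrMr ?exprn_gt0// => n2.
rewrite ltr_pdivrMr// in nb; apply: le_trans (ler_norm c) _.
by rewrite (le_trans (ltW nb))// mulrC ler_wpM2l// ltW.
Qed.

Lemma derive_lip (R : realType) (f df : R -> R) (a b K : R) :
  (forall t, a <= t <= b -> is_derive t 1 f (df t)) ->
  (forall t, a <= t <= b -> `|df t| <= K) ->
  forall t s, a <= t <= b -> a <= s <= b -> `|f t - f s| <= K * `|t - s|.
Proof.
move=> hf hK.
suff hle t s : a <= t <= b -> a <= s <= b -> s <= t -> `|f t - f s| <= K * `|t - s|.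
  move=> t s ht hs; have [st|ts] := leP s t; first exact: hle.
  by rewrite distrC [X in _ * X]distrC; apply: hle => //; exact: ltW.
move=> /andP[at_ tb] /andP[as_ sb] st; rewrite [X in _ * X]ger0_norm ?subr_ge0//.
have sub u : s <= u <= t -> a <= u <= b.
  by move=> /andP[su ut]; rewrite (le_trans as_ su) (le_trans ut tb).
have subo u : s < u < t -> a <= u <= b.
  by move=> /andP[su ut]; apply: sub; rewrite !ltW.
have cf : {within `[s, t], continuous f}.
  by apply: (@derive_within_continuous _ _ df) => u /sub; exact: hf.
have hf' u : s < u < t -> is_derive u 1 f (df u) by move=> /subo; exact: hf.
rewrite ler_norml; apply/andP; split.
  rewrite -mulNr; apply: (MVT_ger st cf hf') => u /subo /hK.
  by rewrite ler_norml => /andP[].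
apply: (MVT_ler st cf hf') => u /subo /hK.
by rewrite ler_norml => /andP[].
Qed.

Lemma is_derive1_subr (R : realType) (f g : R -> R) (t df dg : R) :
  is_derive t 1 f df -> is_derive t 1 g dg ->
  is_derive t 1 (fun u => f u - g u) (df - dg).
Proof. by move=> hf hg; apply: is_derive_eq. Qed.

Section picard.
Variables (R : realType) (F : R -> R -> R) (L K a b t0 x0 : R).
Hypothesis FL : lipschitz2 L F.
Hypothesis FK : forall t x, `|F t x| <= K.
Hypothesis t0ab : a <= t0 <= b.
Hypothesis short : (b - a) * L <= 2^-1.

Let ab : a <= b. Proof. by case/andP: t0ab; exact: le_trans. Qed.
Let K0 : 0 <= K. Proof. exact: le_trans (FK 0 0). Qed.
Let L0 : 0 <= L.
Proof.
have := FL 0 1 0 0; rewrite subrr normr0 addr0 sub0r normrN normr1 mulr1.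
exact: le_trans.
Qed.
Let cl := clamp a b.
Let nice (u : R -> R) := forall t s, a <= t <= b -> a <= s <= b ->
  `|u t - u s| <= K * `|t - s|.

(** [step u v] says that [v] is the Picard image of [u]. The equation is imposed on an interval
    wider than [[a, b]], with the argument of [u] clamped, so that the derivatives at [a] and [b]
    are two-sided. *)
Let step (u v : R -> R) := v t0 = x0 /\
  forall t, a - 1 < t < b + 1 -> is_derive t 1 v (F t (u (cl t))).

Let wide t : a <= t <= b -> a - 1 < t < b + 1. Proof. lra. Qed.

Let step_ex u : nice u -> exists v, step u v.
Proof.
move=> hu.
have ch : continuous (fun t => F t (u (cl t))).
  apply: (lipschitz_continuous (K := L * (1 + K))) => t s.
  apply: (le_trans (FL _ _ _ _)); rewrite -mulrA ler_wpM2l// mulrDl mul1r lerD2l.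
  apply: (le_trans (hu _ _ (clamp_itv _ ab) (clamp_itv _ ab))).
  by rewrite ler_wpM2l// clamp_lip.
have [v v0 hv] := @primitive R _ (a - 1) (b + 1) t0 x0 ch.
by exists v.
Qed.

Let step_nice u v : step u v -> nice v.
Proof.
by move=> [_ hv]; apply: (derive_lip (df := fun t => F t (u (cl t)))) => t /wide; auto.
Qed.

(** Hypothesis [short] makes the Picard map a contraction with factor one half. *)
Let step_close u v u' v' d : step u v -> step u' v' ->
  (forall t, a <= t <= b -> `|u t - u' t| <= d) ->
  forall t, a <= t <= b -> `|v t - v' t| <= d * 2^-1.
Proof.
move=> [v0 hv] [v0' hv'] hd t tab.
have d0 : 0 <= d by exact: le_trans (hd t tab).
have hdv s : a <= s <= b -> is_derive s 1 (fun u => v u - v' u)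
    (F s (u (cl s)) - F s (u' (cl s))).
  by move=> /wide sab; apply: is_derive1_subr; [exact: hv|exact: hv'].
have hK s : a <= s <= b -> `|F s (u (cl s)) - F s (u' (cl s))| <= L * d.
  move=> sab; apply: (le_trans (FL _ _ _ _)); rewrite subrr normr0 add0r.
  by rewrite ler_wpM2l// hd// clamp_itv.
have := derive_lip hdv hK tab t0ab; rewrite v0 v0' subrr subr0 => /le_trans; apply.
have : `|t - t0| <= b - a by rewrite ler_norml; case/andP: tab; case/andP: t0ab; lra.
move=> h; apply: (@le_trans _ _ (L * d * (b - a))).
  by rewrite ler_wpM2l// mulr_ge0.
by rewrite mulrAC [leLHS]mulrC ler_wpM2l// mulrC.
Qed.

Lemma picard : exists2 X : R -> R, X t0 = x0 &
  forall t, a < t < b -> is_derive t 1 X (F t (X t)).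
Proof.
have /choice [nx hnx] : forall u, exists v, nice u -> step u v.
  move=> u; have [/step_ex[v hv]|nu] := pselect (nice u); first by exists v.
  by exists u.
pose u := fix u n := if n is n'.+1 then nx (u n') else cst x0.
have u_nice n : nice (u n).
  elim: n => [|n IH] /=; last exact: step_nice (hnx _ IH).
  by move=> t s _ _; rewrite /cst subrr normr0 mulr_ge0.
have u_step n : step (u n) (u n.+1) by exact: hnx.
pose C := K * (b - a).
have u_close n : forall t, a <= t <= b -> `|u n.+1 t - u n t| <= C * 2^-1 ^+ n.
  elim: n => [|n IH] t tab.
    have := u_nice 1%N t t0 tab t0ab; have -> : u 1%N t0 = x0 by case: (u_step 0%N).
    move=> /le_trans; apply; rewrite expr0 mulr1 ler_wpM2l// ler_norml.
    by case/andP: tab; case/andP: t0ab; lra.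
  by rewrite exprSr mulrA; apply: step_close IH t tab.
(* [q n] is the tail of the geometric series bounding the increments. The intervals
   [[u n t - q n, u n t + q n]] are thus nested, and the supremum of their left ends is the
   limit. *)
pose q (n : nat) := 2 * C * 2^-1 ^+ n.
have q0 n : 0 <= q n by rewrite !mulr_ge0// ?exprn_ge0// subr_ge0.
have mono n m t : a <= t <= b -> u n t - q n <= u (n + m)%N t - q (n + m)%N /\
    u (n + m)%N t + q (n + m)%N <= u n t + q n.
  move=> tab; elim: m => [|m [IH1 IH2]]; first by rewrite addn0.
  rewrite addnS; have := u_close (n + m)%N t tab.
  have -> : q (n + m).+1 = C * 2^-1 ^+ (n + m) by rewrite /q exprS; field.
  move: IH1 IH2; have -> : q (n + m)%N = 2 * (C * 2^-1 ^+ (n + m)) by rewrite /q mulrA.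
  by rewrite ler_norml; lra.
have nest n m t : a <= t <= b -> u n t - q n <= u m t + q m.
  move=> tab; have [h1 _] := mono n m t tab; have [_ h2] := mono m n t tab.
  have := q0 (n + m)%N; move: h1 h2; rewrite addnC; lra.
pose S t := [set u n t - q n | n in [set: nat]].
pose X t := sup (S t).
have Xu n t : a <= t <= b -> `|X t - u n t| <= q n.
  move=> tab; have ubS m : ubound (S t) (u m t + q m).
    by move=> _ [k _ <-]; exact: nest.
  have hS : has_sup (S t) by split; [exists (u 0%N t - q 0%N); exists 0%N|exists (u 0%N t + q 0%N)].
  have h1 : X t <= u n t + q n by apply: ge_sup; [exact: hS.1|exact: ubS].
  have h2 : u n t - q n <= X t by apply: ub_le_sup; [exact: hS.2|exists n].
  by rewrite ler_norml; move: h1 h2; lra.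
have X_nice : nice X.
  move=> t s tab sab; apply: (@ler_add_half _ _ _ (4 * C)) => n.
  have := Xu n t tab; have := Xu n s sab; have := u_nice n t s tab sab.
  by rewrite /q !ler_norml; lra.
(* The limit [X] is so far only Lipschitz. Its Picard image [V] is differentiable, and it equals [X]
   on [[a, b]] because both are limits of the [u n]. *)
have [V hV] := step_ex X_nice.
have VX t : a <= t <= b -> V t = X t.
  move=> tab; apply/eqP; rewrite -subr_eq0 -normr_le0.
  apply: (@ler_add_half _ _ _ (2 * C)) => n; rewrite add0r.
  have := step_close hV (u_step n) (Xu n) tab; have := Xu n.+1 t tab.
  have -> : q n.+1 = q n * 2^-1 by rewrite /q exprSr mulrA.
  rewrite -/(q n) !ler_norml; lra.
exists V; first by case: hV.
move=> t tab; have tab' : a <= t <= b by case/andP: tab => /ltW-> /ltW->.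
by case: hV => _ /(_ t (wide tab')); rewrite /cl clamp_id// -VX.
Qed.

End picard.

(** * Folds and their solutions *)

(* One mode with [t = y] as time, extended from the box [-r, r]^2 to the plane by clamping, so
   that solutions are global. *)
Record fold (R : realType) (k L M r : R) (phi : R -> R -> R) : Prop := Fold {
  fold_k : 0 < k;
  fold_r : 0 < r;
  fold_M : 0 <= M;
  fold_lip : lipschitz2 L phi;
  fold_bound : forall t x, `|phi t x| <= 2 * L * r;
  fold_inc : forall x t1 t2, - r <= t1 -> t1 <= t2 -> t2 <= r ->
    k / 2 * (t2 - t1) <= phi t2 x - phi t1 x;
  fold_lin : forall t, - r <= t <= r -> `|phi t 0 - k * t| <= M * t ^+ 2;
  fold_dd : forall x t1 t2 t3, - r <= t1 -> t1 < t2 -> t2 < t3 -> t3 <= r ->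
    `|(phi t2 x - phi t1 x) / (t2 - t1) - (phi t3 x - phi t2 x) / (t3 - t2)|
      <= M * (t3 - t1);
  fold_small1 : 8 * L ^+ 2 * r <= k;
  fold_small2 : L * r <= 8^-1 }.

Section fold_dynamics.
Variables (R : realType) (k L M r : R) (phi : R -> R -> R).
Hypothesis F : fold k L M r phi.

Lemma fold_kL : k / 2 <= L.
Proof.
have k0 := fold_k F; have r0 := fold_r F.
have h1 := fold_inc F 0 (t1 := 0) (t2 := r) ltac:(lra) ltac:(lra) ltac:(lra).
have h2 := fold_lip F r 0 0 0; rewrite !subr0 normr0 addr0 [`|r|]gtr0_norm// in h2.
have := le_trans h1 (le_trans (ler_norm _) h2).
by rewrite subr0 ler_pM2r.
Qed.

Lemma fold00 : phi 0 0 = 0.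
Proof.
have k0 := fold_k F; have r0 := fold_r F.
have h := fold_lin F (t := 0) ltac:(lra).
by apply/eqP; rewrite -normr_le0; move: h; rewrite !mulr0 subr0 expr0n mulr0.
Qed.

(** The time interval is twice the box, so that derivatives at [- r] and [r] are two-sided. *)
Definition sol (X : R -> R) :=
  forall t, - (2 * r) < t < 2 * r -> is_derive t 1 X (phi t (X t)).

(** [fold_small2] is the contraction condition for the interval [[-2r, 2r]], of length [4 r]. *)
Lemma sol_ex t0 x0 : - r <= t0 <= r -> exists2 X, sol X & X t0 = x0.
Proof.
have k0 := fold_k F; have r0 := fold_r F.
move=> ht; have h4 : (2 * r - - (2 * r)) * L <= 2^-1.
  by have := fold_small2 F; lra.
have h2 : - (2 * r) <= t0 <= 2 * r by lra.
have [X X0 hX] := @picard _ _ _ _ _ _ _ x0 (fold_lip F) (fold_bound F) h2 h4.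
by exists X.
Qed.

Lemma sol_continuous X a b : - (2 * r) < a -> b < 2 * r -> sol X ->
  {within `[a, b], continuous X}.
Proof.
have k0 := fold_k F; have r0 := fold_r F.
move=> ha hb hX; apply: (derive_within_continuous (df := fun t => phi t (X t))).
by move=> t ht; apply: hX; lra.
Qed.

Lemma sol_lip X t s : sol X -> - r <= t <= r -> - r <= s <= r ->
  `|X t - X s| <= 2 * L * r * `|t - s|.
Proof.
have k0 := fold_k F; have r0 := fold_r F.
move=> hX; apply: (derive_lip (df := fun t => phi t (X t))) => u hu.
  by apply: hX; lra.
exact: fold_bound F _ _.
Qed.

Lemma sol_eq X Y t0 t : sol X -> sol Y -> - r <= t0 <= r -> - r <= t <= r ->
  X t0 = Y t0 -> X t = Y t.
Proof.
have k0 := fold_k F; have r0 := fold_r F.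
move=> hX hY.
have key a b : - r <= a -> a <= b -> b <= r -> (X a - Y a = 0 <-> X b - Y b = 0).
  move=> ha ab hb.
  have hz u : a <= u <= b -> is_derive u 1 (fun u => X u - Y u) (phi u (X u) - phi u (Y u)).
    by move=> hu; apply: is_derive1_subr; [apply: hX|apply: hY]; lra.
  apply: (@gronwall0 R (fun u => X u - Y u)
    (fun u => phi u (X u) - phi u (Y u)) a b L ab).
  - exact: derive_within_continuous hz.
  - by move=> u hu; apply: hz; lra.
  - by move=> u hu; have := fold_lip F u u (X u) (Y u); rewrite subrr normr0 add0r.
move=> ht0 ht /eqP; rewrite -subr_eq0 => /eqP e0; apply/eqP; rewrite -subr_eq0.
apply/eqP; have [tt0|tt0] := leP t0 t.
  by apply/(key t0 t) => //; lra.
by apply/(key t t0) => //; lra.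
Qed.

(** Two solutions that change order would meet, by the intermediate value theorem, and then coincide
    by [sol_eq]. *)
Lemma sol_lt X Y t0 t : sol X -> sol Y -> - r <= t0 <= r -> - r <= t <= r ->
  X t0 < Y t0 -> X t < Y t.
Proof.
have k0 := fold_k F; have r0 := fold_r F.
move=> hX hY ht0 ht XY; rewrite ltNge; apply/negP => YX.
have hz u : - (2 * r) < u < 2 * r ->
    is_derive u 1 (fun u => X u - Y u) (phi u (X u) - phi u (Y u)).
  by move=> hu; apply: is_derive1_subr; [exact: hX|exact: hY].
have cz a b : - r <= a -> b <= r -> {within `[a, b], continuous (fun u => X u - Y u)}.
  by move=> ha hb; apply: derive_within_continuous => u hu; apply: hz; lra.
have [u hu zu] : exists2 u, - r <= u <= r & X u - Y u = 0.
  have [tt0|tt0] := leP t0 t.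
    have [||u hu zu] := @ivt_between _ (fun u => X u - Y u) t0 t 0 tt0; last by exists u => //; lra.
      by apply: cz; lra.
    by rewrite !subr0; nra.
  have [||u hu zu] := @ivt_between _ (fun u => X u - Y u) t t0 0 (ltW tt0);
    last by exists u => //; lra.
    by apply: cz; lra.
  by rewrite !subr0; nra.
have := sol_eq hX hY hu ht0 ltac:(lra); lra.
Qed.

Lemma sol_le X Y t0 t : sol X -> sol Y -> - r <= t0 <= r -> - r <= t <= r ->
  X t0 <= Y t0 -> X t <= Y t.
Proof.
have k0 := fold_k F; have r0 := fold_r F.
move=> hX hY ht0 ht XY; rewrite leNgt; apply/negP => YX.
by have := sol_lt hY hX ht ht0 YX; rewrite ltNge XY.
Qed.

(* Along a solution the slope increases, although [phi] need not be monotone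
   in [x]: [phi] is small near the fold, so [x] hardly changes. *)
Lemma slope_inc X s t : sol X -> - r <= s -> s <= t -> t <= r ->
  k / 4 * (t - s) <= phi t (X t) - phi s (X s).
Proof.
have k0 := fold_k F; have r0 := fold_r F.
move=> hX hs st ht.
have h1 := fold_inc F (X s) hs st ht.
have h2 := fold_lip F t t (X t) (X s); rewrite subrr normr0 add0r in h2.
have h3 := sol_lip hX (t := t) (s := s) ltac:(lra) ltac:(lra).
rewrite [`|t - s|]ger0_norm ?subr_ge0// in h3.
have h4 : L * `|X t - X s| <= k / 4 * (t - s).
  have L0 : 0 <= L by have := fold_kL; lra.
  apply: (le_trans (ler_wpM2l L0 h3)).
  have h5 := fold_small1 F.
  have -> : L * (2 * L * r * (t - s)) = (8 * L ^+ 2 * r) / 4 * (t - s) by field.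
  by rewrite ler_wpM2r ?subr_ge0// ler_pM2r// invr_gt0.
move: h2; rewrite ler_norml; lra.
Qed.

Lemma is_derive_half_sqr (c q t : R) :
  is_derive t 1 (fun u : R => c / 2 * (q - u) ^+ 2) (- (c * (q - t))).
Proof.
apply: is_derive_eq; rewrite /GRing.scale /=; lra.
Qed.

(** By [slope_inc] the slope at [u <= q] is at most [- k / 4 * (q - u)]; integration gives the
    quadratic drop. Non-rising at [q] suffices, so tangential arrivals are covered. *)
Lemma sol_fall X q s t : sol X -> phi q (X q) <= 0 -> - r <= s -> s <= t -> t <= q ->
  q <= r -> k / 8 * ((q - s) ^+ 2 - (q - t) ^+ 2) <= X s - X t.
Proof.
have k0 := fold_k F; have r0 := fold_r F.
move=> hX hq hs st tq qr.
have h := @derive_ler R X _ (fun u => phi u (X u)) (fun u => - (k / 4 * (q - u))) s t st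
  _ (fun u _ => is_derive_half_sqr (k / 4) q u).
have {}h : X t - X s <= k / 4 / 2 * (q - t) ^+ 2 - k / 4 / 2 * (q - s) ^+ 2.
  apply: h => u hu; first by apply: hX; lra.
  have := slope_inc hX (s := u) (t := q) ltac:(lra) ltac:(lra) qr; lra.
lra.
Qed.

Lemma sol_dec X q s t : sol X -> phi q (X q) <= 0 -> - r <= s -> s < t -> t <= q ->
  q <= r -> X t < X s.
Proof.
have k0 := fold_k F; have r0 := fold_r F.
move=> hX hq hs st tq qr.
have := sol_fall hX hq hs (ltW st) tq qr.
have : 0 < k / 8 * ((q - s) ^+ 2 - (q - t) ^+ 2).
  by apply: mulr_gt0; [lra|nra].
lra.
Qed.

Lemma sol_rise X p t : sol X -> - r <= p -> p <= t -> t <= r ->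
  X p + phi p (X p) * (t - p) + k / 8 * (t - p) ^+ 2 <= X t.
Proof.
have k0 := fold_k F; have r0 := fold_r F.
move=> hX hp pt tr.
pose c := phi p (X p).
have hg (u : R) : is_derive u 1 (fun u : R => k / 4 / 2 * (p - u) ^+ 2 + c * u)
    (- (k / 4 * (p - u)) + c).
  have := is_derive_half_sqr (k / 4) p u => h.
  by apply: is_derive_eq; rewrite /GRing.scale /= mulr1.
have h : k / 4 / 2 * (p - t) ^+ 2 + c * t - (k / 4 / 2 * (p - p) ^+ 2 + c * p) <= X t - X p.
  apply: (@derive_ler R (fun u => k / 4 / 2 * (p - u) ^+ 2 + c * u) X
    (fun u => - (k / 4 * (p - u)) + c) (fun u => phi u (X u)) p t pt) => u hu //.
    by apply: hX; lra.
  have := slope_inc hX (s := p) (t := u) hp ltac:(lra) ltac:(lra); rewrite -/c; lra.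
by move: h; rewrite -/c subrr expr0n /= mulr0; nra.
Qed.

End fold_dynamics.

(** * Phases through the band *)

(** The sign condition at [q] makes the solution strictly decreasing up to [q], by [sol_dec]. Hence
    [q] is the first time at which [x = - e], and tangential arrival is included. *)
Definition transit (R : realType) (r : R) (phi : R -> R -> R) (e x0 p q : R) :=
  exists X, [/\ sol r phi X, X p = x0, X q = - e, [/\ - r <= p, p < q & q <= r] &
    phi q (- e) <= 0].

Section transits.
Variables (R : realType) (k L M r : R) (phi : R -> R -> R).
Hypothesis F : fold k L M r phi.
Variable e : R.
Hypothesis e0 : 0 < e.
Hypothesis e_small : 64 * e <= k * r ^+ 2.
Local Notation sol := (sol r phi).
Local Notation tr := (transit r phi e).

Lemma tangency_ex : 2 * L * e / k <= r ->
  exists2 t, phi t (- e) = 0 & `|t| <= 2 * L * e / k.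
Proof.
move=> small; have k0 := fold_k F; have r0 := fold_r F; have e0' := e0.
have L0 : 0 < L by have := fold_kL F; lra.
move: small; have [T TE] : exists T, T = 2 * L * e / k by exists (2 * L * e / k).
rewrite -TE => small.
have T0 : 0 <= T by rewrite TE divr_ge0 ?mulr_ge0 ?ltW.
have kT : k / 2 * T = L * e by rewrite TE; field; rewrite gt_eqF.
have h1 := fold_lip F 0 0 (- e) 0.
rewrite (fold00 F) subrr normr0 add0r !subr0 normrN (gtr0_norm e0) in h1.
have h2 := fold_inc F (- e) (t1 := 0) (t2 := T) ltac:(lra) T0 small.
have h3 := fold_inc F (- e) (t1 := - T) (t2 := 0) ltac:(lra) ltac:(lra) ltac:(lra).
move: h1; rewrite (ler_norml (phi 0 (- e))) => /andP[h1 h1'].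
have cphi : {within `[- T, T], continuous (phi^~ (- e))}.
  apply: continuous_subspaceT; apply: (lipschitz_continuous (K := L)) => t s.
  by have := fold_lip F t s (- e) (- e); rewrite subrr normr0 addr0.
have [|t ht pt] := @ivt_between _ (phi^~ (- e)) (- T) T 0 ltac:(lra) cphi.
  by rewrite !subr0; nra.
by exists t => //; rewrite ler_norml; lra.
Qed.

Lemma transit_gap x0 p q : tr x0 p q -> k / 8 * (q - p) ^+ 2 <= x0 + e.
Proof.
move=> [X [hX Xp Xq [rp pq qr] fq]].
have := sol_fall F hX (q := q) ltac:(by rewrite Xq) rp (ltW pq) (lexx q) qr.
by rewrite subrr expr0n /= Xp Xq; lra.
Qed.

(** Followed backwards from [(q, - e)], the solution has risen by at least [k / 8 * (r / 2)^2] at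
    time [- r]. By [e_small] this is at least [2 e], so level [x0] is met on the way. *)
Lemma transit_ex x0 q : - e < x0 <= e -> - (r / 2) <= q <= r -> phi q (- e) <= 0 ->
  exists p, tr x0 p q.
Proof.
move=> hx0 hq fq; have k0 := fold_k F; have r0 := fold_r F; have e0' := e0.
have [X hX Xq] := sol_ex F (t0 := q) (- e) ltac:(lra).
have fX : phi q (X q) <= 0 by rewrite Xq.
have h := sol_fall F hX fX (lexx (- r)) (t := q) ltac:(lra) (lexx q) ltac:(lra).
rewrite subrr expr0n /= subr0 Xq in h.
have cX : {within `[- r, q], continuous X}.
  by apply: (sol_continuous F _ _ hX); lra.
have hr : r ^+ 2 / 4 <= (q - - r) ^+ 2 by nra.
have he := e_small.
have h2 : k / 8 * (r ^+ 2 / 4) <= k / 8 * (q - - r) ^+ 2 by rewrite ler_wpM2l//; lra.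
have [|p hp Xp] := @ivt_between _ X (- r) q x0 ltac:(lra) cX.
  by rewrite Xq; nra.
have pq : p < q.
  rewrite lt_neqAle; apply/andP; split; last by lra.
  by apply/eqP => pq; move: Xp; rewrite pq Xq; lra.
by exists p, X; split => //; split => //; lra.
Qed.

Lemma transit_fun x0 p q q' : tr x0 p q -> tr x0 p q' -> q = q'.
Proof.
suff h q1 q2 : tr x0 p q1 -> tr x0 p q2 -> q1 <= q2.
  by move=> h1 h2; apply/eqP; rewrite eq_le (h q q')// (h q' q).
move=> [X [hX Xp Xq [rp pq qr] fq]] [Y [hY Yp Yq [_ pq' qr'] fq']].
rewrite leNgt; apply/negP => qq.
have := sol_dec F hX (q := q1) ltac:(by rewrite Xq) _ qq (lexx _) qr.
rewrite (sol_eq F hX hY (t0 := p) (t := q2) ltac:(lra) ltac:(lra)) ?Xp ?Yp//.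
by rewrite Xq Yq ltxx => H; have := H ltac:(lra).
Qed.

(** The orbit that started earlier has already dropped below [x0] when the later one starts there.
    It stays below by uniqueness, hence reaches [- e] first. *)
Lemma transit_lt x0 p q p' q' : - e < x0 -> tr x0 p q -> tr x0 p' q' ->
  p < p' -> q < q'.
Proof.
move=> hx0 [X [hX Xp Xq [rp pq qr] fq]] [Y [hY Yp Yq [rp' pq' qr'] fq']] pp.
have [p'q|] := ltP p' q; last by lra.
have XY : X p' < Y p'.
  by rewrite Yp -Xp; apply: (sol_dec F hX (q := q)) => //; [rewrite Xq|exact: ltW].
rewrite ltNge; apply/negP => q'q.
have := sol_lt F hX hY (t0 := p') (t := q') ltac:(lra) ltac:(lra) XY.
have [E|qq] := eqVneq q' q; first by rewrite Yq E Xq ltxx.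
have : X q < X q'.
  apply: (sol_dec F hX (q := q)) => //; [by rewrite Xq|lra|].
  by rewrite lt_neqAle qq.
by rewrite Xq Yq; lra.
Qed.

Lemma transit_mono x0 p q p' q' : - e < x0 -> tr x0 p q -> tr x0 p' q' ->
  (p < p') = (q < q').
Proof.
move=> hx0 h h'; apply/idP/idP; first exact: transit_lt h h'.
move=> qq; rewrite ltNge; apply/negP; rewrite le_eqVlt => /orP[/eqP E|pp].
  by subst p'; move: qq; rewrite (transit_fun h h') ltxx.
by have := transit_lt hx0 h' h pp; rewrite ltNge ltW.
Qed.

(** [Z], the solution from [(c, x0)], is the separating orbit. An earlier start puts [X] strictly
    below [Z], so [X] is below [- e] at time [ts] and has crossed that level before. *)
Lemma transit_succeeds x0 c ts p : phi ts (- e) = 0 -> tr x0 c ts ->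
  - r <= p -> p < c -> exists2 q, tr x0 p q & q < ts.
Proof.
move=> f0 [Z [hZ Zc Zt [rc ct tr_] _]] rp pc.
have [X hX Xp] := sol_ex F (t0 := p) x0 ltac:(lra).
have f0' : phi ts (Z ts) <= 0 by rewrite Zt f0.
have Zpc : Z c < Z p by apply: (sol_dec F hZ f0' rp pc (ltW ct) tr_).
have XZ t : - r <= t <= r -> X t < Z t.
  by move=> ht; apply: (sol_lt F hX hZ (t0 := p)) => //; lra.
have Xt : X ts < - e by rewrite -Zt; apply: XZ; lra.
have cX : {within `[p, ts], continuous (fun t => - X t)}.
  have cX : {within `[p, ts], continuous X} by apply: (sol_continuous F _ _ hX); lra.
  by move=> t; apply: continuousN; exact: cX.
have xe : - e < x0.
  by rewrite -Zt -Zc; apply: (sol_dec F hZ f0' rc ct (lexx _) tr_).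
have hpts : p <= ts by lra.
have hXp : - X p <= e by lra.
have hXt : e <= - X ts by lra.
have [q [hq Xq lt_q]] := @first_hit R (fun t => - X t) p ts e hpts cX hXp hXt.
have {}Xq : X q = - e by lra.
have qp : q != p by apply/eqP => E; move: Xq; rewrite E Xp; lra.
have qts : q != ts by apply/eqP => E; move: Xq; rewrite E; lra.
have qts' : q < ts by rewrite lt_neqAle qts; lra.
have pq : p < q by rewrite lt_neqAle eq_sym qp; lra.
exists q => //; exists X; split => //; first by split => //; lra.
(* The arrival is downward because [phi] at [x = - e] increases in time and vanishes only later, at
   [ts]. *)
have k0 := fold_k F.
have := fold_inc F (- e) (le_trans rp (ltW pq)) (ltW qts') tr_.
rewrite f0 sub0r; apply: contraTT; rewrite -!ltNge => h.
rewrite (@lt_le_trans _ _ 0) ?oppr_lt0// mulr_ge0 ?divr_ge0 ?(ltW k0)// subr_ge0; exact: ltW.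
Qed.

Lemma sol_rising X p q : sol X -> - r <= p -> p < q -> q <= r -> 0 < phi q (X q) ->
  exists2 s, p <= s < q & X s <= X q.
Proof.
move=> hX rp pq qr fpos; have k0 := fold_k F; have r0 := fold_r F.
have [f fE] : exists f, f = phi q (X q) by exists (phi q (X q)).
have L0 : 0 < L by have := fold_kL F; lra.
have [K KE] : exists K, K = L * (1 + 2 * L * r) by exists (L * (1 + 2 * L * r)).
have K0 : 0 < K by rewrite KE mulr_gt0// ltr_wpDr// !mulr_ge0 ?ltW.
have fK : 0 < f / K by rewrite fE divr_gt0.
(* [K] is a Lipschitz constant of the slope along [X], so the slope stays nonnegative within [f / K]
   before [q]. *)
have [s [ps sq qs]] : exists s, [/\ p <= s, s < q & q - s <= f / K].
  exists (Num.max p (q - f / K)); split; first by rewrite le_max lexx.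
    by rewrite gt_max pq; lra.
  by rewrite lerBlDr -lerBlDl le_max lexx orbT.
exists s; first by rewrite ps.
rewrite -subr_ge0; rewrite -[leLHS](mul0r (q - s)).
have rs : - r <= s by exact: le_trans ps.
have cXs : {within `[s, q], continuous X} by apply: (sol_continuous F _ _ hX); lra.
apply: (MVT_ger (df := fun u => phi u (X u)) (ltW sq) cXs) => u hu.
  by apply: hX; lra.
have ru : - r <= u <= r by lra.
have rq : - r <= q <= r by lra.
have uq : 0 < q - u by lra.
have qu : q - u <= f / K by lra.
have h1 := fold_lip F q u (X q) (X u).
have h2 := sol_lip F hX rq ru.
rewrite (gtr0_norm uq) in h1 h2.
have h3 : L * (q - u + `|X q - X u|) <= K * (q - u).
  by rewrite KE -mulrA ler_wpM2l ?(ltW L0)// [leRHS]mulrDl mul1r lerD2l.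
have h4 : K * (q - u) <= f by rewrite -ler_pdivlMl// mulrC.
have := le_trans (le_trans h1 h3) h4; rewrite ler_norml -fE => /andP[_].
by rewrite lerBlDr lerDl.
Qed.

(** Consider a first arrival [q] at [- e]. If [q <= ts], then [X] is not above the separating orbit
    [Z] at [q], hence not at [p], although [Z] has already dropped below [x0] there. If [q > ts],
    the slope at [q] is positive, so by [sol_rising] the level was met earlier. *)
Lemma transit_fails x0 c ts p X : phi ts (- e) = 0 -> tr x0 c ts ->
  sol X -> X p = x0 -> c < p -> p <= r -> forall t, p <= t <= r -> - e < X t.
Proof.
move=> f0 [Z [hZ Zc Zt [rc ct tr_] _]] hX Xp cp pr t ht; rewrite ltNge; apply/negP => Xt.
have k0 := fold_k F; have r0 := fold_r F.
have f0' : phi ts (Z ts) <= 0 by rewrite Zt f0.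
have xe : - e < x0.
  by rewrite -Zt -Zc; apply: (sol_dec F hZ f0' rc ct (lexx _) tr_).
have cX : {within `[p, t], continuous (fun t => - X t)}.
  have cX : {within `[p, t], continuous X} by apply: (sol_continuous F _ _ hX); lra.
  by move=> u; apply: continuousN; exact: cX.
have hpt : p <= t by lra.
have hXp : - X p <= e by lra.
have hXt : e <= - X t by lra.
have [q [hq Xq lt_q]] := @first_hit R (fun t => - X t) p t e hpt cX hXp hXt.
have {}Xq : X q = - e by lra.
have qp : q != p by apply/eqP => E; move: Xq; rewrite E Xp; lra.
have pq : p < q by rewrite lt_neqAle eq_sym qp; lra.
have qr : q <= r by case/andP: hq => _ /le_trans->//; case/andP: ht.
have [qts|tsq] := leP q ts.
  have Zq : - e <= Z q.
    have [->|qts'] := eqVneq q ts; first by rewrite Zt.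
    rewrite -Zt; apply: ltW; apply: (sol_dec F hZ f0') => //; first lra.
    by rewrite lt_neqAle qts'.
  have rp := le_trans rc (ltW cp).
  have iq : - r <= q <= r by rewrite (le_trans rp (ltW pq)) (le_trans qts).
  have ip : - r <= p <= r by rewrite rp.
  have Xq_le : X q <= Z q by rewrite Xq.
  have := sol_le F hX hZ iq ip Xq_le.
  rewrite Xp -Zc leNgt => /negP; apply.
  exact: (sol_dec F hZ f0' rc cp (le_trans (ltW pq) qts) tr_).
have fpos : 0 < phi q (X q).
  rewrite Xq; have := fold_inc F (- e) (le_trans rc (ltW ct)) (ltW tsq) qr.
  by rewrite f0 subr0; apply: lt_le_trans; rewrite mulr_gt0 ?divr_gt0// subr_gt0.
have rp := le_trans rc (ltW cp).
have [s hs] := sol_rising hX rp pq qr fpos.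
by rewrite Xq => h; have := lt_q s hs; rewrite /= ltrNl ltNge h.
Qed.

(** By [sol_rise], the quadratic gain up to time [r] is at least [k r^2 / 32]. An initial descent
    has slope at least [- L (p1 + e)] and acts for a time at most [2 r], so one half of the gain
    pays for it and for [x0], and the other half reaches [xs]. *)
Lemma exit_ex x0 p p1 X xs : sol X -> X p = x0 -> - e < x0 <= e ->
  `|p| <= p1 -> p1 <= r / 2 -> e + 2 * L * r * (p1 + e) <= k * r ^+ 2 / 64 ->
  e <= xs -> xs <= k * r ^+ 2 / 64 ->
  exists t, [/\ p <= t <= r, X t = xs & forall s, p <= s < t -> X s < xs].
Proof.
move=> hX Xp hx0 hp p1r sm exs hxs.
have k0 := fold_k F; have r0 := fold_r F; have e0' := e0.
have L0 : 0 < L by have := fold_kL F; lra.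
move: (hp); rewrite ler_norml => /andP[hp1 hp2].
have rp : - r <= p by lra.
have pr : p <= r by lra.
have cX : {within `[p, r], continuous X} by apply: (sol_continuous F _ _ hX); lra.
have := sol_rise F hX (p := p) (t := r) ltac:(lra) ltac:(lra) (lexx r).
have h1 := fold_lip F p 0 x0 0; rewrite (fold00 F) !subr0 in h1.
have x0e : `|x0| <= e by rewrite ler_norml; lra.
have h2 : L * (`|p| + `|x0|) <= L * (p1 + e) by rewrite ler_wpM2l ?(ltW L0)// lerD.
have := le_trans h1 h2; rewrite ler_norml => /andP[h3 _].
have h4 : - (2 * L * r * (p1 + e)) <= phi p x0 * (r - p).
  have h5 : 0 <= L * (p1 + e) by rewrite mulr_ge0 ?ltW//; lra.
  have h6 : 0 <= r - p <= 2 * r by lra.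
  by nra.
have h7 : r ^+ 2 / 4 <= (r - p) ^+ 2 by nra.
have h8 : k / 8 * (r ^+ 2 / 4) <= k / 8 * (r - p) ^+ 2 by rewrite ler_wpM2l//; lra.
rewrite Xp => h9.
have Xp' : X p <= xs by rewrite Xp (le_trans _ exs)//; case/andP: hx0.
have Xr : xs <= X r by case/andP: hx0 => hx0 _; lra.
have [t [ht Xt lt_t]] := first_hit pr cX Xp' Xr.
by exists t.
Qed.

End transits.

(** * Quantitative estimates for a single phase *)

Section transit_estimates.
Variables (R : realType) (k L M r : R) (phi : R -> R -> R).
Hypothesis F : fold k L M r phi.
Variable e : R.
Hypothesis e0 : 0 < e.
Local Notation sol := (sol r phi).
Local Notation tr := (transit r phi e).

Lemma sol_itv X p q t : sol X -> X q = - e -> - r <= p -> q <= r ->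
  phi q (- e) <= 0 -> p <= t <= q -> - e <= X t <= X p.
Proof.
move=> hX Xq rp qr fq /andP[pt tq]; have fq' : phi q (X q) <= 0 by rewrite Xq.
have le a b : p <= a -> a <= b -> b <= q -> X b <= X a.
  move=> pa; rewrite le_eqVlt => /orP[/eqP->//|ab] bq.
  by apply: ltW; apply: (sol_dec F hX fq') => //; exact: le_trans pa.
by rewrite -{1}Xq !le.
Qed.

(** Crude bounds, valid for all phases ending before the fold and not only in the limit: [phi] lies
    between linear functions of slopes [L] and [k / 2] in [t], up to [L e]. They show that [t^2]
    shifts by an amount comparable to [e]. *)
Lemma transit_sqr x0 p q : 0 <= x0 <= e -> q <= 0 -> tr x0 p q ->
  e <= L * (p ^+ 2 - q ^+ 2) /\ k * (p ^+ 2 - q ^+ 2) <= 12 * e.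
Proof.
move=> hx0 q0 [X [hX Xp Xq [rp pq qr] fq]].
have k0 := fold_k F; have r0 := fold_r F; have e0' := e0.
have L0 : 0 < L by have := fold_kL F; lra.
have Xe u : p <= u <= q -> `|X u| <= e.
  by move=> /(sol_itv hX Xq rp qr fq); rewrite Xp ler_norml; lra.
have dX u : p <= u <= q -> is_derive u 1 X (phi u (X u)).
  by move=> hu; apply: hX; lra.
have dg (c d u : R) : is_derive u 1 (fun u : R => c * u + d / 2 * u ^+ 2) (c + d * u).
  by apply: is_derive_eq; rewrite /GRing.scale /=; lra.
(* Over the whole phase, the dependence of [phi] on [x] costs at most [e / 8]. *)
have Le : L * e * (q - p) <= e / 8.
  have h1 : q - p <= r by lra.
  have := fold_small2 F => h2.
  have h3 : L * e * (q - p) <= L * e * r by rewrite ler_wpM2l// mulr_ge0// ltW.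
  have h4 : L * r * e <= 8^-1 * e by rewrite ler_wpM2r// ltW.
  lra.
split.
- have := @derive_ler R _ X _ _ p q (ltW pq) (fun u _ => dg (- (L * e)) L u) dX.
  have H u : p <= u <= q -> - (L * e) + L * u <= phi u (X u).
    move=> hu; have h1 := fold_lip F u 0 (X u) 0; rewrite (fold00 F) !subr0 in h1.
    have h2 : L * (`|u| + `|X u|) <= L * (- u + e).
      rewrite ler_wpM2l ?(ltW L0)// lerD ?Xe// ler0_norm//; lra.
    by have := le_trans h1 h2; rewrite ler_norml; lra.
  by move=> /(_ H); rewrite Xp Xq; lra.
- have := @derive_ler R X _ _ _ p q (ltW pq) dX (fun u _ => dg (L * e) (k / 2) u).
  have H u : p <= u <= q -> phi u (X u) <= L * e + k / 2 * u.
    move=> hu; have h1 := fold_lip F 0 0 (X u) 0.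
    rewrite (fold00 F) subrr normr0 add0r !subr0 in h1.
    have h2 : L * `|X u| <= L * e by rewrite ler_wpM2l ?Xe// ltW.
    have h3 := fold_inc F (X u) (t1 := u) (t2 := 0) ltac:(lra) ltac:(lra) ltac:(lra).
    by have := le_trans h1 h2; rewrite ler_norml; lra.
  by move=> /(_ H); rewrite Xp Xq; lra.
Qed.

(** The slope differs from [k t] by at most [L e + M B^2] during a time at most [2 B]. With [B] of
    order [sqrt e] the error is [O(e^(3/2))], negligible against [e]. *)
Lemma transit_sqr_approx x0 p q B : 0 <= x0 <= e -> `|p| <= B -> `|q| <= B ->
  tr x0 p q ->
  `|k / 2 * (p ^+ 2 - q ^+ 2) - (x0 + e)| <= (L * e + M * B ^+ 2) * (2 * B).
Proof.
move=> hx0 hp hq [X [hX Xp Xq [rp pq qr] fq]].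
have k0 := fold_k F; have r0 := fold_r F; have M0 := fold_M F.
have L0 : 0 < L by have := fold_kL F; lra.
move: hp hq; rewrite (ler_norml p) (ler_norml q) => hp hq.
have dX (u : R) : p <= u <= q ->
    is_derive u 1 (fun u : R => X u - k / 2 * u ^+ 2) (phi u (X u) - k * u).
  move=> hu; have h : is_derive u 1 X (phi u (X u)) by apply: hX; lra.
  by apply: is_derive_eq; rewrite /GRing.scale /=; lra.
have bX u : p <= u <= q -> `|phi u (X u) - k * u| <= L * e + M * B ^+ 2.
  move=> hu; have hXu := sol_itv hX Xq rp qr fq hu.
  have h1 := fold_lip F u u (X u) 0; rewrite subrr normr0 add0r subr0 in h1.
  have h2 := fold_lin F (t := u) ltac:(lra).
  have h3 : L * `|X u| <= L * e.
    by rewrite ler_wpM2l ?(ltW L0)//; move: hXu; rewrite Xp ler_norml; lra.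
  have h4 : M * u ^+ 2 <= M * B ^+ 2 by rewrite ler_wpM2l//; nra.
  have -> : phi u (X u) - k * u = (phi u (X u) - phi u 0) + (phi u 0 - k * u) by ring.
  by apply: (le_trans (ler_normD _ _)); apply: lerD; [exact: le_trans h3|exact: le_trans h4].
have := derive_lip dX bX (t := q) (s := p) ltac:(lra) ltac:(lra).
rewrite [`|q - p|]gtr0_norm ?subr_gt0// Xp Xq.
have -> : - e - k / 2 * q ^+ 2 - (x0 - k / 2 * p ^+ 2) =
  k / 2 * (p ^+ 2 - q ^+ 2) - (x0 + e) by ring.
move=> h; apply: (le_trans h); rewrite ler_wpM2l//; last by lra.
by rewrite addr_ge0// mulr_ge0 ?sqr_ge0// ltW.
Qed.

(** Orbits of one phase start and end at different times but cross the same interval of [x], so they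
    are compared as functions of [x]. *)
Lemma inverse_graph X x0 p q : sol X -> X p = x0 -> X q = - e -> - r < p ->
  p < q -> q < r -> phi q (- e) < 0 ->
  exists T : R -> R, [/\ T (- e) = q, T x0 = p &
    forall x, - e <= x <= x0 -> [/\ p <= T x <= q, X (T x) = x &
      is_derive x 1 T (phi (T x) x)^-1]].
Proof.
move=> hX Xp Xq rp pq qr fq.
have k0 := fold_k F; have r0 := fold_r F.
have L0 : 0 < L by have := fold_kL F; lra.
pose K := L * (1 + 2 * L * r).
have K0 : 0 < K by rewrite /K mulr_gt0// ltr_wpDr// !mulr_ge0 ?ltW.
(* The solution keeps decreasing until [q + d], so [- e] is an interior value of the monotone branch
   and the inverse is differentiable there too. *)
pose d := Num.min (r - q) (- phi q (- e) / K).
have d0 : 0 < d by rewrite /d lt_min subr_gt0 qr divr_gt0// oppr_gt0.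
have [t ht] : exists t, t = q + d by exists (q + d).
have qt : q < t by rewrite ht ltrDl.
have tr_ : t <= r.
  have dr : d <= r - q by rewrite /d ge_min lexx.
  by rewrite ht -lerBrDl.
have ft : phi t (X t) <= 0.
  have h1 := fold_lip F t q (X t) (X q).
  have h2 := sol_lip F hX (t := t) (s := q) ltac:(lra) ltac:(lra).
  have tq : `|t - q| = d by rewrite ht addrAC subrr add0r gtr0_norm.
  rewrite tq in h1 h2.
  have h3 : L * (d + `|X t - X q|) <= K * d.
    by rewrite /K -mulrA ler_wpM2l ?(ltW L0)//; lra.
  have h4 : K * d <= - phi q (- e).
    by rewrite -ler_pdivlMl// mulrC /d ge_min lexx orbT.
  by have := le_trans h1 h3; rewrite ler_norml Xq; lra.
have dec s s' : - r <= s -> s < s' -> s' <= t -> X s' < X s.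
  by move=> rs ss s't; apply: (sol_dec F hX ft).
pose T x := xget 0 [set s | - r <= s <= t /\ X s = x].
have TX s : - r <= s <= t -> T (X s) = s.
  move=> hs; rewrite /T; case: xgetP => [s' _ [hs' E]|/(_ s)]; last by move=> /=; tauto.
  have [ss|ss|//] := ltgtP s' s.
    by have := dec s' s ltac:(lra) ss ltac:(lra); rewrite E ltxx.
  by have := dec s s' ltac:(lra) ss ltac:(lra); rewrite E ltxx.
exists T; split; first by rewrite -Xq TX//; lra.
  by rewrite -Xp TX//; lra.
move=> x hx; have cX : {within `[p, q], continuous X}.
  by apply: (sol_continuous F _ _ hX); lra.
have [|s hs Xs] := @ivt_between _ X p q x (ltW pq) cX; first by rewrite Xp Xq; nra.
have Tx : T x = s by rewrite -Xs TX//; lra.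
rewrite Tx Xs; split => //.
rewrite -Xs; apply: (@is_derive_inverse R X T (phi s (X s))).
- have : \forall u \near s, u \in `]- r, t[ by apply: near_in_itvoo; rewrite in_itv /=; lra.
  by apply: filterS => u; rewrite in_itv /= => hu; apply: TX; lra.
- have : \forall u \near s, u \in `]- r, t[ by apply: near_in_itvoo; rewrite in_itv /=; lra.
  apply: filterS => u; rewrite in_itv /= => hu.
  by apply: (is_derive1_continuous (d := phi u (X u))); apply: hX; lra.
- by apply: hX; lra.
- have := slope_inc F hX (s := s) (t := q) ltac:(lra) ltac:(lra) ltac:(lra).
  have : 0 <= k / 4 * (q - s) by rewrite mulr_ge0//; lra.
  by rewrite Xq => h1 h2; rewrite lt_eqF//; lra.
Qed.

End transit_estimates.

(** * Distortion of a phase *)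

Lemma is_derive_ln_comp (R : realType) (f : R -> R) (x d : R) : 0 < f x ->
  is_derive x 1 f d -> is_derive x 1 (fun u => ln (f u)) (d / f x).
Proof.
move=> fx hf; have h := is_derive1_ln fx.
by have := @is_derive1_comp _ (@ln R) f x _ _ h hf; rewrite mulrC.
Qed.

(* With [fi = phi ti x], the left-hand side is the derivative in [x] of
   [ln ((T2 - T1) / (T3 - T2))] for three solutions of [dT/dx = 1 / phi T x]. *)
Lemma ratio_slope (R : realType) (k m d L M r f1 f2 f3 t1 t2 t3 : R) :
  0 < k -> 0 < m -> m <= r -> 0 <= M -> t1 < t2 -> t2 < t3 -> t3 - t1 <= d ->
  f1 <= - (k / 4 * m) -> f2 <= - (k / 4 * m) -> f3 <= - (k / 4 * m) ->
  `|f3 - f2| <= L * (t3 - t2) -> `|f3 - f1| <= L * (t3 - t1) ->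
  `|(f2 - f1) / (t2 - t1) - (f3 - f2) / (t3 - t2)| <= M * (t3 - t1) ->
  `|(f2^-1 - f1^-1) / (t2 - t1) - (f3^-1 - f2^-1) / (t3 - t2)|
    <= (16 * M * r / k ^+ 2 + 64 * L ^+ 2 / k ^+ 3) * (d / m ^+ 3).
Proof.
move=> k0 m0 mr M0 t12 t23 hd h1 h2 h3 hb hf hab.
have km : 0 < k / 4 * m by rewrite !mulr_gt0.
have n1 : f1 != 0 by rewrite lt_eqF//; lra.
have n2 : f2 != 0 by rewrite lt_eqF//; lra.
have n3 : f3 != 0 by rewrite lt_eqF//; lra.
have d12 : t2 - t1 != 0 by rewrite gt_eqF// subr_gt0.
have d23 : t3 - t2 != 0 by rewrite gt_eqF// subr_gt0.
have L0 : 0 <= L.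
  by have := le_trans (normr_ge0 _) hb; rewrite pmulr_lge0// subr_gt0.
(* The divided differences of [1 / phi] reduce to those of [phi]. Their difference leaves a second
   difference, bounded through [M], and a product of two first differences; the single first
   differences cancel. *)
have -> : (f2^-1 - f1^-1) / (t2 - t1) - (f3^-1 - f2^-1) / (t3 - t2) =
    - ((f2 - f1) / (t2 - t1) - (f3 - f2) / (t3 - t2)) * (f1^-1 * f2^-1)
    - ((f3 - f2) / (t3 - t2)) * (f3 - f1) * (f1^-1 * f2^-1 * f3^-1).
  by field; rewrite n1 n2 n3 d12 d23.
have inv f : f <= - (k / 4 * m) -> `|f^-1| <= 4 / (k * m).
  move=> hf'; have f0 : f < 0 by lra.
  have -> : 4 / (k * m) = (k / 4 * m)^-1 by field; rewrite !gt_eqF.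
  by rewrite normfV ltr0_norm// lef_pV2 ?posrE//; lra.
have g0 : 0 <= 4 / (k * m) by rewrite divr_ge0// mulr_ge0 ?ltW.
have d0 : 0 <= t3 - t1 by lra.
apply: (le_trans (ler_normB _ _)); rewrite !normrM normrN [leRHS]mulrDl; apply: lerD.
  apply: (@le_trans _ _ (M * d * (4 / (k * m) * (4 / (k * m))))).
    apply: ler_pM => //; rewrite ?mulr_ge0//.
      by apply: (le_trans hab); rewrite ler_wpM2l.
    by apply: ler_pM => //; exact: inv.
  (* The factor [r / m >= 1] is given away so that both terms have the form [d / m^3]. *)
  have -> : 16 * M * r / k ^+ 2 * (d / m ^+ 3) =
      M * d * (4 / (k * m) * (4 / (k * m))) * (r / m).
    by field; rewrite !gt_eqF.
  rewrite ler_peMr//; last by rewrite ler_pdivlMr// mul1r.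
  by rewrite !mulr_ge0//; lra.
apply: (@le_trans _ _ (L * (L * d) * (4 / (k * m) * (4 / (k * m)) * (4 / (k * m))))).
  apply: ler_pM => //; rewrite ?mulr_ge0//.
    apply: ler_pM => //; rewrite ?mulr_ge0//.
      rewrite -normrM normrM normfV [`|t3 - t2|]gtr0_norm ?subr_gt0//.
      by rewrite ler_pdivrMr ?subr_gt0.
    by apply: (le_trans hf); rewrite ler_wpM2l.
  apply: ler_pM => //; rewrite ?mulr_ge0//; last exact: inv.
  by apply: ler_pM => //; exact: inv.
have -> : 64 * L ^+ 2 / k ^+ 3 * (d / m ^+ 3) =
  L * (L * d) * (4 / (k * m) * (4 / (k * m)) * (4 / (k * m))).
  by field; rewrite !gt_eqF.
by [].
Qed.

Section transit_ratio.
Variables (R : realType) (k L M r : R) (phi : R -> R -> R).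
Hypothesis F : fold k L M r phi.
Variable e : R.
Hypothesis e0 : 0 < e.
Local Notation sol := (sol r phi).
Local Notation tr := (transit r phi e).

Definition ratio_const := 2 * (16 * M * r / k ^+ 2 + 64 * L ^+ 2 / k ^+ 3).

Lemma ratio_const_ge0 : 0 <= ratio_const.
Proof.
have k0 := fold_k F; have r0 := fold_r F; have M0 := fold_M F.
have L0 : 0 < L by have := fold_kL F; lra.
rewrite mulr_ge0// addr_ge0// divr_ge0 ?exprn_ge0 ?mulr_ge0 ?exprn_ge0//; exact: ltW.
Qed.

Lemma fold_neg m x t : 4 * L * e <= k * m -> - e <= x <= e -> - r <= t -> t <= - m ->
  t <= 0 -> phi t x <= - (k / 4 * m).
Proof.
move=> em hx rt tm t0; have k0 := fold_k F; have r0 := fold_r F.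
have L0 : 0 < L by have := fold_kL F; lra.
have h1 := fold_lip F 0 0 x 0.
rewrite (fold00 F) subrr normr0 add0r !subr0 in h1.
have h2 : L * `|x| <= L * e by rewrite ler_wpM2l ?(ltW L0)// ler_norml; lra.
have h3 := fold_inc F x (t1 := t) (t2 := 0) rt t0 ltac:(lra).
have h4 : k / 2 * m <= k / 2 * (0 - t) by rewrite ler_wpM2l//; lra.
by have := le_trans h1 h2; rewrite ler_norml; lra.
Qed.

(** Ordered arrival times give ordered times at every level crossed on the way, which keeps the
    logarithms in [transit_ratio] defined. *)
Lemma sol_time_lt X Y q q' t t' : sol X -> sol Y -> X q = - e -> Y q' = - e ->
  phi q (- e) <= 0 -> phi q' (- e) <= 0 ->
  q < q' -> - r <= t <= q -> - r <= t' <= q' -> q' <= r -> X t = Y t' -> t < t'.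
Proof.
move=> hX hY Xq Yq fq fq' qq ht ht' qr E; rewrite ltNge; apply/negP => t't.
have XY : X q < Y q.
  rewrite Xq -Yq; apply: (sol_dec F hY (q := q')) => //; last by lra.
  by rewrite Yq.
have XYt : X t' < Y t' by apply: (sol_lt F hX hY (t0 := q)) => //; lra.
move: t't; rewrite le_eqVlt => /orP[/eqP tt|t't].
  by move: XYt; rewrite -E tt ltxx.
have := sol_dec F hX (q := q) (s := t') (t := t) ltac:(by rewrite Xq) ltac:(lra) t't
  ltac:(lra) ltac:(lra).
by lra.
Qed.

Lemma ratio_slope_fold m d x t1 t2 t3 : 4 * L * e <= k * m -> 0 < m ->
  - e <= x <= e -> - r <= t1 -> t1 < t2 -> t2 < t3 -> t3 <= - m -> t3 - t1 <= d ->
  `|((phi t2 x)^-1 - (phi t1 x)^-1) / (t2 - t1) -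
    ((phi t3 x)^-1 - (phi t2 x)^-1) / (t3 - t2)|
    <= (16 * M * r / k ^+ 2 + 64 * L ^+ 2 / k ^+ 3) * (d / m ^+ 3).
Proof.
move=> em m0 hx rt1 t12 t23 t3m hd.
have k0 := fold_k F; have r0 := fold_r F; have M0 := fold_M F.
apply: (@ratio_slope R k m _ L M r) => //; try by lra.
- by apply: fold_neg => //; lra.
- by apply: fold_neg => //; lra.
- by apply: fold_neg => //; lra.
- have := fold_lip F t3 t2 x x; rewrite subrr normr0 addr0.
  by rewrite [`|t3 - t2|]gtr0_norm ?subr_gt0.
- have := fold_lip F t3 t1 x x; rewrite subrr normr0 addr0.
  by rewrite [`|t3 - t1|]gtr0_norm ?subr_gt0//; lra.
- by apply: (fold_dd F) => //; lra.
Qed.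

(** The bound of [ratio_slope_fold] is integrated over [[- e, x0]], whose length is at most [2 e];
    hence the factor 2 in [ratio_const]. *)
Lemma transit_ratio x0 m p1 p2 p3 q1 q2 q3 : 0 <= x0 <= e -> 0 < m ->
  4 * L * e <= k * m -> tr x0 p1 q1 -> tr x0 p2 q2 -> tr x0 p3 q3 -> - r < p1 ->
  q1 < q2 -> q2 < q3 -> q3 <= - m ->
  `|ln ((p2 - p1) / (p3 - p2)) - ln ((q2 - q1) / (q3 - q2))|
    <= ratio_const * (e * (q3 - p1) / m ^+ 3).
Proof.
move=> hx0 m0 em t1 t2 t3 rp1 q12 q23 q3m.
have [x00 x0e] : 0 <= x0 /\ x0 <= e by apply/andP.
have ee0 : - e < 0 by rewrite oppr_lt0.
have ex0 := lt_le_trans ee0 x00.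
have r0 := fold_r F; have e0' := e0.
have p12 : p1 < p2 by rewrite (transit_mono F ex0 t1 t2).
have p23 : p2 < p3 by rewrite (transit_mono F ex0 t2 t3).
case: t1 => [X1 [hX1 X1p X1q [_ pq1 _] fq1]].
case: t2 => [X2 [hX2 X2p X2q [_ pq2 _] fq2]].
case: t3 => [X3 [hX3 X3p X3q [_ pq3 _] fq3]].
have fq q : - r <= q -> q <= q3 -> phi q (- e) < 0.
  move=> rq qm; have := @fold_neg m (- e) q em ltac:(lra) rq ltac:(lra) ltac:(lra).
  have : 0 < k / 4 * m by rewrite !mulr_gt0// (fold_k F).
  by lra.
have rp2 := lt_trans rp1 p12; have rp3 := lt_trans rp2 p23.
have q3r : q3 < r by apply: (le_lt_trans q3m); apply: lt_trans r0; rewrite oppr_lt0.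
have q2r := lt_trans q23 q3r; have q1r := lt_trans q12 q2r.
have n1 : phi q1 (- e) < 0.
  by apply: fq; [exact: ltW (lt_trans rp1 pq1)|exact: ltW (lt_trans q12 q23)].
have n2 : phi q2 (- e) < 0 by apply: fq; [exact: ltW (lt_trans rp2 pq2)|exact: ltW].
have n3 : phi q3 (- e) < 0 by apply: fq; [exact: ltW (lt_trans rp3 pq3)|exact: lexx].
have [T1 [T1q T1p hT1]] := inverse_graph F hX1 X1p X1q rp1 pq1 q1r n1.
have [T2 [T2q T2p hT2]] := inverse_graph F hX2 X2p X2q rp2 pq2 q2r n2.
have [T3 [T3q T3p hT3]] := inverse_graph F hX3 X3p X3q rp3 pq3 q3r n3.
have T12 x : - e <= x <= x0 -> T1 x < T2 x.
  move=> hx; have [/andP[b1 b1'] E1 _] := hT1 _ hx; have [/andP[b2 b2'] E2 _] := hT2 _ hx.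
  apply: (sol_time_lt hX1 hX2 X1q X2q fq1 fq2 q12 _ _ (ltW q2r)).
  - by rewrite b1' (le_trans (ltW rp1)).
  - by rewrite b2' (le_trans (ltW rp2)).
  - by rewrite E1 E2.
have T23 x : - e <= x <= x0 -> T2 x < T3 x.
  move=> hx; have [/andP[b1 b1'] E1 _] := hT2 _ hx; have [/andP[b2 b2'] E2 _] := hT3 _ hx.
  apply: (sol_time_lt hX2 hX3 X2q X3q fq2 fq3 q23 _ _ (ltW q3r)).
  - by rewrite b1' (le_trans (ltW rp2)).
  - by rewrite b2' (le_trans (ltW rp3)).
  - by rewrite E1 E2.
pose h x := ln (T2 x - T1 x) - ln (T3 x - T2 x).
pose dh x := ((phi (T2 x) x)^-1 - (phi (T1 x) x)^-1) / (T2 x - T1 x) -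
  ((phi (T3 x) x)^-1 - (phi (T2 x) x)^-1) / (T3 x - T2 x).
have hdh x : - e <= x <= x0 -> is_derive x 1 h (dh x).
  move=> hx; have [_ _ d1] := hT1 _ hx; have [_ _ d2] := hT2 _ hx.
  have [_ _ d3] := hT3 _ hx.
  have d21 := is_derive1_subr d2 d1; have d32 := is_derive1_subr d3 d2.
  apply: is_derive1_subr; apply: is_derive_ln_comp => //; rewrite subr_gt0.
    exact: T12.
  exact: T23.
have bdh x : - e <= x <= x0 ->
    `|dh x| <= (16 * M * r / k ^+ 2 + 64 * L ^+ 2 / k ^+ 3) * ((q3 - p1) / m ^+ 3).
  move=> hx; have [/andP[b1 _] _ _] := hT1 _ hx; have [/andP[_ b3] _ _] := hT3 _ hx.
  have hxe : - e <= x <= e by case/andP: hx hx0 => -> /le_trans h' /andP[_ /h'->].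
  apply: ratio_slope_fold => //.
  - exact: le_trans (ltW rp1) b1.
  - exact: T12.
  - exact: T23.
  - exact: le_trans b3 q3m.
  - exact: lerB.
have bx0 : - e <= x0 <= x0 by rewrite lexx ltW.
have be : - e <= - e <= x0 by rewrite lexx ltW.
have hle := derive_lip hdh bdh bx0 be.
move: hle; rewrite /h T1q T2q T3q T1p T2p T3p => hle.
rewrite !ln_div ?posrE ?subr_gt0//; apply: (le_trans hle).
have := ratio_const_ge0; rewrite /ratio_const pmulr_rge0// => C0.
have Q0 : 0 <= (q3 - p1) / m ^+ 3.
  by rewrite divr_ge0 ?exprn_ge0 ?(ltW m0)// subr_ge0 ltW// (lt_trans p12)// (lt_trans p23).
rewrite opprK ger0_norm ?addr_ge0 ?(ltW e0)//.
have -> : 2 * (16 * M * r / k ^+ 2 + 64 * L ^+ 2 / k ^+ 3) * (e * (q3 - p1) / m ^+ 3) =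
  (16 * M * r / k ^+ 2 + 64 * L ^+ 2 / k ^+ 3) * ((q3 - p1) / m ^+ 3) * (2 * e).
  by ring.
by apply: ler_wpM2l; [exact: mulr_ge0|rewrite mulr_natl mulr2n lerD2r].
Qed.

End transit_ratio.

(** * Narrow bands *)

Section small_band.
Variables (R : realType) (k L M r : R) (phi : R -> R -> R).
Hypothesis F : fold k L M r phi.
Local Notation tr := (transit r phi).

(** The time is at least of order [sqrt e] before the fold, whereas the tangency is within [O(e)] of
    it. At such times the term [k t] dominates the variation of [phi] across the band. *)
Definition regular (e u : R) := u < 0 /\ e <= L * u ^+ 2.

(** The last three bounds serve [transit_ex], [tangency_ex] and [regular_large] respectively. *)
Definition small_band (e : R) :=
  [/\ 0 < e, 64 * e <= k * r ^+ 2, 2 * L * e / k <= r & 16 * L ^+ 3 * e <= k ^+ 2].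

Lemma small_band_near : \forall e \near 0^'+, small_band e.
Proof.
have k0 := fold_k F; have r0 := fold_r F.
have L0 : 0 < L by have := fold_kL F; lra.
near=> e; have e0 : 0 < e by [].
split => //.
- rewrite mulrC -ler_pdivlMr//; near: e; apply: nbhs_right_le.
  by rewrite divr_gt0// mulr_gt0// exprn_gt0.
- rewrite ler_pdivrMr// mulrC -ler_pdivlMr ?mulr_gt0//; near: e; apply: nbhs_right_le.
  by rewrite divr_gt0 ?mulr_gt0.
- rewrite mulrC -ler_pdivlMr ?mulr_gt0 ?exprn_gt0//; near: e; apply: nbhs_right_le.
  by rewrite divr_gt0 ?mulr_gt0 ?exprn_gt0.
Unshelve. all: by end_near. Qed.

Lemma regular_large e u : small_band e -> regular e u -> 4 * L * e <= k * - u.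
Proof.
move=> [e0 _ _ h] [u0 hu]; have k0 := fold_k F.
have L0 : 0 < L by have := fold_kL F; lra.
rewrite -ler_sqr ?nnegrE; last 2 first.
- by rewrite !mulr_ge0 ?(ltW L0) ?(ltW e0).
- by rewrite mulr_ge0 ?(ltW k0)// oppr_ge0 ltW.
have h1 : 16 * L ^+ 3 * e * e <= k ^+ 2 * (L * u ^+ 2).
  by apply: ler_pM => //; rewrite ?(ltW e0)// !mulr_ge0 ?exprn_ge0 ?(ltW L0) ?(ltW e0).
rewrite -(ler_pM2l L0); apply: le_trans (le_trans h1 _).
  by rewrite le_eqVlt; apply/orP; left; apply/eqP; ring.
by rewrite le_eqVlt; apply/orP; left; apply/eqP; ring.
Qed.

Lemma regular_slope e u : small_band e -> regular e u -> - r <= u -> phi u (- e) <= 0.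
Proof.
move=> se ru hu; have k0 := fold_k F; have L0 : 0 < L by have := fold_kL F; lra.
have h := regular_large se ru; have [u0 _] := ru; have [e0 _ _ _] := se.
have := fold_neg F (m := - u) (x := - e) (t := u) h ltac:(lra) hu ltac:(lra) ltac:(lra).
have : 0 <= k / 4 * - u by rewrite !mulr_ge0//; lra.
by lra.
Qed.

(** Squared times grow backwards by at least [e / L], so regularity is inherited by the start of the
    phase. *)
Lemma transit_regular e x0 p q : small_band e -> 0 <= x0 <= e -> regular e q ->
  tr e x0 p q -> [/\ p < q, regular e p, L * q ^+ 2 + e <= L * p ^+ 2 &
    k * p ^+ 2 <= k * q ^+ 2 + 12 * e].
Proof.
move=> [e0 _ _ _] hx0 [q0 hq] t.
have [h1 h2] := transit_sqr F e0 hx0 (ltW q0) t.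
have pq : p < q by case: t => X [_ _ _ [_ ? _] _].
split => //; [split; first exact: lt_trans q0 | |]; lra.
Qed.

Lemma transit_regular_ex e x0 q : small_band e -> 0 <= x0 <= e -> regular e q ->
  - (r / 2) <= q -> exists p, tr e x0 p q.
Proof.
move=> se hx0 rq hq; have [e0 e64 _ _] := se; have [q0 _] := rq; have r0 := fold_r F.
apply: (transit_ex F e0 e64); [lra|lra|].
by apply: regular_slope => //; lra.
Qed.

Definition tangency e := xget 0 [set t | phi t (- e) = 0 /\ `|t| <= 2 * L * e / k].

Lemma tangencyP e : small_band e ->
  phi (tangency e) (- e) = 0 /\ `|tangency e| <= 2 * L * e / k.
Proof.
move=> [e0 _ h _]; rewrite /tangency; case: xgetP => [t -> //|].
by have [t t1 t2] := tangency_ex F e0 h => /(_ t) [].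
Qed.

(** The start, at [x = e], of the phase that ends tangentially: later starts fail to cross. *)
Definition cutoff e := xget 0 [set c | tr e e c (tangency e)].

Lemma transit_approx (K th : R) : 0 < K -> 0 < th -> \forall e \near 0^'+,
  forall p q, tr e e p q -> p ^+ 2 <= K * e -> q ^+ 2 <= K * e ->
    `|p ^+ 2 - q ^+ 2 - 4 / k * e| <= th * e.
Proof.
move=> K0 th0; have k0 := fold_k F; have r0 := fold_r F; have M0 := fold_M F.
have L0 : 0 < L by have := fold_kL F; lra.
(* The error of [transit_sqr_approx] with [B = sqrt (K e)] is a constant times [sqrt e * e]; [c] is
   the bound on [sqrt e] that brings it below [th * e]. *)
pose c := (th * k) / (4 * Num.sqrt K * (L + M * K)).
have sK : 0 < Num.sqrt K by rewrite sqrtr_gt0.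
have LM : 0 < L + M * K by rewrite ltr_wpDr// mulr_ge0// ltW.
have c0 : 0 < c by rewrite divr_gt0 ?mulr_gt0.
near=> e => p q t hp hq.
have e0 : 0 < e by [].
have se : Num.sqrt e <= c.
  rewrite -(@ler_sqr _ (Num.sqrt e)) ?nnegrE ?sqrtr_ge0 ?(ltW c0)// sqr_sqrtr ?(ltW e0)//.
  by near: e; apply: nbhs_right_le; rewrite exprn_gt0.
pose B := Num.sqrt (K * e).
have B2 : B ^+ 2 = K * e by rewrite sqr_sqrtr// mulr_ge0 ?ltW.
have hB u : u ^+ 2 <= K * e -> `|u| <= B.
  by move=> hu; rewrite -sqrtr_sqr ler_wsqrtr.
have ee : 0 <= e <= e by rewrite lexx ltW.
have := transit_sqr_approx F e0 ee (hB _ hp) (hB _ hq) t.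
rewrite B2 => h.
have -> : p ^+ 2 - q ^+ 2 - 4 / k * e = 2 / k * (k / 2 * (p ^+ 2 - q ^+ 2) - (e + e)).
  by field; rewrite gt_eqF.
rewrite normrM gtr0_norm ?divr_gt0//.
apply: (le_trans (ler_wpM2l _ h)); first by rewrite divr_ge0// ltW.
have -> : 2 / k * ((L * e + M * (K * e)) * (2 * B)) =
    4 / k * (L + M * K) * Num.sqrt K * Num.sqrt e * e.
  by rewrite /B sqrtrM ?(ltW K0)//; field; rewrite gt_eqF.
rewrite ler_pM2r//.
apply: (@le_trans _ _ (4 / k * (L + M * K) * Num.sqrt K * c)).
  by rewrite ler_wpM2l// !mulr_ge0 ?invr_ge0 ?(ltW k0) ?(ltW LM) ?(ltW sK).
by rewrite /c le_eqVlt; apply/orP; left; apply/eqP; field; rewrite !gt_eqF.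
Unshelve. all: by end_near. Qed.

Lemma cutoff_near (th : R) : 0 < th -> \forall e \near 0^'+,
  [/\ tr e e (cutoff e) (tangency e), cutoff e < 0,
      `|cutoff e ^+ 2 - tangency e ^+ 2 - 4 / k * e| <= th * e &
      tangency e ^+ 2 <= th * e].
Proof.
move=> th0; have k0 := fold_k F; have r0 := fold_r F.
have L0 : 0 < L by have := fold_kL F; lra.
(* The bound [1 / k] forces the sign of the cutoff at the end: a nonnegative cutoff lies before the
   tangency and has the smaller square, against a difference of squares near [4 e / k]. *)
pose th' := Num.min th (k^-1).
have th'0 : 0 < th' by rewrite lt_min th0 invr_gt0.
have th'k : th' <= k^-1 by rewrite ge_min lexx orbT.
have th'th : th' <= th by rewrite ge_min lexx.
have K0 : 0 < 36 / k by rewrite divr_gt0.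
have small (c : R) : 0 < c -> \forall e \near 0^'+, (2 * L * e / k) ^+ 2 <= c * e.
  move=> c0; near=> e; have e0 : 0 < e by [].
  have -> : (2 * L * e / k) ^+ 2 = (4 * L ^+ 2 / k ^+ 2 * e) * e.
    by field; rewrite gt_eqF.
  rewrite ler_pM2r// mulrC -ler_pdivlMr ?divr_gt0 ?mulr_gt0 ?exprn_gt0//.
  by near: e; apply: nbhs_right_le; rewrite ?divr_gt0 ?mulr_gt0 ?exprn_gt0.
near=> e; have e0 : 0 < e by [].
have se : small_band e by near: e; exact: small_band_near.
have [t0 tle] := tangencyP se.
have T0 : 0 <= 2 * L * e / k by exact: le_trans (normr_ge0 _) tle.
have t2le : tangency e ^+ 2 <= (2 * L * e / k) ^+ 2.
  by rewrite -[leLHS]real_normK ?num_real// ler_sqr ?nnegrE.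
have t2 : tangency e ^+ 2 <= th' * e.
  by apply: (le_trans t2le); near: e; exact: small.
have [e64 hr] : 64 * e <= k * r ^+ 2 /\ 2 * L * e / k <= r / 2.
  split; first by case: se.
  rewrite ler_pdivrMr// mulrC -ler_pdivlMr ?mulr_gt0//; near: e; apply: nbhs_right_le.
  by rewrite !divr_gt0 ?mulr_gt0 ?divr_gt0.
have tc : tr e e (cutoff e) (tangency e).
  rewrite /cutoff; case: xgetP => [c -> //|].
  have ee : - e < e <= e by rewrite lexx andbT; lra.
  have ht : - (r / 2) <= tangency e <= r by move: tle; rewrite ler_norml; lra.
  have t0' : phi (tangency e) (- e) <= 0 by rewrite t0.
  by have [c hc] := transit_ex F e0 e64 ee ht t0' => /(_ c).
have gap := transit_gap F tc.
(* An a priori bound is needed before [transit_approx] applies. It comes from [transit_gap], which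
   gives [(tangency - cutoff)^2 <= 16 e / k]. *)
have c2 : cutoff e ^+ 2 <= 36 / k * e.
  have h1 : cutoff e ^+ 2 <= 2 * ((tangency e - cutoff e) ^+ 2 + tangency e ^+ 2).
    rewrite -subr_ge0.
    have -> : 2 * ((tangency e - cutoff e) ^+ 2 + tangency e ^+ 2) - cutoff e ^+ 2 =
      (2 * tangency e - cutoff e) ^+ 2 by ring.
    exact: sqr_ge0.
  have h2 : (tangency e - cutoff e) ^+ 2 <= 16 / k * e.
    rewrite -(ler_pM2l (_ : 0 < k / 8)) ?divr_gt0//; apply: (le_trans gap).
    by rewrite le_eqVlt; apply/orP; left; apply/eqP; field; rewrite gt_eqF.
  have h3 : tangency e ^+ 2 <= k^-1 * e by apply: (le_trans t2); rewrite ler_pM2r.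
  have -> : 36 / k * e = 2 * (16 / k * e + k^-1 * e) + 2 * (k^-1 * e) by ring.
  have : 0 <= k^-1 * e by rewrite mulr_ge0 ?invr_ge0 ?(ltW k0) ?(ltW e0).
  by lra.
have t2' : tangency e ^+ 2 <= 36 / k * e.
  apply: (le_trans t2); rewrite ler_pM2r//; apply: (le_trans th'k).
  by rewrite ler_peMl ?invr_ge0 ?(ltW k0)//; lra.
have ap : `|cutoff e ^+ 2 - tangency e ^+ 2 - 4 / k * e| <= th' * e.
  have H : forall p q, tr e e p q -> p ^+ 2 <= 36 / k * e -> q ^+ 2 <= 36 / k * e ->
    `|p ^+ 2 - q ^+ 2 - 4 / k * e| <= th' * e.
    by near: e; exact: transit_approx.
  exact: H.
split => //; last 2 first.
- by apply: (le_trans ap); rewrite ler_pM2r.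
- by apply: (le_trans t2); rewrite ler_pM2r.
rewrite ltNge; apply/negP => c0.
have ct : cutoff e < tangency e by case: tc => X [_ _ _ [_ ? _] _].
have cc : cutoff e ^+ 2 <= tangency e ^+ 2.
  by rewrite ler_sqr ?nnegrE// ltW// (le_lt_trans c0).
move: ap; rewrite ler_norml => /andP[ap _].
have : - (th' * e) <= - (4 / k * e).
  by apply: (le_trans ap); rewrite lerBlDr addNr subr_le0.
have : th' * e <= k^-1 * e by rewrite ler_pM2r.
have : 0 < k^-1 * e by rewrite mulr_gt0// invr_gt0.
rewrite -mulrA lerN2; move: (k^-1 * e) (th' * e) => x y; lra.
Unshelve. all: by end_near. Qed.

End small_band.

(** * Backward sequences *)

Lemma sqr_le_lb (R : realFieldType) (u c : R) : 0 <= c -> u ^+ 2 <= c ^+ 2 -> - c <= u.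
Proof. by move=> c0 h; nra. Qed.

Lemma sqr_le_half (R : realFieldType) (u r : R) : 0 < r -> u ^+ 2 <= r ^+ 2 / 8 -> - (r / 2) <= u.
Proof.
by move=> r0 h; have r2 : 0 < r ^+ 2 by [rewrite exprn_gt0]; apply: sqr_le_lb; lra.
Qed.

Lemma sqr_le_gt (R : realFieldType) (u a r d : R) : 0 < r -> u ^+ 2 <= r ^+ 2 / 8 ->
  d <= r ^+ 2 / 16 -> a ^+ 2 <= u ^+ 2 + d -> - r < a.
Proof.
move=> r0 h1 h2 h3; have r2 : 0 < r ^+ 2 by rewrite exprn_gt0.
by apply: (@lt_le_trans _ _ (- (3 * r / 4))); [lra|apply: sqr_le_lb; lra].
Qed.

Section backward_cycles.
Variables (R : realType) (k1 k2 L M r : R) (phi1 phi2 : R -> R -> R).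
Hypothesis F1 : fold k1 L M r phi1.
Hypothesis F2 : fold k2 L M r phi2.
Local Notation tr1 := (transit r phi1).
Local Notation tr2 := (transit r phi2).
Local Notation regular := (regular L).
Local Notation tan1 := (tangency k1 L phi1).
Local Notation tan2 := (tangency k2 L phi2).
Local Notation cut1 := (cutoff k1 L r phi1).
Local Notation cut2 := (cutoff k2 L r phi2).

Definition drift := 12 / k1 + 12 / k2.

Lemma drift_gt0 : 0 < drift.
Proof. by rewrite addr_gt0// divr_gt0// ?(fold_k F1)// (fold_k F2). Qed.

Definition band (e : R) :=
  [/\ small_band k1 L r e, small_band k2 L r e & drift * e <= r ^+ 2 / 16] /\
  [/\ tr1 e e (cut1 e) (tan1 e), tr2 e e (cut2 e) (tan2 e), regular e (cut1 e)
    & regular e (cut2 e)] /\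
  [/\ cut1 e < tan2 e, cut2 e < tan1 e, cut1 e ^+ 2 <= tan1 e ^+ 2 + 12 / k1 * e
    & tan1 e ^+ 2 <= r ^+ 2 / 16].

Lemma cut_regular k phi e : fold k L M r phi -> small_band k L r e ->
  cutoff k L r phi e < 0 ->
  `|cutoff k L r phi e ^+ 2 - tangency k L phi e ^+ 2 - 4 / k * e| <= k^-1 * e ->
  regular e (cutoff k L r phi e) /\
  cutoff k L r phi e ^+ 2 <= tangency k L phi e ^+ 2 + 12 / k * e.
Proof.
move=> F [e0 _ _ _] c0; have k0 := fold_k F.
have kL := fold_kL F; have L0 : 0 < L by lra.
have -> : 4 / k * e = 4 * (k^-1 * e) by ring.
have -> : 12 / k * e = 12 * (k^-1 * e) by ring.
have ke : 0 < k^-1 * e by rewrite mulr_gt0// invr_gt0.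
rewrite ler_norml => /andP[h1 h2]; split; last by lra.
split => //; have t0 := sqr_ge0 (tangency k L phi e).
apply: (@le_trans _ _ (L * (3 * (k^-1 * e)))); last by rewrite ler_pM2l//; lra.
have -> : L * (3 * (k^-1 * e)) = L * 3 / k * e by ring.
by rewrite ler_peMl ?(ltW e0)// ler_pdivlMr// mul1r; lra.
Qed.

Lemma band_near : \forall e \near 0^'+, band e.
Proof.
have k10 := fold_k F1; have k20 := fold_k F2; have r0 := fold_r F1; have D0 := drift_gt0.
have kL := fold_kL F1; have L0 : 0 < L by lra.
have i1 : 0 < k1^-1 by rewrite invr_gt0.
have i2 : 0 < k2^-1 by rewrite invr_gt0.
have le12 : k1^-1 <= 12 / k1 + 12 / k2 by lra.
near=> e; have e0 : 0 < e by [].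
have s1 : small_band k1 L r e by near: e; exact: (small_band_near F1).
have s2 : small_band k2 L r e by near: e; exact: (small_band_near F2).
have [tc1 c10 ap1 t1] : [/\ tr1 e e (cut1 e) (tan1 e), cut1 e < 0,
  `|cut1 e ^+ 2 - tan1 e ^+ 2 - 4 / k1 * e| <= k1^-1 * e & tan1 e ^+ 2 <= k1^-1 * e].
  by near: e; exact: (cutoff_near F1).
have [tc2 c20 ap2 _] : [/\ tr2 e e (cut2 e) (tan2 e), cut2 e < 0,
  `|cut2 e ^+ 2 - tan2 e ^+ 2 - 4 / k2 * e| <= k2^-1 * e & tan2 e ^+ 2 <= k2^-1 * e].
  by near: e; exact: (cutoff_near F2).
have [rc1 cc1] := cut_regular F1 s1 c10 ap1.
have [rc2 cc2] := cut_regular F2 s2 c20 ap2.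
have De : drift * e <= r ^+ 2 / 16.
  rewrite mulrC -ler_pdivlMr//; near: e; apply: nbhs_right_le.
  by rewrite !divr_gt0// exprn_gt0.
have lt k phi c : fold k L M r phi -> small_band k L r e -> regular e c ->
    c < tangency k L phi e.
  move=> F s rc; have := regular_large F s rc; have [_] := tangencyP F s.
  have k0 := fold_k F.
  rewrite ler_norml ler_pdivlMr// => /andP[]; rewrite lerNl ler_pdivlMr// => h _.
  have Le : 0 < L * e by rewrite mulr_gt0.
  move=> hx; rewrite -(ltr_pM2l k0); move: h hx Le.
  rewrite -!mulrA mulrN mulNr [tangency _ _ _ _ * k]mulrC.
  by move: (L * e) (k * c) (k * _) => x y z; lra.
split; first by split.
split; first by split.
split => //; [exact: lt|exact: lt|].
by apply: (le_trans t1); apply: le_trans De; rewrite ler_pM2r.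
Unshelve. all: by end_near. Qed.

(** One full cycle between consecutive starts of left phases. In the reflected coordinate of [tr2] a
    left phase starts at [e] as well, which gives both halves the same form. *)
Definition band_cycle e u' u := exists2 p, tr2 e e u' p & tr1 e e p u.

Lemma cycle_lt e u' u : band_cycle e u' u -> u' < u.
Proof. by move=> [p [X [_ _ _ [_ h _] _]] [Y [_ _ _ [_ h' _] _]]]; exact: lt_trans h'. Qed.

(* The default value [u - 1] keeps the backward sequences decreasing when no preimage exists. *)
Definition back e u := xget (u - 1) [set u' | band_cycle e u' u].

Lemma back_lt e u : back e u < u.
Proof. by rewrite /back; case: xgetP => [u' _ /cycle_lt|_] //; lra. Qed.

Lemma cycle_regular e u' u : band e -> regular e u -> band_cycle e u' u ->
  [/\ regular e u', L * u ^+ 2 + 2 * e <= L * u' ^+ 2 & u' ^+ 2 <= u ^+ 2 + drift * e].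
Proof.
move=> [[s1 s2 _] _] ru [p t2 t1].
have ee : 0 <= e <= e by case: s1 => e0 _ _ _; rewrite lexx ltW.
have [_ rp h1 h2] := transit_regular F1 s1 ee ru t1.
have [_ ru' h3 h4] := transit_regular F2 s2 ee rp t2.
split => //; first lra.
have k10 := fold_k F1; have k20 := fold_k F2.
have h5 : p ^+ 2 <= u ^+ 2 + 12 / k1 * e.
  rewrite -(ler_pM2l k10) mulrDr; apply: (le_trans h2); rewrite lerD2l.
  by rewrite le_eqVlt; apply/orP; left; apply/eqP; field; rewrite gt_eqF.
have h6 : u' ^+ 2 <= p ^+ 2 + 12 / k2 * e.
  rewrite -(ler_pM2l k20) mulrDr; apply: (le_trans h4); rewrite lerD2l.
  by rewrite le_eqVlt; apply/orP; left; apply/eqP; field; rewrite gt_eqF.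
by rewrite /drift mulrDl; lra.
Qed.

Lemma backP e u : band e -> regular e u -> u ^+ 2 <= r ^+ 2 / 8 -> band_cycle e (back e u) u.
Proof.
move=> [[s1 s2 De] _] ru ur; rewrite /back; case: xgetP => [u' -> //|].
have r0 := fold_r F1; have k10 := fold_k F1; have k20 := fold_k F2.
have e0 : 0 < e by case: s1.
have ee : 0 <= e <= e by rewrite lexx ltW.
have r2 : 0 < r ^+ 2 by rewrite exprn_gt0.
have lu := sqr_le_half r0 ur.
have [p t1] := transit_regular_ex F1 s1 ee ru lu.
have [_ rp _ h2] := transit_regular F1 s1 ee ru t1.
have h5 : p ^+ 2 <= u ^+ 2 + 12 / k1 * e.
  rewrite -(ler_pM2l k10) mulrDr; apply: (le_trans h2); rewrite lerD2l.
  by rewrite le_eqVlt; apply/orP; left; apply/eqP; field; rewrite gt_eqF.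
have h6 : 0 < 12 / k2 * e by rewrite mulr_gt0// divr_gt0.
have lp : - (r / 2) <= p by apply: sqr_le_lb; rewrite /drift in De; lra.
have [u' t2] := transit_regular_ex F2 s2 ee rp lp.
by move=> /(_ u') []; exists p.
Qed.

Lemma cycle_mono e u u' v v' : 0 < e -> band_cycle e u' u -> band_cycle e v' v ->
  (u' < v') = (u < v).
Proof.
move=> e0 [p t2 t1] [q s2 s1]; have h := gtrN e0.
by rewrite (transit_mono F2 h t2 s2) (transit_mono F1 h t1 s1).
Qed.

(* Arrival times at [x = -e], where left phases start. After [n] further cycles, the orbit of
   [useq e n] arrives at the tangency of the right field, and that of [vseq e n] starts the left
   phase that ends tangentially. *)
Definition useq e n := iter n (back e) (tan1 e).
Definition vseq e n := iter n (back e) (cut2 e).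

Lemma useq_dec e n m : (n <= m)%N -> useq e m <= useq e n.
Proof.
move=> /subnK <-; elim: (m - n)%N => // j IH; rewrite addSn.
by apply: le_trans IH; exact/ltW/back_lt.
Qed.

(** The range [- (r / 4)] means squares up to [r^2 / 16]; one more cycle adds at most
    [drift * e <= r^2 / 16], so preimages still exist inside the box. The lower bound [n.+1%:R * e],
    gained by at least [e] per cycle, is what later makes distortions summable. *)
Lemma seq_spec e n : band e -> - (r / 4) <= useq e n ->
  [/\ band_cycle e (useq e n.+1) (useq e n), band_cycle e (vseq e n.+1) (vseq e n),
     useq e n.+1 < vseq e n, vseq e n < useq e n & regular e (vseq e n)] /\
  [/\ regular e (useq e n.+1), n.+1%:R * e <= L * useq e n.+1 ^+ 2,
    useq e n.+1 ^+ 2 <= useq e n ^+ 2 + drift * e,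
    vseq e n ^+ 2 <= r ^+ 2 / 8 & useq e n.+1 ^+ 2 <= r ^+ 2 / 8].
Proof.
move=> be; have [[s1 s2 De] [[tc1 tc2 rc1 rc2] [c1 c2 cc1 t1]]] := be.
have r0 := fold_r F1; have k10 := fold_k F1; have k20 := fold_k F2.
have kL := fold_kL F1; have L0 : 0 < L by lra.
have e0 : 0 < e by case: s1.
have ee : 0 <= e <= e by rewrite lexx ltW.
have r2 : 0 < r ^+ 2 by rewrite exprn_gt0.
(* Squares control the times only when these are negative; [useq e 0] is the tangency and may be
   positive, which is why its square is bounded separately. *)
have usq m : - (r / 4) <= useq e m -> useq e m ^+ 2 <= r ^+ 2 / 16.
  move=> hm; have [u0|u0] := leP (useq e m) 0; first by nra.
  have : useq e m <= tan1 e by rewrite -[tan1 e]/(useq e 0) useq_dec.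
  by move: t1; nra.
have vsq n' : - (r / 4) <= useq e n' -> useq e n'.+1 ^+ 2 <= useq e n' ^+ 2 + drift * e ->
    useq e n'.+1 < vseq e n' -> vseq e n' < 0 ->
    vseq e n' ^+ 2 <= r ^+ 2 / 8 /\ useq e n'.+1 ^+ 2 <= r ^+ 2 / 8.
  move=> /usq h1 h2 h3 h4; have h5 : useq e n'.+1 ^+ 2 <= r ^+ 2 / 8 by lra.
  by split => //; apply: le_trans h5; nra.
elim: n => [|n IH] hn.
  (* The tangency is not regular, so [backP] does not apply. The right phase of this first cycle is
     the one that starts at the cutoff, and the cutoff is regular. *)
  have cu : band_cycle e (useq e 1) (useq e 0).
    rewrite /useq /= /back; case: xgetP => [u' -> //|].
    have lp : - (r / 2) <= cut1 e.
      apply: sqr_le_lb; first lra.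
      have : 0 < 12 / k2 * e by rewrite mulr_gt0// divr_gt0.
      by move: De; rewrite /drift; lra.
    have [u' t2] := transit_regular_ex F2 s2 ee rc1 lp.
    by move=> /(_ u') []; exists (cut1 e).
  have [p tp2 tp1] := cu.
  have pE : p = cut1 e.
    have h := gtrN e0.
    have := transit_mono F1 h tp1 tc1; have := transit_mono F1 h tc1 tp1.
    by rewrite !ltxx => h1 h2; apply/eqP; rewrite eq_le leNgt h1 leNgt h2.
  rewrite pE in tp2 tp1.
  have [_ ru1 h3 h4] := transit_regular F2 s2 ee rc1 tp2.
  have lt1 : useq e 1 < vseq e 0.
    by rewrite (transit_mono F2 (gtrN e0) tp2 tc2).
  have h5 : useq e 1 ^+ 2 <= useq e 0 ^+ 2 + drift * e.
    have h6 : useq e 1 ^+ 2 <= cut1 e ^+ 2 + 12 / k2 * e.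
      rewrite -(ler_pM2l k20) mulrDr; apply: (le_trans h4); rewrite lerD2l.
      by rewrite le_eqVlt; apply/orP; left; apply/eqP; field; rewrite gt_eqF.
    by move: cc1 h6; rewrite /drift /useq /= mulrDl; lra.
  have [v8 u8] := vsq 0%N hn h5 lt1 (proj1 rc2).
  split; split => //; first exact: backP.
  by case: ru1; rewrite mul1r.
have hn' : - (r / 4) <= useq e n by apply: (le_trans hn); exact: useq_dec.
have [[cu cv uv vu rv] [ru ge_u le_u v8 u8]] := IH hn'.
have cu' : band_cycle e (useq e n.+2) (useq e n.+1) by apply: backP.
have [ru' g1 g2] := cycle_regular be ru cu'.
have [rv' g3 g4] := cycle_regular be rv cv.
have lt1 : useq e n.+2 < vseq e n.+1 by rewrite (cycle_mono e0 cu' cv).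
have lt2 : vseq e n.+1 < useq e n.+1 by rewrite (cycle_mono e0 cv cu).
have [v8' u8'] := vsq n.+1 hn g2 lt1 (proj1 rv').
split; split => //; first exact: backP.
by rewrite mulrSr mulrDl mul1r; lra.
Qed.

End backward_cycles.

(** * Limit of the length ratios *)

Lemma ln_near (R : realType) (c th : R) : 0 < c -> 0 < th ->
  exists2 d, 0 < d & forall x, `|x - c| <= d -> 0 < x /\ `|ln x - ln c| <= th.
Proof.
move=> c0 th0; have /cvgrPdist_lt/(_ _ th0) := continuous_ln c0.
rewrite near_simpl => /nbhs_ballP[d /= d0 h].
exists (Num.min (d / 2) (c / 2)); first by rewrite lt_min !divr_gt0.
move=> x; rewrite le_min => /andP[xd xc]; split.
  by move: xc; rewrite ler_norml; lra.
rewrite distrC ltW//; apply: h; rewrite /ball /= distrC; apply: (le_lt_trans xd).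
by lra.
Qed.

Section ratio_steps.
Variables (R : realType) (k1 k2 L M r : R) (phi1 phi2 : R -> R -> R).
Hypothesis F1 : fold k1 L M r phi1.
Hypothesis F2 : fold k2 L M r phi2.
Local Notation tr1 := (transit r phi1).
Local Notation regular := (regular L).
Local Notation u_ := (useq k1 L r phi1 phi2).
Local Notation v_ := (vseq k2 L r phi1 phi2).
Local Notation band := (band k1 k2 L r phi1 phi2).
Local Notation drift := (drift k1 k2).

(* Pulls a point of [x = -e] back to the section [x = 0] of initial points. *)
Definition hat e u := xget 0 [set a | tr1 e 0 a u].

Lemma hatP e u : band e -> regular e u -> u ^+ 2 <= r ^+ 2 / 8 ->
  [/\ tr1 e 0 (hat e u) u, hat e u < 0, u ^+ 2 <= (hat e u) ^+ 2 &
    (hat e u) ^+ 2 <= u ^+ 2 + drift * e].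
Proof.
move=> [[s1 s2 De] _] ru ur.
have r0 := fold_r F1; have k10 := fold_k F1; have k20 := fold_k F2.
have kL := fold_kL F1; have L0 : 0 < L by lra.
have e0 : 0 < e by case: s1.
have ee : 0 <= (0 : R) <= e by rewrite lexx ltW.
have r2 : 0 < r ^+ 2 by rewrite exprn_gt0.
have lu := sqr_le_half r0 ur.
have ta : tr1 e 0 (hat e u) u.
  rewrite /hat; case: xgetP => [a -> //|].
  by have [a ha] := transit_regular_ex F1 s1 ee ru lu => /(_ a).
have [_ [a0 _] h1 h2] := transit_regular F1 s1 ee ru ta.
split => //; first by rewrite -(ler_pM2l L0); lra.
have h5 : (hat e u) ^+ 2 <= u ^+ 2 + 12 / k1 * e.
  rewrite -(ler_pM2l k10) mulrDr; apply: (le_trans h2); rewrite lerD2l.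
  by rewrite le_eqVlt; apply/orP; left; apply/eqP; field; rewrite gt_eqF.
apply: (le_trans h5); rewrite lerD2l ler_pM2r// /drift lerDl.
by rewrite divr_ge0// ltW.
Qed.

Definition rho e n := ln ((v_ e n - u_ e n.+1) / (u_ e n - v_ e n)).

Definition rhohat e n := ln ((hat e (v_ e n) - hat e (u_ e n.+1)) /
  (hat e (u_ e n) - hat e (v_ e n))).

(** Since [d * m <= b^2 - m^2 <= 2 * drift * e], the left-hand side is at most
    [2 * drift * e^2 / m^4], and [m^2 >= n.+1%:R * e / L] cancels [e]. The factor 2 in the
    hypothesis allows for the two cycles spanned by three interleaved points and their images. *)
Lemma gap_bound (e m b d : R) n : 0 < e -> 0 < m -> m <= b ->
  b ^+ 2 <= m ^+ 2 + 2 * drift * e -> d <= b - m -> n.+1%:R * e <= L * m ^+ 2 ->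
  e * d / m ^+ 3 <= 2 * drift * L ^+ 2 / n.+1%:R ^+ 2.
Proof.
move=> e0 m0 mb b2 db nm.
have D0 : 0 < drift by exact: (drift_gt0 F1 F2).
have kL := fold_kL F1; have L0 : 0 < L by have := fold_k F1; lra.
have n0 : 0 < n.+1%:R :> R by rewrite ltr0n.
move: nm n0; move: (n.+1%:R) => N nm n0.
have dm : d * m <= 2 * drift * e.
  apply: (@le_trans _ _ ((b - m) * m)); first by rewrite ler_pM2r.
  have : 0 <= b * (b - m) by rewrite mulr_ge0//; lra.
  by lra.
have h2 : (N * e) ^+ 2 <= (L * m ^+ 2) ^+ 2.
  by rewrite ler_sqr// nnegrE mulr_ge0// ?sqr_ge0// ltW.
rewrite ler_pdivrMr ?exprn_gt0//.
have -> : 2 * drift * L ^+ 2 / N ^+ 2 * m ^+ 3 =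
  (2 * drift) * ((L * m ^+ 2) ^+ 2 / N ^+ 2) / m.
  by field; rewrite !gt_eqF.
rewrite ler_pdivlMr//.
apply: (@le_trans _ _ (2 * drift * e ^+ 2)).
  have -> : e * d * m = e * (d * m) by ring.
  have -> : 2 * drift * e ^+ 2 = e * (2 * drift * e) by ring.
  by rewrite ler_pM2l.
rewrite ler_pM2l ?mulr_gt0// ler_pdivlMr ?exprn_gt0//.
by rewrite mulrC -exprMn.
Qed.

Definition rate := (ratio_const k1 L M r + ratio_const k2 L M r) * (2 * drift * L ^+ 2).

Lemma rate_ge0 : 0 <= rate.
Proof.
have C1 := ratio_const_ge0 F1; have C2 := ratio_const_ge0 F2.
have D0 : 0 < drift by exact: (drift_gt0 F1 F2).
rewrite /rate mulr_ge0 ?addr_ge0// mulr_ge0 ?sqr_ge0//.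
by rewrite mulr_ge0// ltW.
Qed.

(** The cycle is split at [x = e]: each half is one phase, hence one application of [transit_ratio].
    All times involved are at most [u_ e n.+1], which serves as the common distance from the
    fold. *)
Lemma rho_step e n : band e -> - (r / 4) <= u_ e n.+2 ->
  `|rho e n.+2 - rho e n.+1| <= rate / n.+1%:R ^+ 2.
Proof.
move=> be hn2; have r0 := fold_r F1.
have hn1 : - (r / 4) <= u_ e n.+1 by apply: (le_trans hn2); exact: useq_dec.
have hn : - (r / 4) <= u_ e n by apply: (le_trans hn1); exact: useq_dec.
have [_ [ru nu le_u _ _]] := seq_spec F1 F2 be hn.
have [[cu cv uv vu rv] [ru' _ le_u' _ _]] := seq_spec F1 F2 be hn1.
have [[cu2 cv2 uv2 vu2 _] [_ _ le_u2 _ u8]] := seq_spec F1 F2 be hn2.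
have [[s1 s2 De] _] := be; have e0 : 0 < e by case: s1.
have ee : 0 <= e <= e by rewrite lexx ltW.
have r2 : 0 < r ^+ 2 by rewrite exprn_gt0.
have ru3 : - r < u_ e n.+3.
  by apply: (@lt_le_trans _ _ (- (r / 2))); [lra|apply: sqr_le_lb; lra].
have C1 := ratio_const_ge0 F1; have C2 := ratio_const_ge0 F2.
have [u0 _] := ru; have m0 : 0 < - u_ e n.+1 by rewrite oppr_gt0.
have em1 := regular_large F1 s1 ru; have em2 := regular_large F2 s2 ru.
have m_le : - u_ e n.+1 <= - u_ e n.+3.
  by rewrite lerN2; apply: useq_dec; exact: leqW (leqW (leqnn _)).
have b2 : (- u_ e n.+3) ^+ 2 <= (- u_ e n.+1) ^+ 2 + 2 * drift * e.
  by rewrite !sqrrN; lra.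
have nm : n.+1%:R * e <= L * (- u_ e n.+1) ^+ 2 by rewrite sqrrN.
have gb d : d <= - u_ e n.+3 - - u_ e n.+1 -> e * d / (- u_ e n.+1) ^+ 3 <=
    2 * drift * L ^+ 2 / n.+1%:R ^+ 2 by move=> hd; exact: (gap_bound e0 m0 m_le b2 hd nm).
have [p1 t21 t11] := cu2; have [p2 t22 t12] := cv; have [p3 t23 t13] := cu.
have lt_tr ph q x0 p : transit r ph e x0 q p -> q < p by case=> X [_ _ _ [_ ? _] _].
have p1u := lt_tr _ _ _ _ t21; have p3u := lt_tr _ _ _ _ t13.
have h := gtrN e0.
have p12 : p1 < p2 by rewrite (transit_mono F1 h t11 t12).
have p23 : p2 < p3 by rewrite (transit_mono F1 h t12 t13).
have um : u_ e n.+1 <= - - u_ e n.+1 by rewrite opprK.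
have rp1 := lt_trans ru3 p1u.
have A1 := @transit_ratio _ _ _ _ _ _ F1 e e0 e (- u_ e n.+1) p1 p2 p3
  (u_ e n.+2) (v_ e n.+1) (u_ e n.+1) ee m0 em1 t11 t12 t13 rp1 uv vu um.
have A2 := @transit_ratio _ _ _ _ _ _ F2 e e0 e (- u_ e n.+1)
  (u_ e n.+3) (v_ e n.+2) (u_ e n.+2) p1 p2 p3 ee m0 em2 t21 t22 t23 ru3 p12 p23
  (ltW (lt_le_trans p3u um)).
have B1 : e * (u_ e n.+1 - p1) / (- u_ e n.+1) ^+ 3 <= 2 * drift * L ^+ 2 / n.+1%:R ^+ 2.
  by apply: gb; rewrite opprK addrC lerD2r lerN2 ltW.
have B2 : e * (p3 - u_ e n.+3) / (- u_ e n.+1) ^+ 3 <= 2 * drift * L ^+ 2 / n.+1%:R ^+ 2.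
  by apply: gb; rewrite opprK addrC lerD2l ltW.
have D1 := le_trans A1 (ler_wpM2l C1 B1).
have D2 := le_trans A2 (ler_wpM2l C2 B2).
rewrite /rate -mulrA mulrDl /rho.
apply: (le_trans (ler_distD (ln ((p2 - p1) / (p3 - p2))) _ _)).
by rewrite addrC; apply: lerD; [exact: D1|exact: D2].
Qed.

Lemma rhohat_close e n : band e -> - (r / 4) <= u_ e n.+1 ->
  `|rhohat e n.+1 - rho e n.+1| <= rate / n.+1%:R ^+ 2.
Proof.
move=> be hn1; have r0 := fold_r F1.
have hn : - (r / 4) <= u_ e n by apply: (le_trans hn1); exact: useq_dec.
have [_ [ru nu le_u _ u8]] := seq_spec F1 F2 be hn.
have [[cu cv uv vu rv] [ru' _ le_u' v8 u8']] := seq_spec F1 F2 be hn1.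
have [[s1 s2 De] _] := be; have e0 : 0 < e by case: s1.
have ee : 0 <= (0 : R) <= e by rewrite lexx ltW.
have r2 : 0 < r ^+ 2 by rewrite exprn_gt0.
have C1 := ratio_const_ge0 F1; have C2 := ratio_const_ge0 F2.
have [u0 _] := ru; have m0 : 0 < - u_ e n.+1 by rewrite oppr_gt0.
have em1 := regular_large F1 s1 ru.
have [ta1 a0 _ a1] := hatP be ru' u8'.
have [ta2 _ _ _] := hatP be rv v8.
have [ta3 _ _ _] := hatP be ru u8.
have au : hat e (u_ e n.+2) < u_ e n.+2 by case: ta1 => X [_ _ _ [_ ? _] _].
have m_le : - u_ e n.+1 <= - hat e (u_ e n.+2) by lra.
have b2 : (- hat e (u_ e n.+2)) ^+ 2 <= (- u_ e n.+1) ^+ 2 + 2 * drift * e.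
  by rewrite !sqrrN; lra.
have nm : n.+1%:R * e <= L * (- u_ e n.+1) ^+ 2 by rewrite sqrrN.
have dle : u_ e n.+1 - hat e (u_ e n.+2) <= - hat e (u_ e n.+2) - - u_ e n.+1.
  by rewrite opprK addrC.
have B1 := gap_bound (d := u_ e n.+1 - hat e (u_ e n.+2)) e0 m0 m_le b2 dle nm.
have ra := sqr_le_gt r0 u8' De a1.
have um : u_ e n.+1 <= - - u_ e n.+1 by rewrite opprK.
have A1 := @transit_ratio _ _ _ _ _ _ F1 e e0 0 (- u_ e n.+1) _ _ _
  (u_ e n.+2) (v_ e n.+1) (u_ e n.+1) ee m0 em1 ta1 ta2 ta3 ra uv vu um.
have D1 := le_trans A1 (ler_wpM2l C1 B1).
rewrite /rhohat /rho; apply: (le_trans D1); rewrite /rate -[leRHS]mulrA ler_wpM2r ?lerDl//.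
have D0 : 0 < drift by exact: (drift_gt0 F1 F2).
by rewrite divr_ge0 ?exprn_ge0 ?ler0n// mulr_ge0 ?sqr_ge0// mulr_ge0// ltW.
Qed.

Lemma rho_cauchy e n m : band e -> - (r / 4) <= u_ e (n.+2 + m)%N ->
  `|rho e (n.+2 + m)%N - rho e n.+2| <= rate / n.+1%:R.
Proof.
move=> be; have C0 := rate_ge0.
suff H : - (r / 4) <= u_ e (n.+2 + m)%N ->
    `|rho e (n.+2 + m)%N - rho e n.+2| <= rate * (n.+1%:R^-1 - (n.+1 + m)%:R^-1).
  move=> /H h; apply: (le_trans h); rewrite ler_wpM2l// lerBlDr lerDl.
  by rewrite invr_ge0 ler0n.
elim: m => [|m IH] hm; first by rewrite !addn0 !subrr normr0 mulr0.
have hm' : - (r / 4) <= u_ e (n.+2 + m)%N.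
  by apply: (le_trans hm); apply: useq_dec; rewrite leq_add2l.
have := IH hm'; rewrite !addnS in hm *.
have := @rho_step e (n.+1 + m)%N be hm; rewrite -!addSn => h1 h2.
have -> : rho e (n.+2 + m).+1 - rho e n.+2 = (rho e (n.+2 + m).+1 - rho e (n.+2 + m)%N) +
  (rho e (n.+2 + m)%N - rho e n.+2) by ring.
apply: (le_trans (ler_normD _ _)); apply: (le_trans (lerD h1 h2)).
rewrite -mulrDr ler_wpM2l//.
have x0 : 0 < (n.+1 + m)%:R :> R by rewrite ltr0n addSn.
have -> : (n.+2 + m)%:R = (n.+1 + m)%:R + 1 :> R by rewrite natr1 addSn.
move: x0; move: ((n.+1 + m)%:R) => x x0.
(* The sum of inverse squares is majorized by a telescoping sum. *)
have h3 : (x + 1)^-2 <= x^-1 - (x + 1)^-1.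
  have -> : x^-1 - (x + 1)^-1 = (x * (x + 1))^-1.
    by field; apply/andP; split; rewrite gt_eqF//; lra.
  have x1 : 0 < x + 1 by lra.
  by rewrite lef_pV2 ?posrE ?exprn_gt0 ?mulr_gt0// expr2 ler_pM2r//; lra.
move: h3; move: ((x + 1) ^- 2) (x^-1) ((x + 1)^-1) (n.+1%:R^-1) => a b c d; lra.
Qed.

End ratio_steps.

Lemma ln_div3 (R : realType) (a b c : R) : 0 < a -> 0 < b -> 0 < c ->
  ln (a / b / c) = ln a - ln b - ln c.
Proof.
move=> a0 b0 c0; rewrite ln_div ?posrE ?divr_gt0//.
by rewrite ln_div ?posrE.
Qed.

(** Squared times are what the approximations control. Passing from lengths to differences of
    squares costs only the quotient of sums in the last logarithm. *)
Lemma ln_ratio_squares (R : realType) (u' v u e : R) : u' < v -> v < u -> u < 0 -> 0 < e ->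
  ln ((v - u') / (u - v)) = ln ((u' ^+ 2 - v ^+ 2) / e) - ln ((v ^+ 2 - u ^+ 2) / e)
    - ln ((- u' - v) / (- v - u)).
Proof.
move=> u'v vu u0 e0.
have h1 : 0 < v - u' by rewrite subr_gt0.
have h2 : 0 < u - v by rewrite subr_gt0.
have h3 : 0 < - u' - v by lra.
have h4 : 0 < - v - u by lra.
have -> : u' ^+ 2 - v ^+ 2 = (v - u') * (- u' - v) by ring.
have -> : v ^+ 2 - u ^+ 2 = (u - v) * (- v - u) by ring.
rewrite -ln_div3 ?divr_gt0 ?mulr_gt0//; congr ln; field.
by rewrite !gt_eqF.
Qed.

(** The quotient exceeds 1 by [(u - u') / (- v - u)], and [(u - u') * - u <= u'^2 - u^2 <= D e]
    while [e <= L u^2 / N]. *)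
Lemma ln_sum_ratio (R : realType) (u' v u e D L N : R) :
  u' < v -> v < u -> u < 0 -> 0 < N -> 0 < L -> 0 < D ->
  u' ^+ 2 <= u ^+ 2 + D * e -> N * e <= L * u ^+ 2 ->
  0 <= ln ((- u' - v) / (- v - u)) <= D * L / N.
Proof.
move=> u'v vu u0 N0 L0 D0 le_u nu.
have s0 : 0 < - v - u by lra.
have q1 : 1 <= (- u' - v) / (- v - u) by rewrite ler_pdivlMr//; lra.
rewrite ln_ge0//=; have -> : (- u' - v) / (- v - u) = 1 + (u - u') / (- v - u).
  by field; rewrite gt_eqF.
have d0 : 0 <= (u - u') / (- v - u) by rewrite divr_ge0 ?(ltW s0)//; lra.
apply: (le_trans (le_ln1Dx _)); first by clear -d0; lra.
rewrite ler_pdivrMr//; apply: (@le_trans _ _ (D * e / - u)).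
  rewrite ler_pdivlMr ?oppr_gt0//; clear -le_u u'v vu u0; nra.
apply: (@le_trans _ _ (D * L / N * - u)); last first.
  by rewrite ler_pM2l; [lra|rewrite divr_gt0// mulr_gt0].
rewrite ler_pdivrMr ?oppr_gt0//.
have -> : D * L / N * - u * - u = D * (L * u ^+ 2 / N) by ring.
by rewrite ler_pM2l// ler_pdivlMr// mulrC.
Qed.

Section ratio_limit.
Variables (R : realType) (k1 k2 L M r : R) (phi1 phi2 : R -> R -> R).
Hypothesis F1 : fold k1 L M r phi1.
Hypothesis F2 : fold k2 L M r phi2.
Local Notation tr1 := (transit r phi1).
Local Notation u_ := (useq k1 L r phi1 phi2).
Local Notation v_ := (vseq k2 L r phi1 phi2).
Local Notation band := (band k1 k2 L r phi1 phi2).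
Local Notation drift := (drift k1 k2).
Local Notation band_cycle := (band_cycle r phi1 phi2).

Local Notation rho := (rho k1 k2 L r phi1 phi2).
Local Notation rhohat := (rhohat k1 k2 L r phi1 phi2).
Local Notation rate := (rate k1 k2 L M r).

(** For a fixed number of cycles all arrival times are [O(sqrt e)], hence in range once [e] is
    small. *)
Lemma useq_small n : \forall e \near 0^'+,
  band e /\ - (r / 4) <= u_ e n /\ forall j, (j <= n)%N -> u_ e j ^+ 2 <= n.+1%:R * drift * e.
Proof.
have D0 : 0 < drift by exact: (drift_gt0 F1 F2).
have r0 := fold_r F1; have r2 : 0 < r ^+ 2 by rewrite exprn_gt0.
near=> e; have e0 : 0 < e by [].
have be : band e by near: e; exact: (band_near F1 F2).
have t1 : tangency k1 L phi1 e ^+ 2 <= drift * e.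
  have [_ _ _ //] : [/\ tr1 e e (cutoff k1 L r phi1 e) (tangency k1 L phi1 e),
    cutoff k1 L r phi1 e < 0, `|cutoff k1 L r phi1 e ^+ 2 - tangency k1 L phi1 e ^+ 2 - 4 / k1 * e|
     <= drift * e & tangency k1 L phi1 e ^+ 2 <= drift * e].
  by near: e; exact: (cutoff_near F1).
have ne : n.+1%:R * drift * e <= r ^+ 2 / 16.
  rewrite mulrC -ler_pdivlMr ?mulr_gt0//; near: e; apply: nbhs_right_le.
  by rewrite !divr_gt0 ?mulr_gt0.
have key j : (j <= n)%N -> u_ e j ^+ 2 <= j.+1%:R * drift * e.
  elim: j => [_|j IH jn]; first by rewrite mul1r.
  have hj := IH (ltnW jn).
  have rj : - (r / 4) <= u_ e j.
    apply: sqr_le_lb; first lra.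
    apply: (le_trans hj); have : j.+1%:R * drift * e <= n.+1%:R * drift * e.
      by rewrite ler_pM2r// ler_pM2r// ler_nat ltnS ltnW.
    by lra.
  have [_ [_ _ h _ _]] := seq_spec F1 F2 be rj.
  apply: (le_trans h); have -> : j.+2%:R = j.+1%:R + 1 :> R by rewrite natr1.
  by move: hj; move: (j.+1%:R) drift => x y; clear; lra.
have key' j : (j <= n)%N -> u_ e j ^+ 2 <= n.+1%:R * drift * e.
  move=> jn; apply: (le_trans (key _ jn)).
  by rewrite ler_pM2r// ler_pM2r// ler_nat ltnS.
split => //; split => //.
apply: sqr_le_lb; first lra.
by apply: (le_trans (key' n (leqnn n))); lra.
Unshelve. all: by end_near. Qed.

Lemma cycle_approx (K th : R) : 0 < K -> 0 < th -> \forall e \near 0^'+,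
  forall u' u, band_cycle e u' u -> u' ^+ 2 <= K * e -> u ^+ 2 <= K * e ->
    `|u' ^+ 2 - u ^+ 2 - (4 / k1 + 4 / k2) * e| <= th * e.
Proof.
move=> K0 th0; have h0 : 0 < th / 2 by rewrite divr_gt0.
apply: filterS2 (transit_approx F1 K0 h0) (transit_approx F2 K0 h0) => e h1 h2 u' u.
move=> [p t2 t1] hu' hu.
have hp : p ^+ 2 <= K * e.
  have u'p : u' < p by case: t2 => X [_ _ _ [_ ? _] _].
  have pu : p < u by case: t1 => X [_ _ _ [_ ? _] _].
  have [p0|p0] := leP p 0; first by apply: le_trans hu'; nra.
  by apply: le_trans hu; nra.
have := h1 _ _ t1 hp hu; have := h2 _ _ t2 hu' hp.
rewrite !ler_norml mulrDl; lra.
Qed.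

(** Consecutive squares differ by nearly [4 e / k2] and [4 e / k1] alternately, whose quotient is
    the limit [k2 / k1] of [rho]. The tolerance is halved at each induction step, so the range of
    [e] depends on [n]. *)
Lemma seq_approx n (th : R) : 0 < th -> \forall e \near 0^'+,
  `|u_ e n ^+ 2 - n%:R * (4 / k1 + 4 / k2) * e| <= th * e /\
  `|v_ e n ^+ 2 - (n%:R * (4 / k1 + 4 / k2) + 4 / k2) * e| <= th * e.
Proof.
have D0 : 0 < drift by exact: (drift_gt0 F1 F2).
elim: n th => [|n IH] th th0; have h0 : 0 < th / 2 by rewrite divr_gt0.
  apply: filterS2 (cutoff_near F1 h0) (cutoff_near F2 h0) => e [_ _ _ h1] [_ _ h2 h3].
  rewrite !mul0r subr0 add0r; have := sqr_ge0 (tangency k1 L phi1 e).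
  have := sqr_ge0 (tangency k2 L phi2 e).
  move: h2; rewrite /useq /vseq /= !ler_norml; lra.
have K0 : 0 < n.+3%:R * drift by rewrite mulr_gt0// ltr0n.
apply: filterS3 (IH _ h0) (cycle_approx K0 h0) (useq_small n.+2) => e [h1 h2] h3 [be [hn hK]].
have hn1 : - (r / 4) <= u_ e n.+1 by apply: (le_trans hn); exact: useq_dec.
have hn0 : - (r / 4) <= u_ e n by apply: (le_trans hn1); exact: useq_dec.
have [[cu cv uv _ [v0 _]] _] := seq_spec F1 F2 be hn0.
have [[_ _ uv' _ [v0' _]] _] := seq_spec F1 F2 be hn1.
have a1 := h3 _ _ cu (hK n.+1 (leqnSn _)) (hK n (leqW (leqnSn _))).
have a2 : `|v_ e n.+1 ^+ 2 - v_ e n ^+ 2 - (4 / k1 + 4 / k2) * e| <= th / 2 * e.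
  apply: h3 cv _ _.
    by apply: le_trans (hK n.+2 (leqnn _)); nra.
  by apply: le_trans (hK n.+1 (leqnSn _)); nra.
move: h1 h2 a1 a2; rewrite [n.+1%:R]mulrSr [in X in X -> _]ler_norml !ler_norml.
move: (4 / k1 + 4 / k2) (4 / k2) => S S2.
move=> /andP[h1 h1'] /andP[h2 h2'] /andP[a1 a1'] /andP[a2 a2'].
by clear -h1 h1' h2 h2' a1 a1' a2 a2'; split; rewrite ?mulrDl ?mul1r; lra.
Qed.

Lemma rho_near n (th : R) : 0 < th -> \forall e \near 0^'+,
  `|rho e n.+1 - ln (k2 / k1)| <= th + drift * L / n.+1%:R.
Proof.
move=> th0; have k10 := fold_k F1; have k20 := fold_k F2.
have kL := fold_kL F1; have L0 : 0 < L by lra.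
have D0 : 0 < drift by exact: (drift_gt0 F1 F2).
have c1 : 0 < 4 / k1 by rewrite divr_gt0.
have c2 : 0 < 4 / k2 by rewrite divr_gt0.
have th20 : 0 < th / 2 by rewrite divr_gt0.
have [d1 d10 hd1] := ln_near c1 th20.
have [d2 d20 hd2] := ln_near c2 th20.
pose d := Num.min d1 d2 / 2.
have d0 : 0 < d by rewrite divr_gt0// lt_min d10.
have dd1 : 2 * d <= d1 by rewrite /d mulrC divfK// ge_min lexx.
have dd2 : 2 * d <= d2 by rewrite /d mulrC divfK// ge_min lexx orbT.
apply: filterS3 (seq_approx n.+1 d0) (seq_approx n.+2 d0) (useq_small n.+1)
  => e [hu hv] [hu' _] [be [hn _]].
have e0 : 0 < e by case: be => -[[]].
have hn0 : - (r / 4) <= u_ e n by apply: (le_trans hn); exact: useq_dec.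
have [_ [[u0 _] nu _ _ _]] := seq_spec F1 F2 be hn0.
have [[_ _ uv vu [v0 _]] [_ _ le_u _ _]] := seq_spec F1 F2 be hn.
rewrite /rho; move: u0 nu uv vu v0 le_u hu hv hu'.
move: (u_ e n.+1) (v_ e n.+1) (u_ e n.+2) => u v u' u0 nu u'v vu v0 le_u hu hv hu'.
pose A := (u' ^+ 2 - v ^+ 2) / e; pose B := (v ^+ 2 - u ^+ 2) / e.
have [A0 hA] : 0 < A /\ `|ln A - ln (4 / k1)| <= th / 2.
  apply: hd1; apply: le_trans dd1; rewrite -(ler_pM2r e0) -[X in _ * X](gtr0_norm e0) -normrM.
  rewrite /A mulrBl divfK ?gt_eqF//; move: hu' hv; rewrite [n.+2%:R]mulrSr.
  by rewrite !ler_norml !mulrDl !mul1r; clear; lra.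
have [B0 hB] : 0 < B /\ `|ln B - ln (4 / k2)| <= th / 2.
  apply: hd2; apply: le_trans dd2; rewrite -(ler_pM2r e0) -[X in _ * X](gtr0_norm e0) -normrM.
  rewrite /B mulrBl divfK ?gt_eqF//; move: hu hv.
  by rewrite !ler_norml !mulrDl; clear; lra.
rewrite (ln_ratio_squares u'v vu u0 e0).
have lnq := ln_sum_ratio u'v vu u0 (ltr0Sn _ n) L0 D0 le_u nu.
rewrite -/A -/B.
have -> : ln (k2 / k1) = ln (4 / k1) - ln (4 / k2).
  by rewrite -ln_div ?posrE//; congr ln; field; rewrite !gt_eqF.
move: hA hB lnq; move: (ln A) (ln B) (ln (_ / (- v - u))) (ln (4 / k1)) (ln (4 / k2)).
move: (drift * L / n.+1%:R) => x a1 a2 a3 a4 a5; rewrite !ler_norml; clear.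
by move=> /andP[h1 h2] /andP[h3 h4] /andP[h5 h6]; apply/andP; split; lra.
Qed.

(** The index is fixed before [e]: it makes both the sum of all later distortions and the bias
    [drift * L / n] small. Then [e] is taken small for this single index, and [rho_cauchy], uniform
    in [e], carries the estimate to all later ones. *)
Lemma rhohat_near (th : R) : 0 < th -> exists N, \forall e \near 0^'+,
  forall n, (N <= n)%N -> - (r / 4) <= u_ e n -> `|rhohat e n - ln (k2 / k1)| <= th.
Proof.
move=> th0; have D0 : 0 < drift by exact: (drift_gt0 F1 F2).
have L0 : 0 < L by have := fold_kL F1; have := fold_k F1; lra.
have C0 := (rate_ge0 F1 F2); have th2 : 0 < th / 2 by rewrite divr_gt0.
pose c := (2 * rate + drift * L) / (th / 2).
have c0 : 0 <= c.
  apply: divr_ge0; last exact: ltW.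
  by apply: addr_ge0; apply: mulr_ge0 => //; exact: ltW.
pose N1 := Num.bound c.
have hN : (2 * rate + drift * L) / N1.+1%:R <= th / 2.
  rewrite ler_pdivrMr ?ltr0n// [leRHS]mulrC -ler_pdivrMr//.
  by apply: (le_trans (ltW (archi_boundP c0))); rewrite ler_nat leqnSn.
exists N1.+2; apply: filterS2 (band_near F1 F2) (rho_near N1.+1 th2) => e be hr n Nn hn.
have E : n = (N1.+2 + (n - N1.+2))%N by rewrite subnKC.
have h1 := @rho_cauchy _ _ _ _ _ _ _ _ F1 F2 e N1 (n - N1.+2) be.
rewrite -E in h1; have {}h1 := h1 hn.
have h2 : `|rhohat e n - rho e n| <= rate / N1.+1%:R.
  move: Nn hn; case: n {E h1} => // n Nn hn.
  apply: (le_trans (rhohat_close F1 F2 be hn)); rewrite ler_wpM2l//.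
  rewrite lef_pV2 ?posrE ?exprn_gt0 ?ltr0n// -natrX ler_nat.
  apply: (@leq_trans n.+1); first by exact: ltnW.
  by rewrite expnS leq_pmulr// expn_gt0.
have h3 : drift * L / N1.+2%:R <= drift * L / N1.+1%:R.
  rewrite ler_pM2l ?mulr_gt0// lef_pV2 ?posrE ?ltr0n// ler_nat //.
have hN' : 2 * (rate / N1.+1%:R) + drift * L / N1.+1%:R <= th / 2.
  by apply: le_trans hN; rewrite le_eqVlt; apply/orP; left; apply/eqP; ring.
have t1 := ler_distD (rho e n) (rhohat e n) (ln (k2 / k1)).
have t2 := ler_distD (rho e N1.+2) (rho e n) (ln (k2 / k1)).
move: h1 h2 h3 hr hN' t1 t2.
move: (rate / N1.+1%:R) (drift * L / N1.+1%:R) (drift * L / N1.+2%:R) => x y z.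
clear; lra.
Qed.

End ratio_limit.

(** * Hysteretic orbits *)

Lemma itv_within_continuous (R : realType) (f : R -> R) (a b : R) :
  (forall c e, a <= c <= b -> 0 < e ->
    exists2 d, 0 < d & forall t, a <= t <= b -> `|t - c| < d -> `|f t - f c| < e) ->
  {within `[a, b], continuous f}.
Proof.
move=> h; apply/subspace_continuousP => c; rewrite /= in_itv /= => cab.
apply/cvgrPdist_lt => e e0; have [d d0 hd] := h c e cab e0.
rewrite near_withinE near_simpl; apply/nbhs_ballP; exists d => // t tc.
rewrite /= in_itv /= => tab; rewrite distrC; apply: hd => //.
by rewrite distrC; exact: tc.
Qed.

Section solves.
Variables (R : realType) (U : set (R * R)) (F : R * R -> R * R).

Lemma solves_on_ext (a b : R) (x1 y1 x2 y2 : R -> R) :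
  (forall t, a <= t <= b -> x1 t = x2 t /\ y1 t = y2 t) ->
  solves_on U F a b x1 y1 -> solves_on U F a b x2 y2.
Proof.
move=> h [cx cy hU hd]; split.
- apply: subspace_eq_continuous cx => t; rewrite inE /= in_itv /=; by case/h.
- apply: subspace_eq_continuous cy => t; rewrite inE /= in_itv /=; by case/h.
- by move=> t tab; move: (hU t tab); move: tab; rewrite in_itv /= => /h [-> ->].
move=> t tab; have [h1 h2] := hd t tab.
have hn : \forall u \near t, x1 u = x2 u /\ y1 u = y2 u.
  have : \forall u \near t, u \in `]a, b[ by exact: near_in_itvoo.
  apply: filterS => u; rewrite in_itv /= => /andP[au ub].
  by apply: h; rewrite !ltW.
have [<- <-] : x1 t = x2 t /\ y1 t = y2 t by exact: nbhs_singleton hn.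
by split; [apply: near_eq_is_derive h1|apply: near_eq_is_derive h2];
  apply: filterS hn => u [].
Qed.

Lemma is_derive1_shift (f : R -> R) (c t d : R) :
  is_derive (t - c) 1 f d -> is_derive t 1 (fun u => f (u - c)) d.
Proof.
move=> h; have h1 : is_derive t 1 (fun u : R => u - c) 1.
  by apply: is_derive_eq; rewrite subr0.
by have := @is_derive1_comp _ f (fun u : R => u - c) t _ _ h h1; rewrite mulr1.
Qed.

Lemma within_shift (f : R -> R) (a b c : R) : {within `[a, b], continuous f} ->
  {within `[a + c, b + c], continuous (fun t => f (t - c))}.
Proof.
move=> /within_continuous_itvP cf; apply: itv_within_continuous => t e tab e0.
have tab' : a <= t - c <= b by lra.
have [d d0 hd] := cf (t - c) e tab' e0.
exists d => // s sab st; apply: hd; first by lra.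
by have -> : s - c - (t - c) = s - t by ring.
Qed.

Lemma solves_on_shift (a b c : R) (x y : R -> R) : solves_on U F a b x y ->
  solves_on U F (a + c) (b + c) (fun t => x (t - c)) (fun t => y (t - c)).
Proof.
move=> [cx cy hU hd]; split; [exact: within_shift|exact: within_shift| |].
  by move=> t; rewrite in_itv /= => tab; apply: hU; rewrite in_itv /=; lra.
move=> t; rewrite in_itv /= => tab.
have [|h1 h2] := hd (t - c); first by rewrite in_itv /=; lra.
by split; exact: is_derive1_shift.
Qed.

End solves.

(* In the box, the field [(f, g)] is [gam * (phi, 1)] in the coordinates [(s x, y)]; [s = -1] is
   the reflection used for the left mode. *)
Record chart (R : realType) (s c L G r : R) (U : set (R * R)) (f g : R * R -> R)
    (phi gam : R -> R -> R) : Prop := Chart {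
  chart_s : s = 1 \/ s = -1;
  chart_c : 0 < c;
  chart_U : forall t x, - r <= t <= r -> - r <= x <= r -> U (s * x, t);
  chart_f : forall t x, - r <= t <= r -> - r <= x <= r ->
    s * f (s * x, t) = phi t x * gam t x;
  chart_g : forall t x, - r <= t <= r -> - r <= x <= r -> g (s * x, t) = gam t x;
  chart_gc : forall t x, c <= gam t x;
  chart_gG : forall t x, `|gam t x| <= G;
  chart_lip : lipschitz2 L gam;
  chart_small : 16 * L * r <= c }.

(** * Between time [y] and physical time *)

Section segments.
Variables (R : realType) (k L M r s c G : R) (U : set (R * R)) (f g : R * R -> R).
Variables (phi gam : R -> R -> R).
Hypothesis F : fold k L M r phi.
Hypothesis C : chart s c L G r U f g phi gam.
Local Notation sol := (sol r phi).
Local Notation field := (fun p => (f p, g p)).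

Lemma chart_ss : s * s = 1.
Proof. by case: (chart_s C) => ->; rewrite ?mulr1// mulrNN mulr1. Qed.

Lemma chart_norm (x : R) : `|s * x| = `|x|.
Proof. by rewrite normrM; case: (chart_s C) => ->; rewrite ?normrN normr1 mul1r. Qed.

(** Physical time is recovered from the scalar equation [y' = gam y (X y)]; then [x = s * X y] by
    the chain rule. *)
Lemma segment_ex X p q : sol X -> - r <= p -> p <= q -> q <= r ->
  (forall t, p <= t <= q -> `|X t| <= r) ->
  exists T y, [/\ 0 <= T, y 0 = p, y T = q,
    forall t, 0 <= t < T -> p <= y t < q &
    solves_on U field 0 T (fun t => s * X (y t)) y].
Proof.
move=> hX rp pq qr hXr; have r0 := fold_r F; have k0 := fold_k F.
have c0 := chart_c C; have L0 : 0 < L by have := fold_kL F; lra.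
pose H (t y : R) := gam y (X (clamp (- r) r y)).
have rr := ltW (gtrN r0).
have hX' u : - r <= u <= r -> is_derive u 1 X (phi u (X u)) by move=> hu; apply: hX; lra.
have HL : lipschitz2 (2 * L) H.
  move=> t t' y y'; apply: (le_trans (chart_lip C _ _ _ _)).
  have h1 := sol_lip F hX (clamp_itv y rr) (clamp_itv y' rr).
  have h2 := clamp_lip y y' rr.
  have h3 := fold_small2 F.
  have h4 : 2 * L * r * `|clamp (- r) r y - clamp (- r) r y'| <= 1 * `|y - y'|.
    by apply: ler_pM => //; [rewrite !mulr_ge0 ?(ltW L0) ?(ltW r0)|lra].
  have -> : 2 * L * (`|t - t'| + `|y - y'|) =
    L * (`|y - y'| + (`|y - y'| + 2 * `|t - t'|)) by ring.
  rewrite ler_wpM2l ?(ltW L0)// lerD2l; have := normr_ge0 (t - t').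
  have := le_trans h1 h4; lra.
have HG t y : `|H t y| <= G by exact: chart_gG C _ _.
have rc : 0 < r / c by rewrite divr_gt0.
have h0 : - (r / c) <= 0 <= 3 * (r / c) by lra.
(* The speed of [y] is at least [c], so [q], at distance at most [2 r], is reached within time
   [2 r / c]. The equation is solved on a longer interval, which keeps derivatives two-sided. *)
have short : (3 * (r / c) - - (r / c)) * (2 * L) <= 2^-1.
  have h := chart_small C; have -> : (3 * (r / c) - - (r / c)) * (2 * L) = 16 * L * r / c / 2.
    by field; rewrite gt_eqF.
  rewrite ler_pdivrMr// mulVf// ler_pdivrMr// mul1r; lra.
have [y y0 hy] := @picard _ H (2 * L) G _ _ 0 p HL HG h0 short.
have grow a b : 0 <= a -> a <= b -> b <= 2 * (r / c) -> c * (b - a) <= y b - y a.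
  move=> a0 ab b2; have hy' t : a <= t <= b -> is_derive t 1 y (H t (y t)).
    by move=> ht; apply: hy; lra.
  apply: (MVT_ger (df := fun t => H t (y t)) ab).
  - exact: derive_within_continuous hy'.
  - by move=> t ht; apply: hy'; lra.
  - by move=> t ht; exact: chart_gc C _ _.
have b0 : 0 <= 2 * (r / c) by lra.
have cy : {within `[0, 2 * (r / c)], continuous y}.
  apply: (derive_within_continuous (df := fun t => H t (y t))) => t ht.
  by apply: hy; lra.
have yb : q <= y (2 * (r / c)).
  have := grow 0 (2 * (r / c)) (lexx _) b0 (lexx _); rewrite subr0 y0.
  have -> : c * (2 * (r / c)) = 2 * r by field; rewrite gt_eqF.
  lra.
have [|T hT yT] := @ivt_between _ y 0 (2 * (r / c)) q b0 cy; first by rewrite y0; nra.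
have /andP[T0 T2] := hT.
have inT t : 0 <= t <= T -> - (r / c) < t < 3 * (r / c).
  move=> /andP[t0 tT]; rewrite (lt_le_trans _ t0) ?oppr_lt0//.
  by rewrite (le_lt_trans tT)// (le_lt_trans T2)// ltr_pM2r// ltr_nat.
have yitv t : 0 <= t < T -> p <= y t < q.
  move=> /andP[t0 tT]; have h1 := grow 0 t (lexx _) t0 (le_trans (ltW tT) T2).
  have h2 := grow t T t0 (ltW tT) T2.
  rewrite y0 subr0 in h1; rewrite yT in h2; apply/andP; split.
    by rewrite -subr_ge0; apply: le_trans h1; rewrite mulr_ge0// ltW.
  by rewrite -subr_gt0; apply: lt_le_trans h2; rewrite mulr_gt0// subr_gt0.
have yitv' t : 0 <= t <= T -> p <= y t <= q.
  case/andP=> t0; rewrite le_eqVlt => /orP[/eqP->|tT]; first by rewrite yT pq lexx.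
  by have := yitv t; rewrite t0 tT => /(_ isT) /andP[-> /ltW->].
have ybox t : 0 <= t <= T -> - r <= y t <= r.
  by move=> /yitv' /andP[h1 h2]; rewrite (le_trans rp h1) (le_trans h2).
have dy t : 0 <= t <= T -> is_derive t 1 y (gam (y t) (X (y t))).
  by move=> ht; have := hy t (inT t ht); rewrite /H clamp_id// ybox.
have dx t : 0 <= t <= T -> is_derive t 1 (fun t => s * X (y t))
    (s * (phi (y t) (X (y t)) * gam (y t) (X (y t)))).
  move=> ht; have dyt := dy t ht; have dX := hX' _ (ybox t ht).
  have h := @is_derive1_comp _ X y t _ _ dX dyt.
  have -> : (fun t => s * X (y t)) = (fun t => s * (X \o y) t) by [].
  by apply: is_derive_eq; rewrite /GRing.scale.
have box t : 0 <= t <= T -> - r <= y t <= r /\ - r <= X (y t) <= r.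
  by move=> ht; split; [exact: ybox|rewrite -ler_norml; exact: hXr (yitv' t ht)].
exists T, y; split; [exact: T0|exact: y0|exact: yT|exact: yitv|split].
- exact: derive_within_continuous dx.
- exact: derive_within_continuous dy.
- by move=> t; rewrite in_itv /= => /box [h1 h2]; exact: chart_U C _ _ h1 h2.
move=> t; rewrite in_itv /= => /andP[t0 tT].
have ht' : 0 <= t <= T by rewrite !ltW.
have [h1 h2] := box t ht'; split; last by rewrite (chart_g C h1 h2); exact: dy.
have := dx t ht'; rewrite -(chart_f C h1 h2) mulrA chart_ss mul1r.
exact.
Qed.

(** The converse of [segment_ex]: an arbitrary orbit inside the box satisfies the equation of [X] up
    to the factor [gam], so [s * x - X y] vanishes by Gronwall. *)
Lemma follow X p S x y : sol X -> - r <= p <= r -> 0 <= S ->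
  solves_on U field 0 S x y -> x 0 = s * X p -> y 0 = p ->
  (forall t, 0 <= t <= S -> `|x t| <= r) -> (forall t, 0 <= t < S -> `|y t| <= r) ->
  forall t, 0 <= t <= S -> x t = s * X (y t) /\ p <= y t.
Proof.
move=> hX hp S0 [cx cy hU hd] x0 y0 hx hy0 t ht.
have r0 := fold_r F; have c0 := chart_c C.
have hX' u : - r <= u <= r -> is_derive u 1 X (phi u (X u)).
  by move=> hu; apply: hX; lra.
have hy u : 0 <= u <= S -> `|y u| <= r.
  case/andP=> u0; rewrite le_eqVlt => /orP[/eqP->|uS]; last by apply: hy0; rewrite u0.
  have [E|Spos] := eqVneq S 0; first by rewrite E y0 ler_norml.
  rewrite leNgt; apply/negP => yS.
  have [d d0 hdl] := within_continuous_itvP cy (ltac:(by rewrite S0 lexx) : 0 <= S <= S)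
    (ltac:(by rewrite subr_gt0) : 0 < `|y S| - r).
  have SS : 0 < S by rewrite lt_neqAle eq_sym Spos.
  pose v := Num.max 0 (S - d / 2).
  have v0 : 0 <= v by rewrite le_max lexx.
  have d2 : 0 < d / 2 by rewrite divr_gt0.
  have vS : v < S by rewrite gt_max SS ltrBlDr ltrDl.
  have Sv : S - v < d.
    have h : S - d / 2 <= v by rewrite le_max lexx orbT.
    rewrite ltrBlDl; apply: (le_lt_trans (_ : _ <= v + d / 2)); first by rewrite -lerBlDr.
    by rewrite ltrD2l [ltRHS]splitr ltrDl.
  have := hdl v; rewrite v0 (ltW vS) => /(_ isT).
  rewrite distrC gtr0_norm ?subr_gt0// => /(_ Sv).
  have := hy0 v; rewrite v0 vS => /(_ isT) yv.
  have := ler_distD (y v) (y S) 0; rewrite !subr0 distrC => h h'.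
  by have := le_lt_trans h (ltr_leD h' yv); rewrite subrK ltxx.
have hd' u : 0 < u < S -> is_derive u 1 x (f (x u, y u)) /\ is_derive u 1 y (g (x u, y u)).
  by move=> hu; exact: hd.
have sx u : s * (s * x u) = x u by rewrite mulrA chart_ss mul1r.
have box u : 0 <= u <= S -> - r <= y u <= r /\ - r <= s * x u <= r.
  by move=> hu; rewrite -!ler_norml chart_norm; split; [exact: hy|exact: hx].
have mono u : 0 <= u <= S -> p <= y u.
  move=> /andP[u0 uS]; have cyu : {within `[0, u], continuous y}.
    apply: continuous_subspaceW cy => v /=; rewrite !in_itv /= => /andP[-> h].
    exact: le_trans uS.
  have h : 0 * (u - 0) <= y u - y 0.
    apply: (MVT_ger (df := fun v => g (x v, y v)) u0 cyu) => v /andP[v0 vu].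
      by have [] := hd' v; [rewrite v0 (lt_le_trans vu)|].
    have [|h1 h2] := box v; first by rewrite (ltW v0) (le_trans (ltW vu)).
    have := chart_g C h1 h2; rewrite sx => ->.
    by apply: le_trans (chart_gc C _ _); exact: ltW.
  by rewrite mul0r y0 subr_ge0 in h.
split; last exact: mono.
pose z u := s * x u - X (y u).
have G0 : 0 <= G by exact: le_trans (chart_gG C 0 0).
have zd u : 0 < u < S -> is_derive u 1 z
    (phi (y u) (s * x u) * gam (y u) (s * x u) - phi (y u) (X (y u)) * gam (y u) (s * x u)).
  move=> hu; have [h1 h2] := hd' u hu.
  have [|b1 b2] := box u; first by case/andP: hu => u0 uS; rewrite !ltW.
  have dX := hX' _ b1.
  have := chart_g C b1 b2; have := chart_f C b1 b2; rewrite sx => <- Eg.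
  have h := @is_derive1_comp _ X y u _ _ dX h2.
  have dsx : is_derive u 1 (fun v : R => s * x v) (s * f (x u, y u)).
    by apply: is_derive_eq; rewrite /GRing.scale.
  by rewrite -Eg; exact: (is_derive1_subr dsx h).
have cX v : - r <= v <= r -> {for v, continuous X}.
  by move=> /hX' h; apply: is_derive1_continuous h.
have cz : {within `[0, t], continuous z}.
  apply/subspace_continuousP => u hu.
  have sub : `[0, t] `<=` `[0, S].
    by move=> v /=; rewrite !in_itv /= => /andP[-> h]; apply: (le_trans h); case/andP: ht.
  have hu' : 0 <= u <= S by have := sub u hu; rewrite /= in_itv.
  have [b1 _] := box u hu'.
  have cxu : {within `[0, t], continuous x} by exact: continuous_subspaceW cx.
  have cyu : {within `[0, t], continuous y} by exact: continuous_subspaceW cy.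
  apply: cvgB; first apply: cvgM; first exact: cvg_cst.
    by move/subspace_continuousP : cxu; exact.
  apply: (cvg_comp y X); last exact: cX b1.
  by move/subspace_continuousP : cyu; exact.
have : z 0 = 0 <-> z t = 0.
  apply: (@gronwall0 R z (fun u => phi (y u) (s * x u) * gam (y u) (s * x u) -
    phi (y u) (X (y u)) * gam (y u) (s * x u)) 0 t (L * G) _ cz).
  - by case/andP: ht.
  - move=> u /andP[u0 ut]; apply: zd; rewrite u0 (lt_le_trans ut)//; by case/andP: ht.
  - move=> u hu; rewrite -mulrBl normrM.
    have h1 := fold_lip F (y u) (y u) (s * x u) (X (y u)).
    rewrite subrr normr0 add0r in h1.
    rewrite mulrAC; apply: ler_pM => //; exact: chart_gG C _ _.
have z0 : z 0 = 0 by rewrite /z x0 y0 mulrA chart_ss mul1r subrr.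
move=> [/(_ z0) zt _]; have -> : X (y t) = s * x t by apply/esym/eqP; rewrite -subr_eq0 -/(z t) zt.
by rewrite sx.
Qed.

Lemma follow_or_reach X p t1 S x y : sol X -> - r < p -> p <= t1 -> t1 < r -> 0 <= S ->
  solves_on U field 0 S x y -> x 0 = s * X p -> y 0 = p ->
  (forall t, 0 <= t <= S -> `|x t| <= r) ->
  (exists2 t, 0 <= t <= S & y t = t1 /\ x t = s * X t1) \/
  (forall t, 0 <= t <= S -> p <= y t < t1 /\ x t = s * X (y t)).
Proof.
move=> hX rp pt1 t1r S0 hs x0 y0 hx; have [cx cy hU hd] := hs.
have sub S' : 0 <= S' <= S -> solves_on U field 0 S' x y.
  move=> hS'; split.
  - by apply: continuous_subspaceW cx => v /=; rewrite !in_itv /=; lra.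
  - by apply: continuous_subspaceW cy => v /=; rewrite !in_itv /=; lra.
  - by move=> t ht; apply: hU; move: ht; rewrite !in_itv /=; lra.
  - by move=> t ht; apply: hd; move: ht; rewrite !in_itv /=; lra.
have hpr : - r <= p <= r by rewrite (ltW rp) (le_trans pt1 (ltW t1r)).
have main S' : 0 <= S' <= S -> (forall t, 0 <= t < S' -> `|y t| <= r) ->
    forall t, 0 <= t <= S' -> x t = s * X (y t) /\ p <= y t.
  move=> hS' hy; have /andP[S'0 S'S] := hS'.
  apply: (follow hX hpr S'0 (sub _ hS') x0 y0) => // t /andP[h1 h2].
  by apply: hx; rewrite h1 (le_trans h2).
have reach S' : 0 <= S' <= S -> (forall t, 0 <= t < S' -> `|y t| <= r) -> t1 <= y S' ->
    exists2 t, 0 <= t <= S & y t = t1 /\ x t = s * X t1.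
  move=> hS' hy hyS; have [_ cy' _ _] := sub _ hS'.
  have S'0 : 0 <= S' by case/andP: hS'.
  have [|t ht yt] := @ivt_between _ y 0 S' t1 S'0 cy'; first by rewrite y0; nra.
  exists t; first by case/andP: ht => -> h; rewrite (le_trans h)//; case/andP: hS'.
  split => //.
  by have [-> _] := main S' hS' hy t ht; rewrite yt.
have [[t ht yt]|no] := pselect (exists2 t, 0 <= t <= S & r <= `|y t|).
  have cn : {within `[0, t], continuous (fun t => `|y t|)}.
    have [_ cy' _ _] := sub t ht.
    by move=> u; apply: continuous_comp; [exact: cy'|exact: norm_continuous].
  have y0r : `|y 0| <= r by rewrite y0 ler_norml.
  have t0 : 0 <= t by case/andP: ht.
  have [S' [hS' yS' ltS']] := @first_hit R (fun t => `|y t|) 0 t r t0 cn y0r yt.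
  have hS'' : 0 <= S' <= S.
    by case/andP: hS' => -> h; rewrite (le_trans h)//; case/andP: ht.
  have hy u : 0 <= u < S' -> `|y u| <= r by move=> /ltS' /ltW.
  left; apply: (reach S' hS'' hy).
  have [|_ pyS] := main S' hS'' hy S'; first by case/andP: hS'' => -> _; rewrite lexx.
  (* [y] increases from [p > - r], so it can leave the box only at [r], beyond [t1]. *)
  move: yS'; have [yp|yn] := lerP 0 (y S'); first by rewrite ger0_norm// => ->; exact: ltW.
  by rewrite ltr0_norm// => E; have := lt_le_trans rp pyS; rewrite -E opprK ltxx.
have hy u : 0 <= u < S -> `|y u| <= r.
  by move=> hu; rewrite leNgt; apply/negP => h; apply: no; exists u; [lra|exact: ltW].
have [[t ht yt]|no'] := pselect (exists2 t, 0 <= t <= S & t1 <= y t).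
  by left; apply: (reach t ht) => // u hu; apply: hy; lra.
right => t ht; have [E h] := main S ltac:(lra) hy t ht; split => //.
by rewrite h /= ltNge; apply/negP => h'; apply: no'; exists t.
Qed.

End segments.

(** [heads_right] with an arbitrary mode and initial point, so that it can be carried from one phase
    to the next. *)
Definition exits_right (R : realType) (U : set (R * R)) (FL FR : R * R -> R * R)
    (eps xs : R) (m : mode) (p : R * R) : Prop :=
  exists (T : R) (x y : R -> R),
    [/\ 0 <= T, hysteretic_orbit U FL FR eps m p T x y,
        forall t, 0 <= t < T -> `|x t| < xs & x T = xs].

(** * The outcome of an orbit across one phase *)

Section phases.
Variables (R : realType) (k L M r s c G : R) (U : set (R * R)) (FL FR : R * R -> R * R).
Variables (m : mode) (f g : R * R -> R) (phi gam : R -> R -> R).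
Hypothesis F : fold k L M r phi.
Hypothesis C : chart s c L G r U f g phi gam.
Hypothesis Fm : mode_field FL FR m = (fun p => (f p, g p)).
Hypothesis thr : forall eps, threshold eps m = s * - eps.
Variables (e xs : R).
Hypothesis e0 : 0 < e.
Hypothesis exs : e < xs.
Hypothesis xsr : xs <= r.
Local Notation sol := (sol r phi).
Local Notation exits := (exits_right U FL FR e xs).

Lemma sgn_inj (a b : R) : s * a = s * b -> a = b.
Proof. by move=> h; have := congr1 ( *%R s) h; rewrite !mulrA (chart_ss C) !mul1r. Qed.

Lemma times_mono (n : nat) (S : nat -> R) :
  (forall j, (j <= n)%N -> S j <= S j.+1) ->
  forall i j, (i <= j)%N -> (j <= n.+1)%N -> S i <= S j.
Proof.
move=> h i j ij; rewrite -(subnK ij); elim: (j - i)%N => // d IH; rewrite addSn => hd.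
by apply: le_trans (IH (ltnW hd)) _; exact: h.
Qed.

Lemma norm_until (T S : R) (x : R -> R) : S <= T -> (forall t, 0 <= t < T -> `|x t| < xs) ->
  x T = xs -> forall t, 0 <= t <= S -> `|x t| <= r.
Proof.
move=> ST hx xT t /andP[t0 tS]; have [tT|tT] := ltP t T.
  by rewrite (le_trans (ltW (hx t _)))// t0.
have -> : t = T by apply/eqP; rewrite eq_le (le_trans tS ST).
by rewrite xT ger0_norm// (le_trans (ltW e0))// ltW.
Qed.

(** From right to left, a segment of the first phase is prepended to the given orbit. From left to
    right, uniqueness identifies the first phase of the orbit with [X], and that phase is cut
    off. *)
Lemma exits_transit x0 p q : - e < x0 <= e -> transit r phi e x0 p q -> - r < p ->
  q < r -> exits m (s * x0, p) <-> exits (other m) (s * - e, q).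
Proof.
move=> hx0 [X [hX Xp Xq [rp pq qr] fq]] rp' qr'; have e0' := e0.
have exs' := exs; have xsr' := xsr.
have fXq : phi q (X q) <= 0 by rewrite Xq.
have Xgt t : p <= t < q -> - e < X t.
  by move=> /andP[pt tq]; rewrite -Xq; apply: (sol_dec F hX fXq (le_trans rp pt) tq (lexx q) qr).
have Xle t : p <= t <= q -> - e <= X t <= x0.
  by move=> ht; rewrite -Xp; exact: (sol_itv F hX Xq rp qr fq ht).
have Xn t : p <= t <= q -> `|s * X t| < xs.
  by move=> /Xle h; rewrite (chart_norm C) ltr_norml; lra.
split; last first.
- move=> [T [x [y [T0 [n [S [[S0 ST] p0 hsol hsw hmiss]] hx xT]]]]].
  have Xr t : p <= t <= q -> `|X t| <= r.
    by move=> /Xn; rewrite (chart_norm C) => h; rewrite (le_trans (ltW h)).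
  have [T1 [Y [T10 Y0 YT Yitv hseg]]] := segment_ex F C hX rp (ltW pq) qr Xr.
  have Smono i j : (i <= j)%N -> (j <= n.+1)%N -> S i <= S j.
    by apply: times_mono => l /hsol [].
  have Spos j : (j <= n.+1)%N -> 0 <= S j by rewrite -S0; exact: Smono.
  (* The pieces agree at [T1], so the switching instant may be read from either side; [late] and
     [early] record this. *)
  pose x' t := if t <= T1 then s * X (Y t) else x (t - T1).
  pose y' t := if t <= T1 then Y t else y (t - T1).
  have [x00 y00] : x 0 = s * - e /\ y 0 = q by case: p0.
  have late t : 0 <= t -> x' (T1 + t) = x t /\ y' (T1 + t) = y t.
    move=> t0; rewrite /x' /y'; case: ifP => h; last by rewrite addrAC subrr add0r.
    have -> : t = 0 by apply: le_anti; rewrite t0 -(lerD2l T1) addr0 h.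
    by rewrite addr0 YT Xq x00 y00.
  have late' t : T1 <= t -> x' t = x (t - T1) /\ y' t = y (t - T1).
    by move=> h; have := late (t - T1); rewrite subr_ge0 subrKC; apply.
  have early t : t <= T1 -> x' t = s * X (Y t) /\ y' t = Y t by rewrite /x' /y' => ->.
  have TT : 0 <= T1 + T by rewrite addr_ge0.
  exists (T1 + T), x', y'; split => //; last 2 first.
  + move=> t ht; have [tT|tT] := ltP t T1.
      have [-> _] := early t (ltW tT); apply: Xn.
      have /andP[-> /ltW-> //] : p <= Y t < q by apply: Yitv; rewrite tT andbT; case/andP: ht.
    have [-> _] := late' t tT; apply: hx; rewrite subr_ge0 tT ltrBlDl; by case/andP: ht.
  + by have [-> _] := late T T0.
  (* The old switches are delayed by [T1]. The former initial time [S 0 = 0] becomes the new first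
     switch. *)
  exists n.+1, (fun j => if j is j'.+1 then T1 + S j' else 0); split.
  + by rewrite ST.
  + by have [-> ->] := early 0 T10; rewrite Y0 Xp.
  + move=> [_|j].
      rewrite S0 addr0; split => //; rewrite /= Fm.
      apply: solves_on_ext hseg => t /andP[_ tT].
      by have [-> ->] := early t tT.
    rewrite ltnS => jn; have [h1 h2] := hsol j jn; split; first by rewrite lerD2l.
    rewrite iterSr; have := solves_on_shift T1 h2; rewrite ![_ + T1]addrC.
    apply: solves_on_ext => t /andP[ht _].
    have : T1 <= t by apply: le_trans ht; rewrite lerDl; apply: Spos; exact: leqW.
    by move=> /late' [-> ->].
  + move=> [_|j]; first by rewrite S0 addr0 /= thr; have [-> _] := early T1 (lexx _); rewrite YT Xq.
    rewrite ltnS => jn; rewrite iterSr -hsw//.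
    by have [-> _] := late (S j.+1) (Spos j.+1 (leqW jn)).
  + move=> [_ t|j].
      rewrite S0 addr0 => /andP[t0 tT]; rewrite /= thr; have [-> _] := early t (ltW tT).
      by move=> /sgn_inj E; have := Xgt (Y t) (Yitv t _); rewrite E ltxx t0 tT => /(_ isT).
    rewrite ltnS => jn t ht; rewrite iterSr.
    have tT : T1 <= t.
      by case/andP: ht => h _; apply: le_trans h; rewrite lerDl; apply: Spos; exact: leqW.
    have [-> _] := late' t tT; apply: (hmiss j jn).
    by rewrite lerBrDl ltrBlDl.
move=> [T [x [y [T0 [n [S [[S0 ST] p0 hsol hsw hmiss]] hx xT]]]]].
have Smono i j : (i <= j)%N -> (j <= n.+1)%N -> S i <= S j.
  by apply: times_mono => l /hsol [].
have S1T : S 1%N <= T by rewrite -ST; exact: Smono.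
have [S01] := hsol 0%N isT; rewrite S0 /= Fm => h0; rewrite S0 in S01.
have [x00 y00] : x 0 = s * X p /\ y 0 = p by rewrite Xp; case: p0.
have xr := norm_until S1T hx xT.
case: (follow_or_reach F C hX rp' (ltW pq) qr' S01 h0 x00 y00 xr) => [[t ht [yt xt]]|h1].
- have tS : t = S 1%N.
    case/andP: ht => t0; rewrite le_eqVlt => /orP[/eqP//|tS].
    by case: (hmiss 0%N isT t); rewrite ?S0 ?t0//= thr xt Xq.
  have {}xt : x (S 1%N) = s * - e by rewrite -tS xt Xq.
  have {}yt : y (S 1%N) = q by rewrite -tS yt.
  (* With no switch the orbit would end here, where [|x| = e < xs]. *)
  case: n ST hsol hsw hmiss Smono => [|n] ST hsol hsw hmiss Smono.
    have := chart_norm C (- e); rewrite -xt ST xT normrN gtr0_norm ?(lt_trans e0)//.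
    by rewrite gtr0_norm// => E; move: exs; rewrite E ltxx.
  exists (T - S 1%N), (fun t => x (t - - S 1%N)), (fun t => y (t - - S 1%N)); split.
  + by rewrite subr_ge0.
  + exists n, (fun j => S j.+1 - S 1%N); split.
    * by rewrite subrr ST.
    * by rewrite opprK add0r xt yt.
    * move=> j jn; have [h1 h2] := hsol j.+1 jn; split; first by rewrite lerB.
      by rewrite -iterSr; exact: solves_on_shift.
    * by move=> j jn; rewrite opprK subrK -iterSr; exact: hsw.
    * move=> j jn t' ht'; rewrite -iterSr opprK; apply: (hmiss j.+1 jn).
      by rewrite -lerBlDr -ltrBrDr.
  + move=> t' /andP[h1 h2]; rewrite opprK; apply: hx.
    by rewrite addr_ge0//= -ltrBrDr.
  + by rewrite opprK subrK.
(* If [x = - e] is not reached in the first phase, the phase can end neither by a switch nor at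
   [xs]: the solution stays strictly between these levels. *)
exfalso; have [/andP[h2 h3] h4] := h1 (S 1%N) ltac:(by rewrite S01 lexx).
have := Xgt (y (S 1%N)); rewrite h2 h3 => /(_ isT) X1.
case: n ST hsol hsw hmiss Smono => [|n] ST hsol hsw hmiss Smono.
  have := Xn (y (S 1%N)); rewrite h2 (ltW h3) -h4 ST xT => /(_ isT).
  by rewrite ltNge ler_norm.
by have := hsw 0%N isT; rewrite /= thr h4 => /sgn_inj E; move: X1; rewrite E ltxx.
Qed.

(** The solution turns back without switching and leaves on the side of its own mode, which is the
    right for [s = 1] and the left for [s = -1]. *)
Definition leaves X x0 p t1 := [/\ sol X, X p = x0, [/\ - r < p, p <= t1 & t1 < r],
  X t1 = xs & forall t, p <= t <= t1 -> - e < X t /\ (t < t1 -> X t < xs)].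

Lemma leaves_right X x0 p t1 : s = 1 -> leaves X x0 p t1 -> exits m (s * x0, p).
Proof.
move=> s1 [hX Xp [rp pt tr_] Xt hXt]; have e0' := e0; have exs' := exs; have xsr' := xsr.
have Xb t : p <= t <= t1 -> - e < X t <= xs.
  move=> ht; have [-> h] := hXt t ht; have [tt|tt] := ltP t t1; first by rewrite ltW// h.
  have -> : t = t1 by apply: le_anti; case/andP: ht => _ ->.
  by rewrite Xt lexx.
have Xr t : p <= t <= t1 -> `|X t| <= r by move=> /Xb h; rewrite ler_norml; lra.
have [T [Y [T0 Y0 YT Yitv hseg]]] := segment_ex F C hX (ltW rp) pt (ltW tr_) Xr.
exists T, (fun t => s * X (Y t)), Y; split => //; last 2 first.
- move=> t ht; have hY := Yitv t ht.
  have hY' : p <= Y t <= t1 by case/andP: hY => -> /ltW.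
  have [h1 h2] := hXt _ hY'; rewrite (chart_norm C) ltr_norml h2 ?andbT; last by case/andP: hY.
  by apply: lt_trans h1; rewrite ltrN2.
- by rewrite YT Xt s1 mul1r.
exists 0%N, (fun j => if j is 0%N then 0 else T); split; [by []|by rewrite Y0 Xp| |by []|].
- by move=> j; rewrite leqn0 => /eqP ->; split; [exact: T0|rewrite /= Fm; exact: hseg].
- move=> j; rewrite leqn0 => /eqP -> t ht /=; rewrite thr => /sgn_inj E.
  have hY' : p <= Y t <= t1 by have /andP[-> /ltW] := Yitv t ht.
  by have [] := hXt _ hY'; rewrite E ltxx.
Qed.

Lemma leaves_left X x0 p t1 : s = -1 -> leaves X x0 p t1 -> ~ exits m (s * x0, p).
Proof.
move=> s1 [hX Xp [rp pt tr_] Xt hXt]; have e0' := e0; have exs' := exs; have xsr' := xsr.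
move=> [T [x [y [T0 [n [S [[S0 ST] p0 hsol hsw hmiss]] hx xT]]]]].
have Smono i j : (i <= j)%N -> (j <= n.+1)%N -> S i <= S j.
  by apply: times_mono => l /hsol [].
have S1T : S 1%N <= T by rewrite -ST; exact: Smono.
have [S01] := hsol 0%N isT; rewrite S0 /= Fm => h0; rewrite S0 in S01.
have [x00 y00] : x 0 = s * X p /\ y 0 = p by rewrite Xp; case: p0.
have xr := norm_until S1T hx xT.
case: (follow_or_reach F C hX rp pt tr_ S01 h0 x00 y00 xr) => [[t ht [yt xt]]|h1].
  rewrite Xt s1 mulN1r in xt.
  (* The orbit sits at [x = - xs]. Before [T] this violates [|x| < xs]; at [T] it contradicts
     [x T = xs]. *)
  have [tT|tT] := ltP t T.
    have /andP[t0 _] := ht.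
    by have := hx t; rewrite xt normrN t0 tT => /(_ isT); rewrite ltNge ler_norm.
  have E : t = T by apply: le_anti; case/andP: ht => _ /le_trans ->.
  by have := lt_trans e0 exs; move: xt; rewrite E xT => /eqP; rewrite -addr_eq0; lra.
have [h2 h4] := h1 (S 1%N) ltac:(by rewrite S01 lexx).
have [h5 h6] : _ /\ _ := hXt (y (S 1%N)) ltac:(by case/andP: h2 => -> /ltW).
case: n ST hsol hsw hmiss Smono => [|n] ST hsol hsw hmiss Smono.
  by move: h4; rewrite ST xT s1 -ST; lra.
by have := hsw 0%N isT; rewrite /= thr h4 => /sgn_inj E; move: h5; rewrite E ltxx.
Qed.

End phases.

(** * Folds from smooth fields *)

Lemma partial_dy (R : realType) (h : R * R -> R) (x t : R) :
  derivable h (x, t) ((0, 1) : R * R) ->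
  is_derive t 1 (fun u => h (x, u)) (dy h (x, t)).
Proof.
move=> hd.
have E : (fun u : R => u^-1 *: (((fun v => h (x, v)) \o shift t) (u *: (1 : R)) - h (x, t))) =
    (fun u : R => u^-1 *: ((h \o shift (x, t)) (u *: ((0, 1) : R * R)) - h (x, t))).
  apply/funext => u /=; congr (_ *: (h _ - _)).
  by congr (_, _); rewrite /= /GRing.scale /= mulr0 add0r.
by split; [rewrite /derivable E; exact: hd|rewrite /derive E].
Qed.

Lemma partial_dx (R : realType) (h : R * R -> R) (x t : R) :
  derivable h (x, t) ((1, 0) : R * R) ->
  is_derive x 1 (fun u => h (u, t)) (dx h (x, t)).
Proof.
move=> hd.
have E : (fun u : R => u^-1 *: (((fun v => h (v, t)) \o shift x) (u *: (1 : R)) - h (x, t))) =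
    (fun u : R => u^-1 *: ((h \o shift (x, t)) (u *: ((1, 0) : R * R)) - h (x, t))).
  apply/funext => u /=; congr (_ *: (h _ - _)).
  by congr (_, _); rewrite /= /GRing.scale /= mulr0 add0r.
by split; [rewrite /derivable E; exact: hd|rewrite /derive E].
Qed.

Lemma is_derive_div (R : realType) (a b : R -> R) (t da db : R) : b t != 0 ->
  is_derive t 1 a da -> is_derive t 1 b db ->
  is_derive t 1 (fun u => a u / b u) ((da * b t - a t * db) / b t ^+ 2).
Proof.
move=> b0 ha hb; have hV : is_derive t 1 (fun u => (b u)^-1) (- (b t) ^- 2 *: db).
  exact: is_deriveV.
by apply: is_derive_eq; rewrite /GRing.scale /=; field.
Qed.

Lemma is_derive_wronskian (R : realType) (a a' b b' : R -> R) (t da' db' : R) :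
  is_derive t 1 a (a' t) -> is_derive t 1 b (b' t) ->
  is_derive t 1 a' da' -> is_derive t 1 b' db' ->
  is_derive t 1 (fun u => a' u * b u - a u * b' u) (da' * b t - a t * db').
Proof.
by move=> *; apply: is_derive_eq; rewrite /GRing.scale /=; ring.
Qed.

Lemma is_derive_div_sqr (R : realType) (a b : R -> R) (t da db : R) : b t != 0 ->
  is_derive t 1 a da -> is_derive t 1 b db ->
  is_derive t 1 (fun u => a u / b u ^+ 2) ((da * b t - a t * (2 * db)) / b t ^+ 3).
Proof.
move=> b0 ha hb; have h : is_derive t 1 (fun u => b u ^+ 2) (2 * b t * db).
  by apply: is_derive_eq; rewrite /GRing.scale /=; ring.
have b2 : b t ^+ 2 != 0 by rewrite expf_neq0.
rewrite (_ : (da * b t - a t * (2 * db)) / b t ^+ 3 =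
  (da * b t ^+ 2 - a t * (2 * b t * db)) / (b t ^+ 2) ^+ 2).
  exact: (@is_derive_div R a (fun u => b u ^+ 2) t _ _ b2 ha h).
by field.
Qed.

Lemma continuous_bounded_near (R : realType) (h : R * R -> R) (p : R * R) :
  {for p, continuous h} -> \forall q \near p, `|h q| <= `|h p| + 1.
Proof.
move=> /cvgrPdist_lt/(_ 1 ltr01); apply: filterS => q hq.
have := ler_distD (h p) (h q) 0; rewrite !subr0 distrC; lra.
Qed.

Lemma near_box (R : realType) (P : set (R * R)) : nbhs ((0, 0) : R * R) P ->
  exists2 rho : R, 0 < rho & forall x t, - rho <= x <= rho -> - rho <= t <= rho -> P (x, t).
Proof.
move=> /nbhs_ballP[d /= d0 h]; exists (d / 2); first by rewrite divr_gt0.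
move=> x t hx ht; apply: h; split; rewrite /ball /= sub0r normrN ltr_norml; lra.
Qed.

Lemma upper_bound6 (R : realType) (a b c d e f : R) :
  0 <= a -> 0 <= b -> 0 <= c -> 0 <= d -> 0 <= e -> 0 <= f ->
  exists K, [/\ 0 < K, [/\ a + 1 <= K, b + 1 <= K & c + 1 <= K] &
    [/\ d + 1 <= K, e + 1 <= K & f + 1 <= K]].
Proof.
move=> *; exists (1 + a + b + c + d + e + f).
by split; [lra|split; lra|split; lra].
Qed.

Section quotient.
Variables (R : realType) (U : set (R * R)) (f g : R * R -> R).
Hypothesis oU : open U.
Hypothesis U0 : U (0, 0).
Hypothesis f2 : Ck_on 2 U f.
Hypothesis g2 : Ck_on 2 U g.
Hypothesis g0 : 0 < g (0, 0).

Let Px p := (dx f p * g p - f p * dx g p) / g p ^+ 2.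
Let Pt p := (dy f p * g p - f p * dy g p) / g p ^+ 2.
Let Ptt p := ((dy (dy f) p * g p - f p * dy (dy g) p) * g p
  - (dy f p * g p - f p * dy g p) * (2 * dy g p)) / g p ^+ 3.

(** [Px], [Pt] and [Ptt] are derivatives of [f / g] written out by the quotient rule, so continuity
    at the origin bounds them on a box. The last clause keeps [Pt] away from zero when it is nonzero
    at the origin. *)
Lemma quotient_box : exists K rho : R, [/\ 0 < K, 0 < rho &
  forall x t, - rho <= x <= rho -> - rho <= t <= rho ->
  [/\ U (x, t), g (0, 0) / 2 <= g (x, t) &
    [/\ `|g (x, t)| <= K, `|dx g (x, t)| <= K & `|dy g (x, t)| <= K] /\
    [/\ `|Px (x, t)| <= K, `|Pt (x, t)| <= K, `|Ptt (x, t)| <= K &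
      `|Pt (x, t) - Pt (0, 0)| <= `|Pt (0, 0)| / 2 \/ Pt (0, 0) = 0]]].
Proof.
case: f2 => cf [_ [cfx _] [cfy [_ _ [cfyy _]]]].
case: g2 => cg [_ [cgx _] [cgy [_ _ [cgyy _]]]].
have gn : g (0, 0) != 0 by rewrite gt_eqF.
move: (cf _ U0) (cfx _ U0) (cfy _ U0) (cfyy _ U0) (cg _ U0) (cgx _ U0) (cgy _ U0) (cgyy _ U0).
move=> {}cf {}cfx {}cfy {}cfyy {}cg {}cgx {}cgy {}cgyy.
have cm (a b : R * R -> R) : {for (0, 0) : R * R, continuous a} ->
    {for (0, 0) : R * R, continuous b} ->
    {for (0, 0) : R * R, continuous (fun p : R * R => a p * b p)}.
  by move=> ca cb; exact: cvgM ca cb.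
have cs (a b : R * R -> R) : {for (0, 0) : R * R, continuous a} ->
    {for (0, 0) : R * R, continuous b} ->
    {for (0, 0) : R * R, continuous (fun p : R * R => a p - b p)}.
  by move=> ca cb; exact: cvgB ca cb.
have cgV n : {for (0, 0) : R * R, continuous (fun p : R * R => (g p ^+ n)^-1)}.
  apply: cvgV; first by rewrite expf_neq0.
  exact: (cvg_comp g (fun x : R => x ^+ n) cg (@exprn_continuous R n (g (0, 0)))).
have cPx : {for (0, 0) : R * R, continuous Px}.
  exact: (cm _ _ (cs _ _ (cm _ _ cfx cg) (cm _ _ cf cgx)) (cgV 2%N)).
have cPt : {for (0, 0) : R * R, continuous Pt}.
  exact: (cm _ _ (cs _ _ (cm _ _ cfy cg) (cm _ _ cf cgy)) (cgV 2%N)).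
have cPtt : {for (0, 0) : R * R, continuous Ptt}.
  have c2 : {for (0, 0) : R * R, continuous (fun p : R * R => 2 * dy g p)}.
    by apply: (cm (fun=> 2) _ _ cgy); exact: cvg_cst.
  exact: (cm _ _ (cs _ _ (cm _ _ (cs _ _ (cm _ _ cfyy cg) (cm _ _ cf cgyy)) cg)
    (cm _ _ (cs _ _ (cm _ _ cfy cg) (cm _ _ cf cgy)) c2)) (cgV 3%N)).
have nU : \forall p \near ((0, 0) : R * R), U p by exact: open_nbhs_nbhs.
have ng : \forall p \near ((0, 0) : R * R), g (0, 0) / 2 <= g p.
  have := cg => /cvgrPdist_lt/(_ (g (0, 0) / 2)); rewrite divr_gt0// => /(_ isT).
  by apply: filterS => p; rewrite ltr_norml; lra.
have nP : \forall p \near ((0, 0) : R * R),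
    `|Pt p - Pt (0, 0)| <= `|Pt (0, 0)| / 2 \/ Pt (0, 0) = 0.
  have [->|Pn] := eqVneq (Pt (0, 0)) 0; first by near=> p; right.
  have := cPt => /cvgrPdist_lt/(_ (`|Pt (0, 0)| / 2)); rewrite divr_gt0 ?normr_gt0// => /(_ isT).
  by apply: filterS => p h; left; rewrite distrC ltW.
have [K [K0 [Kg Kgx Kgy] [KPx KPt KPtt]]] : exists K, [/\ 0 < K,
    [/\ `|g (0, 0)| + 1 <= K, `|dx g (0, 0)| + 1 <= K & `|dy g (0, 0)| + 1 <= K] &
    [/\ `|Px (0, 0)| + 1 <= K, `|Pt (0, 0)| + 1 <= K & `|Ptt (0, 0)| + 1 <= K]].
  by apply: upper_bound6; exact: normr_ge0.
have b1 := continuous_bounded_near cg; have b2 := continuous_bounded_near cgx.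
have b3 := continuous_bounded_near cgy; have b4 := continuous_bounded_near cPx.
have b5 := continuous_bounded_near cPt; have b6 := continuous_bounded_near cPtt.
have nall : nbhs ((0, 0) : R * R) (fun p =>
    ((U p /\ g (0, 0) / 2 <= g p) /\
     ((`|Pt p - Pt (0, 0)| <= `|Pt (0, 0)| / 2 \/ Pt (0, 0) = 0) /\
     ((`|g p| <= `|g (0, 0)| + 1 /\ (`|dx g p| <= `|dx g (0, 0)| + 1 /\
       `|dy g p| <= `|dy g (0, 0)| + 1)) /\
     (`|Px p| <= `|Px (0, 0)| + 1 /\ (`|Pt p| <= `|Pt (0, 0)| + 1 /\
       `|Ptt p| <= `|Ptt (0, 0)| + 1)))))).
  exact: filterI (filterI nU ng) (filterI nP (filterI (filterI b1 (filterI b2 b3))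
    (filterI b4 (filterI b5 b6)))).
have [rho rho0 h] := near_box nall.
exists K, rho; split => // x t hx ht.
have [[h1 h2] [h3 [[h4 [h5 h6]] [h7 [h8 h9]]]]] := h x t hx ht.
split => //; split; split => //.
- exact: le_trans h4 Kg.
- exact: le_trans h5 Kgx.
- exact: le_trans h6 Kgy.
- exact: le_trans h7 KPx.
- exact: le_trans h8 KPt.
- exact: le_trans h9 KPtt.
Unshelve. all: by end_near. Qed.

Lemma quotient_derive x t : U (x, t) -> g (x, t) != 0 ->
  [/\ is_derive x 1 (fun u => f (u, t) / g (u, t)) (Px (x, t)),
    is_derive t 1 (fun u => f (x, u) / g (x, u)) (Pt (x, t)),
    is_derive t 1 (fun u => Pt (x, u)) (Ptt (x, t)),
    is_derive x 1 (fun u => g (u, t)) (dx g (x, t)) &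
    is_derive t 1 (fun u => g (x, u)) (dy g (x, t))].
Proof.
move=> Up gn.
case: f2 => _ [df _ [_ [dfy _ _]]]; case: g2 => _ [dg _ [_ [dgy _ _]]].
have [fx fy] := df _ Up; have [gx gy] := dg _ Up.
have [_ fyy] := dfy _ Up; have [_ gyy] := dgy _ Up.
have := partial_dx fx; have := partial_dx gx => {}gx {}fx.
have := partial_dy fy; have := partial_dy gy => {}gy {}fy.
have := partial_dy fyy; have := partial_dy gyy => {}gyy {}fyy.
split; [exact: is_derive_div|exact: is_derive_div| |exact: gx|exact: gy].
exact: is_derive_div_sqr gn (is_derive_wronskian fy gy fyy gyy) gy.
Qed.

End quotient.

Definition clamped_slope (R : realType) (s r : R) (f g : R * R -> R) (t x : R) : R :=
  s * (f (s * clamp (- r) r x, clamp (- r) r t) / g (s * clamp (- r) r x, clamp (- r) r t)).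

Definition clamped_rate (R : realType) (s r : R) (g : R * R -> R) (t x : R) : R :=
  g (s * clamp (- r) r x, clamp (- r) r t).

Lemma box_lip (R : realType) (h hx ht : R * R -> R) (K rho : R) : 0 < K ->
  (forall x t, - rho <= x <= rho -> - rho <= t <= rho ->
    [/\ is_derive x 1 (fun u => h (u, t)) (hx (x, t)),
        is_derive t 1 (fun u => h (x, u)) (ht (x, t)),
        `|hx (x, t)| <= K & `|ht (x, t)| <= K]) ->
  forall x t x' t', - rho <= x <= rho -> - rho <= t <= rho ->
    - rho <= x' <= rho -> - rho <= t' <= rho ->
    `|h (x, t) - h (x', t')| <= K * (`|t - t'| + `|x - x'|).
Proof.
move=> K0 hh x t x' t' bx bt bx' bt'.
have h1 : `|h (x, t) - h (x', t)| <= K * `|x - x'|.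
  apply: (@derive_lip R (fun u => h (u, t)) (fun u => hx (u, t)) (- rho) rho) => // u bu.
    by have [] := hh u t bu bt.
  by have [] := hh u t bu bt.
have h2 : `|h (x', t) - h (x', t')| <= K * `|t - t'|.
  apply: (@derive_lip R (fun u => h (x', u)) (fun u => ht (x', u)) (- rho) rho) => // u bu.
    by have [] := hh x' u bx' bu.
  by have [] := hh x' u bx' bu.
apply: (le_trans (ler_distD (h (x', t)) _ _)).
by rewrite mulrDr [leRHS]addrC; exact: lerD.
Qed.

Lemma clamp_sign_itv (R : realType) (s r rho x : R) : s = 1 \/ s = -1 -> 0 < r -> r <= rho ->
  - rho <= s * clamp (- r) r x <= rho.
Proof.
move=> hs r0 rrho; have rr : - r <= r by lra.
by have := clamp_itv x rr; case: hs => ->; rewrite ?mul1r ?mulN1r; lra.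
Qed.

Lemma fold_of_derivative (R : realType) (s k K L M rho r : R) (P Pt : R -> R -> R) :
  s = 1 \/ s = -1 -> 0 < k -> 0 < K -> K <= L -> K <= M -> 0 < r -> r <= rho ->
  8 * L ^+ 2 * r <= k -> L * r <= 8^-1 ->
  (forall x t x' t', - rho <= x <= rho -> - rho <= t <= rho ->
    - rho <= x' <= rho -> - rho <= t' <= rho ->
    `|P x t - P x' t'| <= K * (`|t - t'| + `|x - x'|)) ->
  (forall x t, - rho <= x <= rho -> - rho <= t <= rho -> is_derive t 1 (P x) (Pt x t)) ->
  (forall x t t', - rho <= x <= rho -> - rho <= t <= rho -> - rho <= t' <= rho ->
    `|Pt x t - Pt x t'| <= K * `|t - t'|) ->
  (forall x t, - rho <= x <= rho -> - rho <= t <= rho -> k / 2 <= s * Pt x t) ->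
  P 0 0 = 0 -> s * Pt 0 0 = k ->
  fold k L M r (fun t x => s * P (s * clamp (- r) r x) (clamp (- r) r t)).
Proof.
move=> hs k0 K0 KL KM r0 rrho h1 h2 lipP derP lipPt Pt_ge P00 sPt0.
have ns (x : R) : `|s * x| = `|x|.
  by rewrite normrM; case: hs => ->; rewrite ?normrN normr1 mul1r.
have rr : - r <= r by lra.
have inb (x : R) : - rho <= s * clamp (- r) r x <= rho.
  exact: clamp_sign_itv.
have inb' (t : R) : - rho <= clamp (- r) r t <= rho.
  by have := clamp_sign_itv t (or_introl erefl) r0 rrho; rewrite mul1r.
have sub (t : R) : - r <= t <= r -> - rho <= t <= rho.
  by move=> /andP[h3 h4]; rewrite (le_trans _ h3) ?lerN2// (le_trans h4).
have b00' : - r <= 0 <= r by rewrite oppr_le0 (ltW r0).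
have b00 := sub 0 b00'.
have M0 := le_trans (ltW K0) KM.
have KL2 : K <= 2 * L by rewrite mulr_natl mulr2n ler_wpDl// (le_trans (ltW K0)).
split => //.
- move=> t t' x x'; rewrite -mulrBr ns; apply: (le_trans (lipP _ _ _ _ _ _ _ _)) => //.
  apply: ler_pM => //; rewrite ?addr_ge0// ?(ltW K0)//.
  by apply: lerD; rewrite -?mulrBr ?ns; exact: clamp_lip.
- move=> t x; rewrite ns.
  have := lipP _ _ 0 0 (inb x) (inb' t) b00 b00; rewrite P00 !subr0 ns => h.
  apply: (le_trans h); apply: (@le_trans _ _ (K * (r + r))).
    rewrite ler_wpM2l ?(ltW K0)//.
    by apply: lerD; rewrite ler_norml clamp_itv.
  have -> : 2 * L * r = L * (r + r) by ring.
  by rewrite ler_wpM2r// addr_ge0// ltW.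
- move=> x t1 t2 rt1 t12 t2r.
  have i1 : - r <= t1 <= r by rewrite rt1 (le_trans t12).
  have i2 : - r <= t2 <= r by rewrite t2r (le_trans rt1).
  rewrite (clamp_id i1) (clamp_id i2).
  move: (inb x); move: (s * clamp (- r) r x) => X bX.
  have itv t : t1 <= t <= t2 -> - rho <= t <= rho.
    by move=> /andP[h3 h4]; apply: sub; rewrite (le_trans rt1 h3) (le_trans h4 t2r).
  have D t : t1 <= t <= t2 -> is_derive t 1 (fun u => s * P X u) (s * Pt X t).
    move=> ht; have h := derP X t bX (itv t ht).
    by apply: is_derive_eq; rewrite /GRing.scale.
  apply: (@MVT_ger R (fun u => s * P X u) (fun u => s * Pt X u) _ _ _ t12).
  + exact: derive_within_continuous D.
  + by move=> t /andP[h3 h4]; apply: D; rewrite !ltW.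
  + by move=> t /andP[h3 h4]; apply: (Pt_ge _ _ bX); apply: itv; rewrite !ltW.
- move=> t ht; rewrite (clamp_id ht) (clamp_id b00') mulr0.
  have [nt nt'] : - rho <= - `|t| /\ `|t| <= rho.
    by rewrite lerNl opprK; split; rewrite ler_norml; exact: sub.
  have itv u : - `|t| <= u <= `|t| -> - rho <= u <= rho.
    by move=> /andP[h3 h4]; rewrite (le_trans nt h3) (le_trans h4).
  have D u : - `|t| <= u <= `|t| -> is_derive u 1 (fun u => s * P 0 u - k * u) (s * Pt 0 u - k).
    move=> hu; have h := derP 0 u b00 (itv u hu).
    by apply: is_derive_eq; rewrite /GRing.scale /= mulr1.
  have B u : - `|t| <= u <= `|t| -> `|s * Pt 0 u - k| <= K * `|t|.
    move=> hu; rewrite -sPt0 -mulrBr ns.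
    apply: (le_trans (lipPt 0 u 0 b00 (itv u hu) b00)).
    by rewrite subr0 ler_wpM2l ?(ltW K0)// ler_norml.
  have bt : - `|t| <= t <= `|t| by rewrite -ler_norml.
  have b0t : - `|t| <= 0 <= `|t| by rewrite oppr_le0 normr_ge0.
  have := derive_lip D B bt b0t; rewrite P00 !mulr0 !subr0 => h.
  apply: (le_trans h); rewrite -mulrA -expr2 real_normK ?num_real//.
  by rewrite ler_wpM2r ?sqr_ge0.
move=> x t1 t2 t3 rt1 t12 t23 t3r.
have rt2 := le_trans rt1 (ltW t12); have t2r := le_trans (ltW t23) t3r.
have i1 : - r <= t1 <= r by rewrite rt1 (le_trans (ltW t12)).
have i2 : - r <= t2 <= r by rewrite rt2.
have i3 : - r <= t3 <= r by rewrite t3r (le_trans rt2 (ltW t23)).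
rewrite (clamp_id i1) (clamp_id i2) (clamp_id i3).
move: (inb x); move: (s * clamp (- r) r x) => X bX.
(* Divided differences are values of [Pt] at intermediate points, which are at most [t3 - t1] apart;
   so [fold_dd] follows from a Lipschitz bound on [Pt]. *)
have mvt a b : - r <= a -> a < b -> b <= r ->
    exists2 c, a < c < b & P X b - P X a = Pt X c * (b - a).
  move=> ra ab br; have D u : a <= u <= b -> is_derive u 1 (P X) (Pt X u).
    move=> /andP[h3 h4]; apply: (derP _ _ bX); apply: sub.
    by rewrite (le_trans ra h3) (le_trans h4).
  have D' u : u \in `]a, b[ -> is_derive u 1 (P X) (Pt X u).
    by rewrite in_itv /= => /andP[h3 h4]; apply: D; rewrite !ltW.
  have [c hc E] := MVT ab D' (derive_within_continuous D).
  by exists c => //; move: hc; rewrite in_itv.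
have [c1 hc1 E1] := mvt t1 t2 rt1 t12 t2r.
have [c2 hc2 E2] := mvt t2 t3 rt2 t23 t3r.
rewrite -!mulrBr E1 E2 -!mulrA -mulrBr ns.
rewrite !mulfV ?subr_eq0 ?gt_eqF// !mulr1.
have [/andP[h3 h4] /andP[h5 h6]] := (hc1, hc2).
have b1 : - rho <= c1 <= rho.
  by apply: sub; rewrite (le_trans rt1 (ltW h3)) (le_trans (ltW h4)).
have b2 : - rho <= c2 <= rho.
  by apply: sub; rewrite (le_trans rt2 (ltW h5)) (le_trans (ltW h6)).
have c12 : `|c1 - c2| <= t3 - t1.
  rewrite distrC ger0_norm ?subr_ge0 ?(ltW (lt_trans h4 h5))//.
  by apply: lerB; exact: ltW.
apply: (le_trans (lipPt X c1 c2 bX b1 b2)).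
by apply: ler_pM => //; exact: ltW.
Qed.

Section fold_of_smooth.
Variables (R : realType) (U : set (R * R)) (f g : R * R -> R) (s k : R).
Hypothesis oU : open U.
Hypothesis U0 : U (0, 0).
Hypothesis f2 : Ck_on 2 U f.
Hypothesis g2 : Ck_on 2 U g.
Hypothesis hs : s = 1 \/ s = -1.
Hypothesis f00 : f (0, 0) = 0.
Hypothesis g00 : 0 < g (0, 0).
Hypothesis k0 : 0 < k.
Hypothesis hk : s * dy f (0, 0) = k * g (0, 0).

Lemma fold_chart_ex : exists L0 M0 c G : R, 0 < L0 /\ forall L M, L0 <= L -> M0 <= M ->
  exists2 r1 : R, 0 < r1 & forall r, 0 < r <= r1 ->
    fold k L M r (clamped_slope s r f g) /\
    chart s c L G r U f g (clamped_slope s r f g) (clamped_rate s r g).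
Proof.
have g0 := g00; have k0_ := k0.
have [K [rho [K0 rho0 box]]] := quotient_box oU U0 f2 g2 g00.
pose P (p : R * R) := f p / g p.
pose Px p := (dx f p * g p - f p * dx g p) / g p ^+ 2.
pose Pt p := (dy f p * g p - f p * dy g p) / g p ^+ 2.
have ss : s * s = 1 by case: hs => ->; rewrite ?mulr1// mulrNN mulr1.
have ns (x : R) : `|s * x| = `|x|.
  by rewrite normrM; case: hs => ->; rewrite ?normrN normr1 mul1r.
have sPt0 : s * Pt (0, 0) = k.
  rewrite /Pt f00 mul0r subr0 mulrA [s * (_ * _)]mulrA hk; field.
  by rewrite gt_eqF.
have nPt0 : `|Pt (0, 0)| = k by rewrite -ns sPt0 gtr0_norm.
have gpos x t : - rho <= x <= rho -> - rho <= t <= rho -> g (x, t) != 0.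
  by move=> bx bt; have [_ h _] := box x t bx bt; rewrite gt_eqF//; lra.
have der x t : - rho <= x <= rho -> - rho <= t <= rho -> _ :=
  fun bx bt => let: And3 u _ _ := box x t bx bt in quotient_derive f2 g2 u (gpos x t bx bt).
have lipP : forall x t x' t', - rho <= x <= rho -> - rho <= t <= rho ->
    - rho <= x' <= rho -> - rho <= t' <= rho ->
    `|P (x, t) - P (x', t')| <= K * (`|t - t'| + `|x - x'|).
  apply: (@box_lip R P Px Pt K rho K0) => x t bx bt.
  have [h1 h2 _ _ _] := der x t bx bt; have [_ _ [_ [h3 h4 _ _]]] := box x t bx bt.
  by split; [exact: h1|exact: h2|exact: h3|exact: h4].
have lipg : forall x t x' t', - rho <= x <= rho -> - rho <= t <= rho ->
    - rho <= x' <= rho -> - rho <= t' <= rho ->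
    `|g (x, t) - g (x', t')| <= K * (`|t - t'| + `|x - x'|).
  apply: (@box_lip R g (dx g) (dy g) K rho K0) => x t bx bt.
  have [_ _ _ h1 h2] := der x t bx bt; have [_ _ [[_ h3 h4] _]] := box x t bx bt.
  by split; [exact: h1|exact: h2|exact: h3|exact: h4].
have lipPt x t t' : - rho <= x <= rho -> - rho <= t <= rho -> - rho <= t' <= rho ->
    `|Pt (x, t) - Pt (x, t')| <= K * `|t - t'|.
  move=> bx; move: t t'.
  apply: (@derive_lip R (fun u => Pt (x, u)) (fun t =>
    ((dy (dy f) (x, t) * g (x, t) - f (x, t) * dy (dy g) (x, t)) * g (x, t)
     - (dy f (x, t) * g (x, t) - f (x, t) * dy g (x, t)) * (2 * dy g (x, t)))
    / g (x, t) ^+ 3)) => t bt.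
    by have [_ _ h _ _] := der x t bx bt.
  by have [_ _ [_ [_ _ h _]]] := box x t bx bt.
have Pt_ge x t : - rho <= x <= rho -> - rho <= t <= rho -> k / 2 <= s * Pt (x, t).
  move=> bx bt; have [_ _ [_ [_ _ _ [|h]]]] := box x t bx bt; last first.
    by move: k0; rewrite -sPt0 /Pt h mulr0 ltxx.
  rewrite -/(Pt (x, t)) -/(Pt (0, 0)) nPt0 -ns mulrBr sPt0 ler_distl => /andP[+ _].
  by rewrite (_ : k - k / 2 = k / 2)//; field.
have derP x t : - rho <= x <= rho -> - rho <= t <= rho ->
    is_derive t 1 (fun u => P (x, u)) (Pt (x, t)).
  by move=> bx bt; have [_ h _ _ _] := der x t bx bt.
have P00 : P (0, 0) = 0 by rewrite /P f00 mul0r.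
exists K, K, (g (0, 0) / 2), K; split => // L M KL KM.
have L0 := lt_le_trans K0 KL.
(* In order, these bounds keep the box inside the region of control and give [fold_small1],
   [fold_small2] and [chart_small]. *)
pose r1 := Num.min (Num.min rho (k / (8 * L ^+ 2))) (Num.min (8^-1 / L) (g (0, 0) / 2 / (16 * L))).
exists r1.
  rewrite !lt_min rho0 !divr_gt0 ?mulr_gt0 ?exprn_gt0//.
move=> r /andP[r0]; rewrite /r1 !le_min => /andP[/andP[rrho h1] /andP[h2 h3]].
split.
  apply: (@fold_of_derivative R s k K L M rho r (fun x t => P (x, t)) (fun x t => Pt (x, t))) => //.
  - by move: h1; rewrite ler_pdivlMr ?mulr_gt0 ?exprn_gt0// mulrC.
  - by move: h2; rewrite ler_pdivlMr// mulrC.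
have rr := ltW (gtrN r0).
have inb (x : R) : - rho <= s * clamp (- r) r x <= rho.
  exact: clamp_sign_itv.
have inb' (t : R) : - rho <= clamp (- r) r t <= rho.
  by have := clamp_sign_itv t (or_introl erefl) r0 rrho; rewrite mul1r.
have inx (x t : R) : - r <= t <= r -> - r <= x <= r -> - rho <= s * x <= rho /\ - rho <= t <= rho.
  by move=> ht hx; have := inb x; have := inb' t; rewrite !clamp_id.
split => //; first by rewrite divr_gt0.
- by move=> t x ht hx; have [b1 b2] := inx x t ht hx; have [] := box _ _ b1 b2.
- move=> t x ht hx; rewrite /clamped_slope /clamped_rate !clamp_id//.
  have [b1 b2] := inx x t ht hx.
  by rewrite -mulrA divfK// gpos.
- by move=> t x ht hx; rewrite /clamped_rate !clamp_id.
- by move=> t x; have [_ h _] := box _ _ (inb x) (inb' t).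
- by move=> t x; have [_ _ [[h _ _] _]] := box _ _ (inb x) (inb' t).
- move=> t t' x x'; rewrite /clamped_rate.
  apply: (le_trans (lipg _ _ _ _ (inb _) (inb' _) (inb _) (inb' _))).
  apply: ler_pM => //; rewrite ?addr_ge0// ?(ltW K0)//.
  by apply: lerD; rewrite -?mulrBr ?ns; exact: clamp_lip.
- by move: h3; rewrite ler_pdivlMr ?mulr_gt0// mulrC.
Qed.

End fold_of_smooth.

(** * Measure of the right-going points *)

Section comb_measure.
Variable R : realType.
Local Notation mu := (@lebesgue_measure R).

(** The outcome at the separating points is left undecided; whatever it is, they contribute a
    measurable null set. *)
Lemma measurable_setI1 (S : set R) (x : R) : measurable (S `&` [set x]).
Proof.
have [Sx|nSx] := pselect (S x).
  rewrite (_ : S `&` [set x] = [set x]); first exact: measurable_set1.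
  by apply/seteqP; split => [y []|y -> /=].
rewrite (_ : S `&` [set x] = set0); first exact: measurable0.
by apply/seteqP; split => // y [Sy /= yE]; apply: nSx; rewrite -yE.
Qed.

Lemma measure_setI1 (S : set R) (x : R) : mu (S `&` [set x]) = 0%E.
Proof.
apply/eqP; rewrite eq_le measure_ge0 andbT -(lebesgue_measure_set1 x).
apply: le_measure; rewrite ?inE; [exact: measurable_setI1|exact: measurable_set1|].
by move=> y [].
Qed.

Lemma measure_tooth (S : set R) (a b c : R) : a < b -> b < c ->
  (forall y, a < y < b -> S y) -> (forall y, b < y < c -> ~ S y) ->
  measurable (S `&` `[a, c[) /\ mu (S `&` `[a, c[) = (b - a)%:E.
Proof.
move=> ab bc hS hN.
have E : S `&` `[a, c[ = (S `&` [set a]) `|` (`]a, b[ `|` (S `&` [set b])).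
  apply/seteqP; split => y.
    move=> [Sy]; rewrite /= in_itv /= => /andP[ay yc].
    move: ay; rewrite le_eqVlt => /orP[/eqP yE|ay]; first by subst y; left.
    have [yb|yb|yb] := ltgtP y b.
    - by right; left; rewrite /= in_itv /= ay.
    - by case: (hN y); rewrite ?yb.
    - by subst y; right; right.
  move=> [[Sy /= yE]|[|[Sy /= yE]]].
  - by subst y; split => //=; rewrite in_itv /= lexx (lt_trans ab).
  - rewrite /= in_itv /= => /andP[ay yb]; split; first by apply: hS; rewrite ay.
    by rewrite /= in_itv /= ltW// (lt_trans yb).
  - by subst y; split => //=; rewrite in_itv /= (ltW ab).
have m1 := measurable_setI1 S a; have m2 := measurable_setI1 S b.
have m3 : measurable (`]a, b[%classic : set R) by exact: measurable_itv.
have m4 : measurable (`]a, b[%classic `|` (S `&` [set b])) by exact: measurableU.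
split; first by rewrite E; exact: measurableU.
rewrite E measureU//; last first.
  apply/seteqP; split => // y [[_ /= ->]]; rewrite /= in_itv /= ltxx => -[//|[_ /= E']].
  by move: ab; rewrite E' ltxx.
rewrite measureU//; last first.
  by apply/seteqP; split => // y [] /= + [_ /= E']; rewrite in_itv /= E' ltxx andbF.
rewrite [X in (X + _)%E]measure_setI1 add0e [X in (_ + X)%E]measure_setI1 adde0.
have E2 : mu `]a, b[%classic = (b - a)%:E.
  by rewrite lebesgue_measure_itv /= lte_fin ab -EFinD.
exact: E2.
Qed.

Lemma measure_comb (S : set R) (a b : nat -> R) (q th : R) (n m : nat) :
  (forall j, (n <= j < n + m)%N -> [/\ a j.+1 < b j, b j < a j,
    forall y, a j.+1 < y < b j -> S y, forall y, b j < y < a j -> ~ S y &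
    `|(b j - a j.+1) - q * (a j - a j.+1)| <= th * (a j - a j.+1)]) ->
  measurable (S `&` `[a (n + m)%N, a n[) /\ exists2 l : R,
    mu (S `&` `[a (n + m)%N, a n[) = l%:E &
    `|l - q * (a n - a (n + m)%N)| <= th * (a n - a (n + m)%N).
Proof.
elim: m => [_|m IH h].
  rewrite addn0 set_itvco0 setI0; split; first exact: measurable0.
  by exists 0; rewrite ?measure0// !subrr !mulr0 subrr normr0.
have [|mS [l El hl]] := IH; first by move=> j /andP[h1 h2]; apply: h; rewrite h1 addnS ltnW.
have [|ab bc hS hN hq] := h (n + m)%N; first by rewrite leq_addr ltn_add2l ltnSn.
have anm : a (n + m)%N <= a n.
  have : forall i, (i <= m)%N -> a (n + i)%N <= a n.
    elim=> [|i IHi] im; first by rewrite addn0.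
    have [|h1 h2 _ _ _] := h (n + i)%N; first by rewrite leq_addr ltn_add2l ltnW.
    rewrite addnS; have := IHi (ltnW im); lra.
  exact.
have [mT ET] := measure_tooth ab bc hS hN.
have E : S `&` `[a (n + m.+1)%N, a n[ =
    (S `&` `[a (n + m).+1, a (n + m)%N[) `|` (S `&` `[a (n + m)%N, a n[).
  rewrite addnS -setIUr; congr (_ `&` _); apply/seteqP; split => y /=.
    rewrite !in_itv /= => /andP[h1 h2].
    by have [h3|h3] := ltP y (a (n + m)%N); [left; rewrite h1|right; rewrite h2].
  rewrite !in_itv /= => -[/andP[h1 h2]|/andP[h1 h2]].
    by rewrite h1 (lt_le_trans h2).
  by rewrite h2 andbT; apply: le_trans h1; lra.
split; first by rewrite E; exact: measurableU.
exists (b (n + m)%N - a (n + m).+1 + l).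
  have EU : mu ((S `&` `[a (n + m).+1, a (n + m)%N[) `|` (S `&` `[a (n + m)%N, a n[)) =
      (mu (S `&` `[a (n + m).+1, a (n + m)%N[) + mu (S `&` `[a (n + m)%N, a n[))%E.
    apply: measureU => //.
    apply/seteqP; split => // y [[_ /=]]; rewrite in_itv /= => /andP[_ h1] [_ /=].
    by rewrite in_itv /= => /andP[h2 _]; move: h1; rewrite ltNge h2.
  by rewrite E EU El ET EFinD.
by move: hq hl; rewrite addnS !ler_norml; lra.
Qed.

(** The comb covers slightly more than [[a, b]]; measurability on the larger interval passes to the
    smaller one. *)
Lemma Rintegral_indic_sub (S : set R) (a b c d : R) : c <= a -> b < d -> a < b ->
  measurable (S `&` `[c, d[) ->
  measurable (S `&` `[a, b]) /\
  (\int[mu]_(y in `[a, b]) \1_S y)%R = fine (mu (S `&` `[a, b])).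
Proof.
move=> ca bd ab mS.
have E : S `&` `[a, b] = (S `&` `[c, d[) `&` `[a, b].
  apply/seteqP; split => y /=; last by move=> [[]].
  rewrite !in_itv /= => -[Sy /andP[ay yb]]; split => //; last by rewrite ay.
  by split => //; rewrite (le_trans ca ay) (le_lt_trans yb bd).
have mT : measurable (S `&` `[a, b]) by rewrite E; apply: measurableI => //; exact: measurable_itv.
split => //; rewrite /Rintegral; congr fine.
transitivity (\int[mu]_(y in `[a, b]) (\1_(S `&` `[a, b]) y)%:E)%E.
  apply: eq_integral => y; rewrite inE /= => hy; congr EFin.
  rewrite !indicE; congr (_ %:R); congr nat_of_bool.
  apply/idP/idP => /set_mem h; apply/mem_set; first by split.
  by case: h.
rewrite integral_indic//.
by rewrite -setIA setIid.
Qed.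

End comb_measure.

(** * Outcomes on the interleaved intervals *)

Section leaving.
Variables (R : realType) (k L M r : R) (phi : R -> R -> R).
Hypothesis F : fold k L M r phi.
Variables e xs : R.
Hypothesis e0 : 0 < e.
Hypothesis e256 : 16 * (16 * e) <= k * r ^+ 2.
Hypothesis exs : e < xs.
Hypothesis xsk : xs < k * r ^+ 2 / 64.

Lemma leaves_ex x0 c ts p : - e < x0 <= e -> phi ts (- e) = 0 ->
  transit r phi e x0 c ts -> c < p -> `|p| <= k * r / L / 16 / 16 ->
  exists X t1, leaves r phi e xs X x0 p t1.
Proof.
move=> hx0 f0 t cp hp; have e0' := e0; have e256' := e256.
have k0 := fold_k F; have r0 := fold_r F; have kL := fold_kL F; have L0 : 0 < L by lra.
have rc : - r <= c by case: t => X [_ _ _ [? _ _] _].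
(* With this bound on [|p|] the loss [2 L r d] in [exit_ex] is [k r^2 / 128], half of what is
   allowed; the rest absorbs the terms in [e]. *)
pose d := k * r / L / 16 / 16.
have d0 : 0 <= d by rewrite !divr_ge0 ?mulr_ge0 ?(ltW k0) ?(ltW r0) ?(ltW L0).
have Ld : 16 * (16 * (L * d)) = k * r by rewrite /d; field; rewrite gt_eqF.
have kr2 : k * r <= 2 * (L * r) by rewrite mulrA ler_pM2r//; lra.
have Lr : 0 < L * r by rewrite mulr_gt0.
have dr : d <= r / 2 by rewrite -(ler_pM2l L0); clearbody d; lra.
have hp' := hp; rewrite -/d ler_norml in hp'.
have sm : e + 2 * L * r * (d + e) <= k * r ^+ 2 / 64.
  have h1 : 2 * L * r * d = k * r ^+ 2 / 128.
    rewrite (_ : 2 * L * r * d = 16 * (16 * (L * d)) * r / 128); last by field.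
    by rewrite Ld; field.
  have h2 : L * r * e <= 8^-1 * e by rewrite ler_pM2r// (fold_small2 F).
  rewrite mulrDr h1; lra.
have [X hX Xp] := sol_ex F (t0 := p) x0 ltac:(lra).
have pr : p <= r by lra.
have above := transit_fails F f0 t hX Xp cp pr.
have kr : 0 < k * r ^+ 2 by rewrite mulr_gt0// exprn_gt0.
have [t1 [ht1 Xt1 lt1]] := exit_ex F e0 hX Xp hx0 hp dr sm (ltW exs) (ltW xsk).
have [t2 [ht2 Xt2 lt2]] := exit_ex F e0 (xs := k * r ^+ 2 / 64) hX Xp hx0 hp dr sm
  (ltW (lt_trans exs xsk)) (lexx _).
have t1r : t1 < r.
  rewrite lt_neqAle; apply/andP; split; last by case/andP: ht1.
  apply/eqP => E; have [t2r|t2r] := ltP t2 t1.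
    have := lt1 t2; rewrite t2r andbT Xt2 => /(_ ltac:(by case/andP: ht2)).
    by rewrite ltNge (ltW xsk).
  have t21 : t2 = t1 by apply: le_anti; rewrite t2r E andbT; case/andP: ht2.
  by move: xsk; rewrite -Xt2 t21 Xt1 ltxx.
exists X, t1; split; [exact: hX|exact: Xp| |exact: Xt1|].
  by split=> //; [exact: le_lt_trans rc cp|case/andP: ht1].
move=> u /andP[pu ut]; split; first by apply: above; rewrite pu (le_trans ut (ltW t1r)).
by move=> ut'; apply: lt1; rewrite pu.
Qed.

End leaving.

Section outcomes.
Variables (R : realType) (k1 k2 L M r c1 c2 G1 G2 : R) (U : set (R * R)).
Variables (fl gl fr gr : R * R -> R) (phi1 phi2 gam1 gam2 : R -> R -> R).
Hypothesis F1 : fold k1 L M r phi1.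
Hypothesis F2 : fold k2 L M r phi2.
Hypothesis C1 : chart 1 c1 L G1 r U fr gr phi1 gam1.
Hypothesis C2 : chart (-1) c2 L G2 r U fl gl phi2 gam2.
Local Notation FL := (fun p => (fl p, gl p)).
Local Notation FR := (fun p => (fr p, gr p)).
Local Notation tr1 := (transit r phi1).
Local Notation tr2 := (transit r phi2).
Local Notation tan1 := (tangency k1 L phi1).
Local Notation tan2 := (tangency k2 L phi2).
Local Notation cut1 := (cutoff k1 L r phi1).
Local Notation cut2 := (cutoff k2 L r phi2).
Local Notation u_ := (useq k1 L r phi1 phi2).
Local Notation v_ := (vseq k2 L r phi1 phi2).
Local Notation band := (band k1 k2 L r phi1 phi2).
Local Notation band_cycle := (band_cycle r phi1 phi2).
Local Notation hat := (hat r phi1).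
Variables e xs : R.
Local Notation exits := (exits_right U FL FR e xs).

Definition narrow := [/\ band e, e < xs <= r,
  16 * (16 * e) <= k1 * r ^+ 2 /\ 16 * (16 * e) <= k2 * r ^+ 2,
  xs < k1 * r ^+ 2 / 64 /\ xs < k2 * r ^+ 2 / 64 &
  [/\ `|cut1 e| <= k1 * r / L / 16 / 16, `|tan2 e| <= k1 * r / L / 16 / 16,
      `|cut2 e| <= k2 * r / L / 16 / 16 & `|tan1 e| <= k2 * r / L / 16 / 16]].

Hypothesis N : narrow.

Let thr1 eps : threshold eps RightMode = (1 : R) * - eps. Proof. by rewrite mul1r. Qed.
Let thr2 eps : threshold eps LeftMode = (-1 : R) * - eps. Proof. by rewrite mulN1r opprK. Qed.
Let e0 : 0 < e. Proof. by case: N => -[[[]]]. Qed.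
Let exs : e < xs. Proof. by case: N => _ /andP[]. Qed.
Let xsr : xs <= r. Proof. by case: N => _ /andP[]. Qed.

Lemma exits_tr1 x0 p q : - e < x0 <= e -> tr1 e x0 p q -> - r < p -> q < r ->
  exits RightMode (x0, p) <-> exits LeftMode (- e, q).
Proof.
move=> hx0 t rp qr.
have := exits_transit F1 C1 (m := RightMode) (FL := FL) (FR := FR) erefl thr1 e0 exs xsr
  hx0 t rp qr.
by rewrite !mul1r.
Qed.

Lemma exits_tr2 p q : tr2 e e p q -> - r < p -> q < r ->
  exits LeftMode (- e, p) <-> exits RightMode (e, q).
Proof.
move=> t rp qr; have e0' := e0; have ee : - e < e <= e by rewrite gtrN /=.
have := exits_transit F2 C2 (m := LeftMode) (FL := FL) (FR := FR) erefl thr2 e0 exs xsr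
  ee t rp qr.
by rewrite !mulN1r opprK.
Qed.

Lemma abs_between (a b y d : R) : a < y < b -> `|a| <= d -> `|b| <= d -> `|y| <= d.
Proof. by rewrite !ler_norml; lra. Qed.

Lemma right_fails y : cut1 e < y < tan2 e -> exits RightMode (e, y).
Proof.
move=> hy; have [be _ [e1 _] [x1 _] [h1 h2 _ _]] := N; have e0' := e0.
have [[s1 _ _] [[tc1 _ _ _] _]] := be; have [t0 _] := tangencyP F1 s1.
have ee : - e < e <= e by rewrite gtrN /=.
have cy : cut1 e < y by case/andP: hy.
have [X [t1 hl]] := leaves_ex F1 e0 e1 exs x1 ee t0 tc1 cy (abs_between hy h1 h2).
have := leaves_right F1 C1 (m := RightMode) (FL := FL) (FR := FR) erefl thr1 e0 exs xsr erefl hl.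
by rewrite mul1r.
Qed.

Lemma left_fails y : cut2 e < y < tan1 e -> ~ exits LeftMode (- e, y).
Proof.
move=> hy; have [be _ [_ e1] [_ x1] [_ _ h1 h2]] := N; have e0' := e0.
have [[_ s2 _] [[_ tc2 _ _] _]] := be; have [t0 _] := tangencyP F2 s2.
have ee : - e < e <= e by rewrite gtrN /=.
have cy : cut2 e < y by case/andP: hy.
have [X [t1 hl]] := leaves_ex F2 e0 e1 exs x1 ee t0 tc2 cy (abs_between hy h1 h2).
have := leaves_left F2 C2 (m := LeftMode) (FL := FL) (FR := FR) erefl thr2 e0 exs xsr erefl hl.
by rewrite mulN1r.
Qed.

Lemma outcome_step a' a b' b y : band_cycle e a' a -> band_cycle e b' b -> - r < a' ->
  b' <= cut2 e -> b <= tan1 e -> a' < y < b' ->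
  exists2 y', a < y' < b & exits LeftMode (- e, y) <-> exits LeftMode (- e, y').
Proof.
move=> [pa ta2 ta1] [pb tb2 tb1] ra' hb' hb /andP[ay yb].
have [be _ _ _ _] := N; have [[s1 s2 _] [[tc1 tc2 _ _] _]] := be.
have h := gtrN e0.
have ee : - e < e <= e by rewrite gtrN /=.
have [t10 t1le] := tangencyP F1 s1; have [t20 t2le] := tangencyP F2 s2.
have r0 := fold_r F1.
have [q tq qt2] := transit_succeeds F2 t20 tc2 (ltW (lt_trans ra' ay)) (lt_le_trans yb hb').
have paq : pa < q by rewrite -(transit_mono F2 h ta2 tq).
have qpb : q < pb by rewrite -(transit_mono F2 h tq tb2).
have pbc : pb <= cut1 e by rewrite leNgt (transit_mono F1 h tc1 tb1) -leNgt.
have lt_tr ph x0 p1 p2 : transit r ph e x0 p1 p2 -> [/\ - r <= p1, p1 < p2 & p2 <= r].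
  by case=> X [_ _ _ ? _].
have [rpa paa ar] := lt_tr _ _ _ _ ta1.
have [rpb pbb br] := lt_tr _ _ _ _ tb1.
have [_ _ t1r] := lt_tr _ _ _ _ tc1.
have rq : - r < q := le_lt_trans rpa paq.
have [y' ty' y't] := transit_succeeds F1 t10 tc1 (ltW rq) (lt_le_trans qpb pbc).
have y'ab : a < y' < b.
  by rewrite -(transit_mono F1 h ta1 ty') -(transit_mono F1 h ty' tb1) paq qpb.
exists y' => //.
have A2 := exits_tr2 tq (lt_trans ra' ay) (lt_trans qpb (lt_le_trans pbb br)).
have A1 := exits_tr1 ee ty' rq (lt_le_trans y't t1r).
exact: iff_trans A2 A1.
Qed.

Lemma vseq_le n : v_ e n <= cut2 e.
Proof.
elim: n => [|n IH]; first exact: lexx.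
by apply: le_trans IH; exact/ltW/back_lt.
Qed.

(** In the first pair of intervals, a point after [v_ e 0] fails its left phase, and a point before
    it completes the left phase but then starts its right phase after the cutoff. All further
    intervals are carried forwards to this pair cycle by cycle. *)
Lemma outcomes_left_section n : - (r / 4) <= u_ e n ->
  (forall y, u_ e n.+1 < y < v_ e n -> exits LeftMode (- e, y)) /\
  (forall y, v_ e n < y < u_ e n -> ~ exits LeftMode (- e, y)).
Proof.
have [be _ _ _ _] := N; have [[s1 s2 De] [[tc1 tc2 rc1 rc2] [c12 c21 _ _]]] := be.
have r0 := fold_r F1; have r2 : 0 < r ^+ 2 by rewrite exprn_gt0.
have h := gtrN e0.
have [t10 t1le] := tangencyP F1 s1; have [t20 t2le] := tangencyP F2 s2.
have lt_tr ph x0 p1 p2 : transit r ph e x0 p1 p2 -> [/\ - r <= p1, p1 < p2 & p2 <= r].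
  by case=> X [_ _ _ ? _].
elim: n => [|n IH] hn.
  split; last exact: left_fails.
  move=> y /andP[uy yv].
  have [[[p tp2 tp1] _ _ _ _] [[u10 _] _ _ _ u8]] := seq_spec F1 F2 be hn.
  have ry : - r < y by have := sqr_le_half r0 u8; lra.
  have [q tq qt2] := transit_succeeds F2 t20 tc2 (ltW ry) yv.
  have pq : p < q by rewrite -(transit_mono F2 h tp2 tq).
  have cp : cut1 e <= p.
    by rewrite leNgt (transit_mono F1 h tp1 tc1) ltxx.
  have [_ _ t2r] := lt_tr _ _ _ _ tc2.
  apply/(exits_tr2 tq ry); first exact: lt_le_trans qt2 t2r.
  by apply: right_fails; rewrite qt2 andbT; exact: le_lt_trans pq.
have hn' : - (r / 4) <= u_ e n by apply: (le_trans hn); exact: useq_dec.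
have [IH1 IH2] := IH hn'.
have [[cu cv uv vu _] _] := seq_spec F1 F2 be hn'.
have [[cu' _ uv' vu' _] [_ _ _ v8 u8]] := seq_spec F1 F2 be hn.
have ra : - r < u_ e n.+2 by have := sqr_le_half r0 u8; lra.
split=> y hy.
  have [y' hy' E] := outcome_step cu' cv ra (vseq_le n.+1)
    (ltW (le_lt_trans (vseq_le n) c21)) hy.
  by apply/E; exact: IH1.
have {}ra := lt_trans ra uv'.
have u1 : u_ e n.+1 <= cut2 e by apply: (le_trans (ltW uv)); exact: vseq_le.
have [y' hy' E] := outcome_step cv cu ra u1 (useq_dec _ _ _ _ _ _ (leq0n n)) hy.
by move/E; exact: IH2.
Qed.

Lemma outcomes n : - (r / 4) <= u_ e n.+1 ->
  (forall y, hat e (u_ e n.+2) < y < hat e (v_ e n.+1) -> heads_right U FL FR e xs y) /\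
  (forall y, hat e (v_ e n.+1) < y < hat e (u_ e n.+1) -> ~ heads_right U FL FR e xs y).
Proof.
move=> hn; have [be _ _ _ _] := N; have [[s1 s2 De] [[tc1 tc2 rc1 rc2] [c12 c21 _ _]]] := be.
have r0 := fold_r F1; have r2 : 0 < r ^+ 2 by rewrite exprn_gt0.
have h' : - e < 0 by rewrite oppr_lt0.
have h : - e < 0 <= e by rewrite h' ltW.
have [t10 t1le] := tangencyP F1 s1.
have hn' : - (r / 4) <= u_ e n by apply: (le_trans hn); exact: useq_dec.
have [_ [ru1 _ _ _ u81]] := seq_spec F1 F2 be hn'.
have [[_ _ uv vu rv] [ru2 _ _ v8 u82]] := seq_spec F1 F2 be hn.
have [hR hL] := outcomes_left_section hn.
have [ta2 _ _ a2] := hatP F1 F2 be ru2 u82.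
have [tb _ _ _] := hatP F1 F2 be rv v8.
have [ta1 _ _ _] := hatP F1 F2 be ru1 u81.
have ra := sqr_le_gt r0 u82 De a2.
have ut : u_ e n.+1 < tan1 e.
  by apply: (@lt_le_trans _ _ (u_ e n)); [exact: back_lt|exact: useq_dec (leq0n n)].
have e64 : 64 * e <= k1 * r ^+ 2 by case: s1.
have t1r : tan1 e <= r by case: tc1 => X [_ _ _ [_ _ ?] _].
have tr4 : - (r / 2) <= tan1 e <= r by rewrite t1r andbT; apply: le_trans (ltW ut); lra.
have t10' : phi1 (tan1 e) (- e) <= 0 by rewrite t10.
(* Orbits start at [x = 0] rather than at [e], so the first right phase has its own separating start
   [c0]. *)
have [c0 tc0] := transit_ex F1 e0 e64 h tr4 t10'.
have bc : hat e (u_ e n.+1) < c0 by rewrite (transit_mono F1 h' ta1 tc0).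
have fwd a b y : tr1 e 0 (hat e a) a -> tr1 e 0 (hat e b) b -> b < tan1 e ->
    - r < hat e a -> hat e a < y < hat e b ->
    exists2 q, a < q < b & heads_right U FL FR e xs y <-> exits LeftMode (- e, q).
  move=> ta tb' bt ra' /andP[ay yb].
  have yc : y < c0 by apply: (lt_trans yb); rewrite (transit_mono F1 h' tb' tc0).
  have ry : - r < y by exact: lt_trans ay.
  have [q tq qt] := transit_succeeds F1 t10 tc0 (ltW ry) yc.
  exists q; first by rewrite -(transit_mono F1 h' ta tq) -(transit_mono F1 h' tq tb') ay yb.
  apply: exits_tr1 => //; exact: lt_le_trans qt t1r.
have rb : - r < hat e (v_ e n.+1).
  by apply: (lt_trans ra); rewrite (transit_mono F1 h' ta2 tb).
split=> y hy.
  have [q hq E] := fwd _ _ y ta2 tb (lt_trans vu ut) ra hy.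
  by apply/E; exact: hR.
have [q hq E] := fwd _ _ y tb ta1 ut rb hy.
by move/E; exact: hL.
Qed.

End outcomes.

(** If [x / y] is near [kap], the share [x / (x + y)] is near [kap / (1 + kap)]; stated without
    division by the total length so that the estimates add up over intervals. *)
Lemma share_near (R : realType) (kap th : R) : 0 < kap -> 0 < th ->
  exists2 d, 0 < d & forall x y : R, 0 < x -> 0 < y -> `|ln (x / y) - ln kap| <= d ->
    `|x - kap / (1 + kap) * (x + y)| <= th * (x + y).
Proof.
move=> k0 th0; have /cvgrPdist_lt/(_ _ th0) := @continuous_expR R (ln kap).
rewrite near_simpl lnK ?posrE// => /nbhs_ballP[d /= d0 h].
exists (d / 2); first by rewrite divr_gt0.
move=> x y x0 y0 hd; have xy : 0 < x / y by rewrite divr_gt0.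
have : `|kap - expR (ln (x / y))| < th.
  apply: h; rewrite /ball /= distrC; apply: (le_lt_trans hd); lra.
rewrite lnK ?posrE// => hk.
have -> : x - kap / (1 + kap) * (x + y) = (x / y - kap) * (y / (1 + kap)).
  by field; rewrite !gt_eqF//; lra.
rewrite normrM distrC; apply: ler_pM => //; first exact: ltW.
have k1 : 0 < 1 + kap by lra.
rewrite gtr0_norm ?divr_gt0// ler_pdivrMr//; nra.
Qed.

(** [m] lies between the measures [l2] and [l1] of an inner and an outer comb, which differ from the
    interval by less than one tooth, hence by at most [g], at each end. The error is at most
    [th * len] plus four times [g]. *)
Lemma fraction_bound (R : realFieldType) (m l1 l2 q th g len d ymin ymax ai ai1 aK aK1 : R) :
  len = ymax - ymin -> 0 < q -> q <= 1 -> 0 < th -> th <= q -> th * len <= d / 2 ->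
  0 < g -> g <= d / 8 -> g <= len / 2 ->
  l1 - q * (ai - aK1) <= th * (ai - aK1) -> - (th * (ai1 - aK)) <= l2 - q * (ai1 - aK) ->
  ai - ai1 <= g -> aK - aK1 <= g -> ymax < ai -> ai1 <= ymax -> aK1 < ymin -> ymin <= aK ->
  m <= l1 -> l2 <= m -> `|m - q * len| <= d.
Proof.
move=> len_eq q0 q1 th0 thq thd g0 gd gl hl1 hl2 gi gK hi hi' hK' hKK le1 le2.
have up : l1 <= (q + th) * (len + 2 * g).
  apply: (@le_trans _ _ ((q + th) * (ai - aK1))); first by clear -hl1; lra.
  rewrite ler_wpM2l ?addr_ge0 ?(ltW q0) ?(ltW th0)//; clear -len_eq gi gK hi' hKK; lra.
have lo : (q - th) * (len - 2 * g) <= l2.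
  apply: (@le_trans _ _ ((q - th) * (ai1 - aK))); last by clear -hl2; lra.
  rewrite ler_wpM2l ?subr_ge0//; clear -len_eq gi gK hi hK'; lra.
have qg : q * g <= g by rewrite ler_piMl// ltW.
have tg : th * g <= q * g by rewrite ler_wpM2r// ltW.
have tg0 : 0 <= th * g by rewrite mulr_ge0// ltW.
clear -up lo qg tg tg0 thd gd le1 le2.
have up' := le_trans le1 up; have lo' := le_trans lo le2; clear up lo le1 le2.
rewrite mulrDl !mulrDr in up'; rewrite mulrBl !mulrBr in lo'.
rewrite ler_norml; apply/andP; split; lra.
Qed.

Lemma gap_contra (R : realFieldType) (ymin ymax len g a a' : R) : len = ymax - ymin ->
  g <= len / 2 -> 0 < len -> a - a' <= g -> ymax < a -> a' < ymin -> False.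
Proof. by move=> *; lra. Qed.

(** * The fraction of a fixed interval *)

Section fraction.
Variables (R : realType) (k1 k2 L M r c1 c2 G1 G2 : R) (U : set (R * R)).
Variables (fl gl fr gr : R * R -> R) (phi1 phi2 gam1 gam2 : R -> R -> R).
Hypothesis F1 : fold k1 L M r phi1.
Hypothesis F2 : fold k2 L M r phi2.
Hypothesis C1 : chart 1 c1 L G1 r U fr gr phi1 gam1.
Hypothesis C2 : chart (-1) c2 L G2 r U fl gl phi2 gam2.
Local Notation FL := (fun p => (fl p, gl p)).
Local Notation FR := (fun p => (fr p, gr p)).
Local Notation u_ := (useq k1 L r phi1 phi2).
Local Notation v_ := (vseq k2 L r phi1 phi2).
Local Notation drift := (drift k1 k2).
Local Notation hat := (hat r phi1).
Local Notation narrow := (narrow k1 k2 L r phi1 phi2).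
Local Notation a_ := (fun e n => hat e (u_ e n)).
Local Notation b_ := (fun e n => hat e (v_ e n)).

Lemma cutoff_small k phi (d : R) : fold k L M r phi -> 0 < d ->
  \forall e \near 0^'+, `|cutoff k L r phi e| <= d /\ `|tangency k L phi e| <= d.
Proof.
move=> F d0; have k0 := fold_k F.
have th0 : 0 < 4 / k by rewrite divr_gt0.
have d2 : 0 < d ^+ 2 by rewrite exprn_gt0.
near=> e; have e0 : 0 < e by [].
have [_ _ h1 h2] : [/\ transit r phi e e (cutoff k L r phi e) (tangency k L phi e),
  cutoff k L r phi e < 0,
  `|cutoff k L r phi e ^+ 2 - tangency k L phi e ^+ 2 - 4 / k * e| <= 4 / k * e &
  tangency k L phi e ^+ 2 <= 4 / k * e] by near: e; exact: (cutoff_near F).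
have h3 : 4 / k * e <= d ^+ 2 / 4.
  rewrite mulrC -ler_pdivlMr//; near: e; apply: nbhs_right_le.
  by rewrite !divr_gt0.
have sq (x : R) : x ^+ 2 <= d ^+ 2 -> `|x| <= d.
  move=> hx; rewrite -(@ler_sqr _ `|x|) ?nnegrE ?(ltW d0)//.
  by rewrite real_normK ?num_real.
by move: h1; rewrite ler_norml => /andP[_ h1]; split; apply: sq; lra.
Unshelve. all: by end_near. Qed.

Lemma narrow_near xs : 0 < xs -> xs <= r -> xs < k1 * r ^+ 2 / 64 ->
  xs < k2 * r ^+ 2 / 64 -> \forall e \near 0^'+, narrow e xs.
Proof.
move=> xs0 xsr x1 x2; have k10 := fold_k F1; have k20 := fold_k F2; have r0 := fold_r F1.
have L0 : 0 < L by have := fold_kL F1; lra.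
have [d1 d1E] : exists d1, d1 = k1 * r / L / 16 / 16 by exists (k1 * r / L / 16 / 16).
have [d2 d2E] : exists d2, d2 = k2 * r / L / 16 / 16 by exists (k2 * r / L / 16 / 16).
have d10 : 0 < d1 by rewrite d1E !divr_gt0 ?mulr_gt0.
have d20 : 0 < d2 by rewrite d2E !divr_gt0 ?mulr_gt0.
have r2 : 0 < r ^+ 2 by rewrite exprn_gt0.
near=> e; split => //.
- by near: e; exact: (band_near F1 F2).
- rewrite xsr andbT; near: e; exact: nbhs_right_lt.
- have h1 : e <= k1 * r ^+ 2 / 16 / 16.
    by near: e; apply: nbhs_right_le; rewrite !divr_gt0 ?mulr_gt0.
  have h2 : e <= k2 * r ^+ 2 / 16 / 16.
    by near: e; apply: nbhs_right_le; rewrite !divr_gt0 ?mulr_gt0.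
  by split; rewrite mulrC -ler_pdivlMr// mulrC -ler_pdivlMr.
rewrite -d1E -d2E; have [h1 _] : `|cutoff k1 L r phi1 e| <= d1 /\ `|tangency k1 L phi1 e| <= d1.
  by near: e; exact: (cutoff_small F1).
have [_ h2] : `|cutoff k2 L r phi2 e| <= d1 /\ `|tangency k2 L phi2 e| <= d1.
  by near: e; exact: (cutoff_small F2).
have [h3 _] : `|cutoff k2 L r phi2 e| <= d2 /\ `|tangency k2 L phi2 e| <= d2.
  by near: e; exact: (cutoff_small F2).
have [_ h4] : `|cutoff k1 L r phi1 e| <= d2 /\ `|tangency k1 L phi1 e| <= d2.
  by near: e; exact: (cutoff_small F1).
by [].
Unshelve. all: by end_near. Qed.

(** The last clause bounds the length of a tooth: its product with [- ymax] is at most the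
    difference of the squares of its ends, which is [O(e)]. *)
Lemma tooth e xs n (ymax : R) : narrow e xs -> - (r / 4) <= u_ e n.+1 ->
  [/\ a_ e n.+2 < b_ e n.+1, b_ e n.+1 < a_ e n.+1 &
   [/\ a_ e n.+2 < u_ e n.+2, n.+2%:R * e <= L * a_ e n.+2 ^+ 2 &
    ymax < 0 -> a_ e n.+2 <= ymax -> (a_ e n.+1 - a_ e n.+2) * - ymax <= 2 * drift * e]].
Proof.
move=> N hn; have [be _ _ _ _] := N; have [[s1 s2 De] _] := be.
have e0 : 0 < e by case: s1.
have kL := fold_kL F1; have L0 : 0 < L by have := fold_k F1; lra.
have hn' : - (r / 4) <= u_ e n by apply: (le_trans hn); exact: useq_dec.
have [_ [ru1 _ _ _ u81]] := seq_spec F1 F2 be hn'.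
have [[_ _ uv vu rv] [ru2 nu le_u v8 u82]] := seq_spec F1 F2 be hn.
have [ta2 a20 a2u a2] := hatP F1 F2 be ru2 u82.
have [tb _ _ _] := hatP F1 F2 be rv v8.
have [ta1 a10 a1u _] := hatP F1 F2 be ru1 u81.
have h : - e < 0 by lra.
have ab : a_ e n.+2 < b_ e n.+1 by rewrite (transit_mono F1 h ta2 tb).
have ba : b_ e n.+1 < a_ e n.+1 by rewrite (transit_mono F1 h tb ta1).
split => //; split.
- by case: ta2 => X [_ _ _ [_ ? _] _].
- by apply: (le_trans nu); rewrite ler_pM2l.
move=> y0 ay.
have d0 : 0 <= hat e (u_ e n.+1) - hat e (u_ e n.+2) by lra.
have h1 : (hat e (u_ e n.+1) - hat e (u_ e n.+2)) * - ymax <=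
    (hat e (u_ e n.+1) - hat e (u_ e n.+2)) * (- hat e (u_ e n.+1) - hat e (u_ e n.+2)).
  by rewrite ler_wpM2l//; lra.
apply: (le_trans h1).
have -> : (hat e (u_ e n.+1) - hat e (u_ e n.+2)) * (- hat e (u_ e n.+1) - hat e (u_ e n.+2)) =
  hat e (u_ e n.+2) ^+ 2 - hat e (u_ e n.+1) ^+ 2 by ring.
lra.
Qed.

Lemma in_range e xs n j y : narrow e xs -> - (r / 4) <= u_ e n.+1 -> - (r / 4) <= y ->
  (forall i, (i <= j)%N -> y <= a_ e (n.+1 + i)%N) -> - (r / 4) <= u_ e (n.+1 + j)%N.
Proof.
move=> N hn hy; elim: j => [_|j IH h]; first by rewrite addn0.
have hj : - (r / 4) <= u_ e (n.+1 + j)%N by apply: IH => i ij; apply: h; exact: leqW.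
rewrite addSn in hj; have [_ _ [au _ _]] := tooth 0 N hj.
have := h j.+1 (leqnn _); rewrite addnS addSn; lra.
Qed.

(** Squares of the comb points are at least [n * e / L], so they eventually exceed any fixed bound;
    as long as they do not, [in_range] allows another cycle. *)
Lemma reach_index e xs n y : narrow e xs -> - (r / 4) <= u_ e n.+1 -> - (r / 4) <= y ->
  exists j, a_ e (n.+1 + j)%N < y.
Proof.
move=> N hn hy; apply: contrapT => no.
have all i : y <= a_ e (n.+1 + i)%N by rewrite leNgt; apply/negP => h; apply: no; exists i.
have e0 : 0 < e by case: N => -[[[]]].
have kL := fold_kL F1; have L0 : 0 < L by have := fold_k F1; lra.
have r0 := fold_r F1.
pose B := L * (r / 4) ^+ 2 / e.
have B0 : 0 <= B.
  by apply: divr_ge0; [apply: mulr_ge0; [exact: ltW|exact: sqr_ge0]|exact: ltW].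
have [j hj] : exists j : nat, B < j%:R by exists (Num.bound B); exact: archi_boundP.
have rj : - (r / 4) <= u_ e (n.+1 + j)%N by apply: (in_range N hn hy) => i _; exact: all.
rewrite addSn in rj; have [_ _ [_ nu _]] := tooth 0 N rj.
have ha := all j.+1; rewrite addnS addSn in ha.
have [be _ _ _ _] := N.
have [_ [ru2 _ _ _ u82]] := seq_spec F1 F2 be rj.
have [_ a0 _ _] := hatP F1 F2 be ru2 u82.
have : L * (hat e (u_ e (n + j).+2)) ^+ 2 <= L * (r / 4) ^+ 2.
  by rewrite ler_pM2l//; nra.
have jn : j%:R <= (n + j).+2%:R :> R by rewrite ler_nat -!addSn leq_addl.
have : j%:R * e <= (n + j).+2%:R * e by rewrite ler_pM2r.
move: hj; rewrite /B ltr_pdivrMr//; lra.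
Qed.

Lemma fraction_near xs ymin ymax (d : R) : 0 < xs -> xs <= r -> xs < k1 * r ^+ 2 / 64 ->
  xs < k2 * r ^+ 2 / 64 -> - (r / 4) <= ymin -> ymin < ymax -> ymax < 0 -> 0 < d ->
  \forall e \near 0^'+,
    `|\int[lebesgue_measure]_(y in `[ymin, ymax]) sigma U FL FR e xs y
      - k2 / (k1 + k2) * (ymax - ymin)| <= d.
Proof.
move=> xs0 xsr x1 x2 ry yy y0 d0.
have k10 := fold_k F1; have k20 := fold_k F2; have r0 := fold_r F1.
have L0 : 0 < L by have := fold_kL F1; lra.
have D0 := drift_gt0 F1 F2.
have [len len_eq] : exists len, len = ymax - ymin by exists (ymax - ymin).
have len0 : 0 < len by lra.
have [q qE] : exists q, q = k2 / (k1 + k2) by exists (k2 / (k1 + k2)).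
have k120 : 0 < k1 + k2 by lra.
have q0 : 0 < q by rewrite qE divr_gt0.
have q1 : q <= 1 by rewrite qE ler_pdivrMr// mul1r; lra.
(* The bound [q] keeps the lower density [q - th] nonnegative; the other one limits the accumulated
   error of the shares to [d / 2]. *)
pose th := Num.min q (d / (2 * len)).
have th0 : 0 < th by rewrite lt_min q0 divr_gt0 ?mulr_gt0.
have thq : th <= q by rewrite ge_min lexx.
have thd : th * len <= d / 2.
  apply: (@le_trans _ _ (d / (2 * len) * len)).
    by rewrite ler_pM2r// ge_min lexx orbT.
  by rewrite le_eqVlt; apply/orP; left; apply/eqP; field; rewrite gt_eqF.
clearbody th.
pose g := Num.min (d / 8) (len / 2).
have g0 : 0 < g by rewrite lt_min !divr_gt0.
have gd : g <= d / 8 by rewrite ge_min lexx.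
have gl_ : g <= len / 2 by rewrite ge_min lexx orbT.
clearbody g.
have kap0 : 0 < k2 / k1 by rewrite divr_gt0.
have [dl dl0 hshare] := share_near kap0 th0.
have [n0 hrho] := rhohat_near F1 F2 dl0.
near=> e; have e0 : 0 < e by [].
have N : narrow e xs by near: e; exact: narrow_near.
have hr : forall n, (n0 <= n)%N -> - (r / 4) <= u_ e n ->
  `|rhohat k1 k2 L r phi1 phi2 e n - ln (k2 / k1)| <= dl by near: e; exact: hrho.
have [be [hn0 hsm]] : band k1 k2 L r phi1 phi2 e /\ - (r / 4) <= u_ e n0.+1 /\
    forall j, (j <= n0.+1)%N -> u_ e j ^+ 2 <= n0.+2%:R * drift * e.
  by near: e; exact: (useq_small F1 F2).
have small : (n0.+3%:R * drift) * e < ymax ^+ 2.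
  rewrite mulrC -ltr_pdivlMr ?mulr_gt0//; near: e; apply: nbhs_right_lt.
  by apply: divr_gt0; [rewrite exprn_even_gt0//= lt_eqF|rewrite mulr_gt0].
have hg : 2 * drift * e <= g * - ymax.
  rewrite mulrC -ler_pdivlMr ?mulr_gt0//; near: e; apply: nbhs_right_le.
  by rewrite divr_gt0 ?mulr_gt0// oppr_gt0.
have hn0' : - (r / 4) <= u_ e n0 by apply: (le_trans hn0); exact: useq_dec.
(* The teeth with index at most [n0], whose quotients are not controlled, lie within [O(sqrt e)] of
   the fold and thus above [ymax]. *)
have top : ymax < a_ e n0.+1.
  have [_ [ru1 _ _ _ u8]] := seq_spec F1 F2 be hn0'.
  have [_ a0 _ ha] := hatP F1 F2 be ru1 u8.
  have := hsm n0.+1 (leqnn _) => hs.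
  rewrite ltNge; apply/negP => h.
  have h1 : ymax ^+ 2 <= hat e (u_ e n0.+1) ^+ 2.
    by rewrite -sqrrN -[leRHS]sqrrN ler_sqr ?nnegrE ?oppr_ge0 ?(ltW y0) ?(ltW a0)// lerN2.
  have h2 : n0.+3%:R * drift * e = n0.+2%:R * drift * e + drift * e.
    have -> : n0.+3%:R = n0.+2%:R + 1 :> R by rewrite natr1.
    by ring.
  move: small; rewrite h2 ltNge => /negP; apply; apply: (le_trans h1); apply: (le_trans ha).
  by rewrite lerD2r.
have exI : exists j, a_ e (n0.+1 + j)%N <= ymax.
  have [j hj] := reach_index N hn0 (le_trans ry (ltW yy)).
  by exists j; exact: ltW.
have exK := reach_index N hn0 ry.
(* [i'] and [K'] are the first indices at which the comb passes [ymax] and [ymin]. Both are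
   successors because the comb starts above [ymax]; their predecessors give the outer comb its upper
   end and the inner one its lower end. *)
have [i' hi' mini] : exists2 i, a_ e (n0.+1 + i)%N <= ymax &
    forall j, a_ e (n0.+1 + j)%N <= ymax -> (i <= j)%N.
  by case: (ex_minnP exI) => i h1 h2; exists i.
have [K' hK' minK] : exists2 K, a_ e (n0.+1 + K)%N < ymin &
    forall j, a_ e (n0.+1 + j)%N < ymin -> (K <= j)%N.
  by case: (ex_minnP exK) => i h1 h2; exists i.
case: i' hi' mini => [|i] hi' mini; first by move: hi'; rewrite addn0 leNgt top.
have hi : ymax < a_ e (n0.+1 + i)%N.
  by rewrite ltNge; apply/negP => h; have := mini _ h; rewrite ltnn.
case: K' hK' minK => [|K] hK' minK; first by move: hK'; rewrite addn0 ltNge (ltW (lt_trans yy top)).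
have hK j : (j <= K)%N -> ymin <= a_ e (n0.+1 + j)%N.
  by move=> jK; rewrite leNgt; apply/negP => /minK; rewrite ltnNge jK.
have iK : (i <= K)%N by have := mini K.+1 (ltW (lt_trans hK' yy)); rewrite ltnS.
have rng j : (j <= K)%N -> - (r / 4) <= u_ e (n0.+1 + j)%N.
  move=> jK; apply: (in_range N hn0 ry) => l lj; apply: hK; exact: leq_trans lj jK.
have teeth j : (n0.+1 <= j < n0.+1 + K.+1)%N -> [/\ a_ e j.+1 < b_ e j, b_ e j < a_ e j,
    forall y, a_ e j.+1 < y < b_ e j -> [set y | heads_right U FL FR e xs y] y,
    forall y, b_ e j < y < a_ e j -> ~ [set y | heads_right U FL FR e xs y] y &
    `|(b_ e j - a_ e j.+1) - q * (a_ e j - a_ e j.+1)| <= th * (a_ e j - a_ e j.+1)].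
  case: j => [//|l] /andP[nl lK].
  have rj : - (r / 4) <= u_ e l.+1.
    have lK' : (l.+1 - n0.+1 <= K)%N by rewrite leq_subLR -ltnS -addnS.
    by have := rng _ lK'; rewrite subnKC.
  have [ab ba _] := tooth 0 N rj.
  have [hR hL] := outcomes F1 F2 C1 C2 N rj.
  split => //.
  have := hr l.+1 (ltnW nl) rj; rewrite /rhohat.
  have X0 : 0 < hat e (v_ e l.+1) - hat e (u_ e l.+2) by rewrite subr_gt0.
  have Y0 : 0 < hat e (u_ e l.+1) - hat e (v_ e l.+1) by rewrite subr_gt0.
  move=> /(hshare _ _ X0 Y0).
  have -> : k2 / k1 / (1 + k2 / k1) = q.
    by rewrite qE; field; apply/andP; split; rewrite gt_eqF//; lra.
  have -> // : hat e (v_ e l.+1) - hat e (u_ e l.+2) + (hat e (u_ e l.+1) - hat e (v_ e l.+1)) =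
    hat e (u_ e l.+1) - hat e (u_ e l.+2).
  by ring.
have gap j : (j <= K)%N -> a_ e (n0.+1 + j).+1 <= ymax ->
    a_ e (n0.+1 + j)%N - a_ e (n0.+1 + j).+1 <= g.
  move=> /rng rj h; rewrite addSn in rj h *; have [_ _ [_ _ hgap]] := tooth ymax N rj.
  have ny : 0 < - ymax by rewrite oppr_gt0.
  by rewrite -(ler_pM2r ny); exact: le_trans (hgap y0 h) hg.
rewrite !addnS in hi' hK'.
have gi := gap i iK hi'.
have gK := gap K (leqnn _) (ltW (lt_trans hK' yy)).
(* If the same tooth contained both ends, its length would exceed [g], which is at most half the
   length of the interval. *)
have iltK : (i < K)%N.
  rewrite ltn_neqAle iK andbT; apply/eqP => E; subst i; exact: gap_contra len_eq gl_ len0 gi hi hK'.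
have E1 : (n0.+1 + i + (K.+1 - i) = (n0.+1 + K).+1)%N.
  by rewrite -addnA subnKC ?(leq_trans iK)// addnS.
have E2 : ((n0.+1 + i).+1 + (K - i.+1) = n0.+1 + K)%N by rewrite -addnS -addnA subnKC.
have sub1 j : (n0.+1 + i <= j < n0.+1 + i + (K.+1 - i))%N -> (n0.+1 <= j < n0.+1 + K.+1)%N.
  rewrite E1 => /andP[h1 h2].
  by rewrite (leq_trans (leq_addr _ _) h1) addnS.
have sub2 j : ((n0.+1 + i).+1 <= j < (n0.+1 + i).+1 + (K - i.+1))%N ->
    (n0.+1 <= j < n0.+1 + K.+1)%N.
  rewrite E2 => /andP[h1 h2].
  by rewrite (leq_trans (leqW (leq_addr _ _)) h1) addnS ltnS ltnW.
have [mS1 [l1 El1 hl1]] := @measure_comb R [set y | heads_right U FL FR e xs y] (a_ e) (b_ e)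
  q th (n0.+1 + i)%N (K.+1 - i)%N (fun j hj => teeth j (sub1 j hj)).
have [mS2 [l2 El2 hl2]] := @measure_comb R [set y | heads_right U FL FR e xs y] (a_ e) (b_ e)
  q th (n0.+1 + i).+1 (K - i.+1)%N (fun j hj => teeth j (sub2 j hj)).
rewrite E1 in mS1 El1 hl1; rewrite E2 in mS2 El2 hl2.
have [mS EI] := Rintegral_indic_sub (ltW hK') hi yy mS1.
have le1 : (lebesgue_measure ([set y | heads_right U FL FR e xs y] `&` `[ymin, ymax]) <= l1%:E)%E.
  rewrite -El1; apply: le_measure; rewrite ?inE// => y [Sy]; rewrite /= !in_itv /= => /andP[h1 h2].
  by split => //=; rewrite ?in_itv /= (le_trans (ltW hK') h1) (le_lt_trans h2 hi).
have le2 : (l2%:E <= lebesgue_measure ([set y | heads_right U FL FR e xs y] `&` `[ymin, ymax]))%E.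
  rewrite -El2; apply: le_measure; rewrite ?inE// => y [Sy]; rewrite /= !in_itv /= => /andP[h1 h2].
  by split => //=; rewrite ?in_itv /= (le_trans (hK K (leqnn _)) h1) (le_trans (ltW h2) hi').
rewrite /sigma EI -qE -len_eq.
move: le1 le2; case: (lebesgue_measure _) => [m| |] //=; rewrite !lee_fin => le1 le2.
move: hl1 hl2; rewrite !ler_norml => /andP[_ hl1] /andP[hl2 _].
rewrite -ler_norml; apply: (fraction_bound len_eq q0 q1 th0 thq thd g0 gd gl_ hl1 hl2 gi gK
  hi hi' hK' (hK K (leqnn _)) le1 le2).
Unshelve. all: by end_near. Qed.

End fraction.

Unset Implicit Arguments.
Set Strict Implicit.

Theorem lemma1 (R : realType) (A B : R) (U : set (R * R))
    (fL gL fR gR : R * R -> R)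
    (hA : 0 < A) (hB : 0 < B)
    (hU : open U) (hU0 : U (0, 0))
    (hfL : smooth_on U fL) (hgL : smooth_on U gL)
    (hfR : smooth_on U fR) (hgR : smooth_on U gR)
    (hfL0 : fL (0, 0) = 0) (hfR0 : fR (0, 0) = 0)
    (hdfL : dy fL (0, 0) = - A) (hdfR : dy fR (0, 0) = 1)
    (hgL0 : gL (0, 0) = B) (hgR0 : gR (0, 0) = 1) :
  \forall xs \near 0^'+,
    exists2 eta : R, 0 < eta &
      forall ymin ymax : R, - eta < ymin -> ymin < ymax -> ymax < 0 ->
        q_right U (fun p => (fL p, gL p)) (fun p => (fR p, gR p)) eps xs
          `[ymin, ymax] @[eps --> 0^'+] --> A / (A + B).
Proof.
have AB0 : 0 < A / B by rewrite divr_gt0.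
have kap : A / B / (1 + A / B) = A / (A + B) by field; rewrite !gt_eqF// addr_gt0.
have gL0 : 0 < gL (0, 0) by rewrite hgL0.
have gR0 : 0 < gR (0, 0) by rewrite hgR0.
have hkR : 1 * dy fR (0, 0) = 1 * gR (0, 0) by rewrite hdfR hgR0.
have hkL : -1 * dy fL (0, 0) = A / B * gL (0, 0).
  by rewrite hdfL hgL0 mulN1r opprK divfK// gt_eqF.
have [L1 [M1 [c1 [G1 [L10 H1]]]]] := fold_chart_ex hU hU0 (hfR 2%N) (hgR 2%N)
  (or_introl erefl) hfR0 gR0 ltr01 hkR.
have [L2 [M2 [c2 [G2 [L20 H2]]]]] := fold_chart_ex hU hU0 (hfL 2%N) (hgL 2%N)
  (or_intror erefl) hfL0 gL0 AB0 hkL.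
(* The right mode is a fold with [k1 = 1] and the reflected left mode one with [k2 = A / B]; common
   constants let both share one box. *)
pose L := Num.max L1 L2; pose M := Num.max M1 M2.
have [r1 r10 {}H1] := H1 L M ltac:(by rewrite le_max lexx) ltac:(by rewrite le_max lexx).
have [r2 r20 {}H2] := H2 L M ltac:(by rewrite le_max lexx orbT) ltac:(by rewrite le_max lexx orbT).
pose r := Num.min r1 r2.
have r0 : 0 < r by rewrite lt_min r10.
have [F1 C1] := H1 r ltac:(by rewrite r0 ge_min lexx).
have [F2 C2] := H2 r ltac:(by rewrite r0 ge_min lexx orbT).
(* [r / 4] is the range in which the backward sequences are controlled; it does not depend on
   [xs]. *)
near=> xs; exists (r / 4); first by rewrite divr_gt0.
move=> ymin ymax ylo yy y0; apply/cvgrPdist_le => d d0.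
have len0 : 0 < ymax - ymin by rewrite subr_gt0.
have xs0 : 0 < xs by [].
have xsr : xs <= r by near: xs; exact: nbhs_right_le.
have x1 : xs < 1 * r ^+ 2 / 64.
  by near: xs; apply: nbhs_right_lt; rewrite divr_gt0 ?mulr_gt0 ?exprn_gt0.
have x2 : xs < A / B * r ^+ 2 / 64.
  near: xs; apply: nbhs_right_lt; apply: divr_gt0 => //.
  by apply: mulr_gt0 => //; exact: exprn_gt0.
have dl : 0 < d * (ymax - ymin) by rewrite mulr_gt0.
apply: filterS (fraction_near F1 F2 C1 C2 xs0 xsr x1 x2 (ltW ylo) yy y0 dl) => e.
rewrite /q_right Rintegral_cst; last exact: measurable_itv.
have muI : lebesgue_measure (`[ymin, ymax]%classic : set R) = (ymax - ymin)%:E.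
  by rewrite lebesgue_measure_itv /= lte_fin yy -EFinD.
rewrite [X in _ / (1 * X)](_ : _ = ymax - ymin) ?mul1r; last exact: (congr1 fine muI).
set I := (X in `|X - _|) => h.
have -> : A / (A + B) - I / (ymax - ymin) =
    - (I - A / B / (1 + A / B) * (ymax - ymin)) / (ymax - ymin).
  rewrite kap; move: (A / (A + B)) => q.
  by rewrite opprB mulrBl mulfK// gt_eqF.
by rewrite normrM normrN normfV (gtr0_norm len0) ler_pdivrMr.
Unshelve. all: by end_near. Qed.
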